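(* Let $h\colon(0,\frac12]\to[0,+\infty)$ be a continuous (strictly) decreasing function such that $\int_0^{1/2}h(a)\,da=+\infty$. Suppose that $h$ satisfies at least one of the following two conditions: (i) the function $\theta\mapsto\theta^2h(\theta)$ does not decrease on $(0,\frac12]$, and $|\log\theta|=O(h(\theta))$ as $\theta\to0$; (ii) $\displaystyle\limsup_{a\to\infty}\frac{h^{-1}(a)}{h^{-1}(2a)}<2$. Let $\rho$ be the absolutely continuous measure on $\mathbb T$ whose density with respect to $m$ at the point $e^{2\pi i\theta}$, $|\theta|\le\frac12$, equals $e^{-h(|\theta|)}$. Then there exist $c,C>0$ and $n_0$, not depending on $n$, such that for all $n\ge n_0$ $$c\int_0^{1/2}h_A(a)\,da\le|\log e_n(\rho)|\le C\int_0^{1/2}h_A(a)\,da,$$ where $A=A(n)$ is the solution of $n\,h^{-1}(A)=A$ and $h_A=\min(h,A)$.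
   Context: $\mathbb T$ is the unit circle and $m$ is Lebesgue measure on $\mathbb T$ normalized by $m(\mathbb T)=1$. For a finite positive measure $\rho$ on $\mathbb T$, $e_n(\rho)=\min_{q_0,\dots,q_{n-1}\in\mathbb C}\Bigl(\int_{\mathbb T}|q_0+q_1t+\dots+q_{n-1}t^{n-1}+t^n|^2\,d\rho(t)\Bigr)^{1/2}$. $h^{-1}$ denotes the inverse function of $h$, defined on $[h(\frac12),+\infty)$. *)

(* Defs.v *)
From HB Require Import structures.
From mathcomp Require Import all_boot all_order all_algebra.
From mathcomp Require Import complex.
From mathcomp Require Import all_classical all_reals all_analysis.
From mathcomp Require Import measurable_realfun.

Set Implicit Arguments.
Unset Strict Implicit.
Unset Printing Implicit Defensive.

Import Order.TTheory GRing.Theory Num.Theory.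
Import numFieldNormedType.Exports.

Local Open Scope classical_set_scope.
Local Open Scope ring_scope.
Local Open Scope complex_scope.

Section unit_circle.
Variable R : realType.

Record circle : Type := Circle {
  circle_val :> R[i];
  _ : `|circle_val| == 1
}.

HB.instance Definition _ := [isSub for circle_val].
HB.instance Definition _ := [Choice of circle by <:].

Lemma circle_pt_subproof (x : R) : `|cos x +i* sin x| == 1.
Proof. by rewrite normc_def /= cos2Dsin2 sqrtr1. Qed.

(* [circle_pt theta] is e^{2 pi i theta}. *)
Definition circle_pt (theta : R) : circle :=
  Circle (circle_pt_subproof (2 * pi * theta)).

HB.instance Definition _ := isPointed.Build circle (circle_pt 0).

Definition circle_coords (t : circle) : R * R :=
  (complex.Re t, complex.Im t).

(* The Borel sigma-algebra of the circle, i.e. the trace of the Borel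
   sigma-algebra of the plane R * R. *)
HB.instance Definition _ :=
  Measurable.copy circle (g_sigma_algebra_preimageType circle_coords).

Lemma measurable_circle_pt : measurable_fun setT circle_pt.
Proof.
have mE : measurable_fun setT ( *%R (2 * pi : R)) := @mulrl_measurable R _ _.
have mf : measurable_fun setT
    (fun x : R => (cos (2 * pi * x), sin (2 * pi * x))).
  apply/measurable_fun_pairP; split.
    exact: measurableT_comp (continuous_measurable_fun (@continuous_cos R)) mE.
  exact: measurableT_comp (continuous_measurable_fun (@continuous_sin R)) mE.
move=> _ _ [B mB <-]; rewrite setTI.
exact: (mf measurableT B mB).
Qed.

(* Arc length on the circle, normalized to have total mass 1. *)
Definition circle_measure : set circle -> \bar R :=
  pushforward
    (mrestr lebesgue_measure (measurable_itv `[- 2^-1 : R, 2^-1]))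
    circle_pt.

Let circle_measure0 : circle_measure set0 = 0%E.
Proof. by rewrite /circle_measure /pushforward preimage_set0 measure0. Qed.

Let circle_measure_ge0 A : (0 <= circle_measure A)%E.
Proof. by rewrite /circle_measure /pushforward measure_ge0. Qed.

Let circle_measure_sigma_additive : semi_sigma_additive circle_measure.
Proof.
have mp (B : set circle) : measurable B -> measurable (circle_pt @^-1` B).
  by move=> mB; rewrite -[X in measurable X]setTI; exact: measurable_circle_pt.
move=> F mF tF mUF; rewrite /circle_measure /pushforward preimage_bigcup.
apply: measure_semi_sigma_additive.
- by move=> n; exact: mp.
- apply/trivIsetP => /= i j _ _ ij; rewrite -preimage_setI.
  by move/trivIsetP : tF => /(_ _ _ _ _ ij) ->//; rewrite preimage_set0.
- by rewrite -preimage_bigcup; exact: mp.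
Qed.

HB.instance Definition _ := isMeasure.Build _ _ _ circle_measure
  circle_measure0 circle_measure_ge0 circle_measure_sigma_additive.

Lemma circle_measureT : circle_measure setT = 1%E.
Proof.
rewrite /circle_measure /pushforward preimage_setT /mrestr setTI.
rewrite lebesgue_measure_itv /= lte_fin ifT.
  by rewrite -EFinD opprK; congr EFin; rewrite [RHS]splitr div1r.
by rewrite (@lt_trans _ _ 0) ?oppr_lt0 ?invr_gt0.
Qed.

(* The minimum in the definition of e_n(rho) is taken over an affine space of
   finite dimension, hence attained; it is written here as an infimum. *)
Definition monic_err (n : nat) (rho : {finite_measure set circle -> \bar R})
    : R :=
  inf [set Num.sqrt (\int[rho]_t
             Normc.normc ((\sum_(i < n) q i * circle_val t ^+ i)
                          + circle_val t ^+ n) ^+ 2)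
      | q in [set: 'I_n -> R[i]]].

End unit_circle.

Section inverse_and_level.
Variable R : realType.
Implicit Type h : R -> R.

(* [hinv h y] is 0 when y is not a value of h on (0, 1/2]. *)
Definition hinv h : R -> R := 'pinv_(fun=> 0) `]0, 2^-1] h.

Definition is_level h (n : nat) (A : R) : Prop :=
  h 2^-1 <= A /\ n%:R * hinv h A = A.

End inverse_and_level.

(* Main.v *)
Require Import Defs.
From HB Require Import structures.
From mathcomp Require Import all_boot all_order all_algebra.
From mathcomp Require Import complex.
From mathcomp Require Import all_classical all_reals all_analysis.
From mathcomp Require Import measurable_realfun.
From mathcomp Require Import ring lra zify.

(** Let [d] be the solution of [n * d = h d] and [A = h d], so that [d = hinv h
    A], and let [hcut h d] be the even profile equal to [h |x|] for [|x| >= d]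
    and frozen at the value [A] in the gap [|x| <= d]. It equals [min (h, A)]
    on (0, 1/2]; the claim is that [- ln (monic_err n rho)] is comparable to
    [S], the integral of [hcut h d] over [0, 1/2].

    The bound [- ln (monic_err n rho) <= C * S] holds for every decreasing [h].
    For a continuous [G], a monic polynomial [p] satisfies Szego's inequality
    (the integral of [|p|^2 exp (- G)] is at least the exponential of minus the
    integral of [G], [szego_lower_bound]), because the mean of [ln |ee x -
    z|^2] over the circle is [0] when [|z| < 1], and zeros outside the disk can
    be moved into it without increasing [|p|] on the circle. Take [G = 2060 *
    hcut h d]. Off the gap, [exp (- G)] is at most the weight [exp (- h)]. In
    the gap, [exp (- G)] is the constant [exp (- 2060 * A)], and the Remez
    inequality [remez_exp] bounds the integral of [|p|^2] over the gap by [exp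
    (2059 * n * d) = exp (2059 * A)] times its integral off the gap, where the
    weight is at least [exp (- A)].

    The Remez inequality itself is obtained from translations. If [E] is the
    translation by a small step [s], expand [1 = (E + (1 - E)) ^ (2 K)]. The
    terms with at least [K] factors [E] only involve values of the polynomial
    at a distance at least [K s >= 2 d] to the right, outside the gap; in the
    others [1 - E] occurs more than [K] times, and by Parseval's identity it
    has small norm on polynomials of degree [n] if [n * s] is small
    ([remez_l2]).

    The bound [c * S <= - ln (monic_err n rho)] needs a test polynomial.

    If [x^2 h(x)] is nondecreasing, a polynomial is assembled from one factor
    for each dyadic scale [s]. The factor has constant coefficient [1], degree
    of order [1 / s], and satisfies [|q (ee x)|^2 <= exp (2056 * min (1, s /
    |x|)^3 - s / 2)] ([jackson_factor]): it is slightly smaller than [1] away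
    from the origin, at the price of a bounded factor at scale [s]. Raised to
    powers proportional to [h s - h (2 s)], these factors have a product of
    degree at most [n] whose square is at most [exp (h |x| - c * S + C)]: the
    cubic terms sum up to [O (h |x|)] by the growth condition
    ([growth_sum_le]), and the terms [s / 2] sum up to a multiple of [S] by
    summation by parts. Reversing the coefficients turns the constant
    coefficient [1] into the leading one.

    If [hinv h a / hinv h (2 * a)] stays below [l < 2], halving the level
    repeatedly shows [S <= C * A * d + a0] ([hcut_integral_le_tip]), so that a
    gain [exp (- c * A * d) = exp (- c * n * d^2)] is enough. It is provided by
    the monic Chebyshev polynomial of the arc [|x| >= d / 64], which has this
    size on the arc and whose growth inside the gap is compensated by the
    weight [exp (- h |x|) <= exp (- A)] ([monic_err_upper_cheb]). *)

Set Implicit Arguments.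
Unset Strict Implicit.
Unset Printing Implicit Defensive.

Import Order.TTheory GRing.Theory Num.Theory.
Import numFieldNormedType.Exports.

Local Open Scope classical_set_scope.
Local Open Scope ring_scope.

(** * Integrals over segments *)

Section interval_integrals.
Variable R : realType.
Local Notation mu := (@lebesgue_measure R).
Local Notation "\I_ ( a , b ) f" := (\int[mu]_(x in `[a, b]) f x)
  (at level 36, a, b at level 10, f at level 36).
Implicit Types (a b c k : R) (f g : R -> R).

Lemma continuous_integrable a b f : continuous f ->
  mu.-integrable `[a, b] (EFin \o f).
Proof.
move=> cf; apply: continuous_compact_integrable; first exact: segment_compact.
exact: continuous_subspaceT.
Qed.

Lemma bounded_integrable a b f M : measurable_fun `[a, b] f ->
  (forall x, a <= x <= b -> `|f x| <= M) -> mu.-integrable `[a, b] (EFin \o f).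
Proof.
move=> mf fM; apply: measurable_bounded_integrable => //.
  by rewrite /= lebesgue_measure_itv/=; case: ifP => _; rewrite ?ltry.
exists M; split; first exact: num_real.
move=> x Mx y /=; rewrite in_itv/= => yab.
exact: le_trans (fM y yab) (ltW Mx).
Qed.

Lemma integrable_subitv a b c d f : a <= c -> d <= b ->
  mu.-integrable `[a, b] (EFin \o f) -> mu.-integrable `[c, d] (EFin \o f).
Proof.
move=> ac db; apply: integrableS => //.
by apply: subset_itv; rewrite bnd_simp.
Qed.

Lemma itv_integral_split a c b f : a <= c <= b ->
  mu.-integrable `[a, b] (EFin \o f) ->
  \I_(a, b) f = \I_(a, c) f + \I_(c, b) f.
Proof.
move=> /andP[ac cb] intf.
have := @Rintegral_itvB R f (BLeft a) (BRight b) c intf.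
rewrite !bnd_simp => /(_ ac cb) H.
apply/eqP; rewrite addrC -subr_eq H; apply/eqP.
apply: Rintegral_itv_obnd_cbnd.
by apply: integrableS intf => //; apply: subset_itv; rewrite bnd_simp.
Qed.

Lemma itv_integral_cst a b c : a <= b -> \I_(a, b) (fun=> c) = c * (b - a).
Proof.
move=> ab; rewrite Rintegral_cst//=; congr (_ * _).
rewrite lebesgue_measure_itv/= lte_fin; case: ltP => //= ba.
have -> : a = b by apply: le_anti; rewrite ab ba.
by rewrite subrr.
Qed.

Lemma le_itv_integral a b f g :
  mu.-integrable `[a, b] (EFin \o f) -> mu.-integrable `[a, b] (EFin \o g) ->
  (forall x, a <= x <= b -> f x <= g x) -> \I_(a, b) f <= \I_(a, b) g.
Proof.
by move=> intf intg fg; apply: le_Rintegral.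
Qed.

Lemma itv_integral_ge0 a b f :
  (forall x, a <= x <= b -> 0 <= f x) -> 0 <= \I_(a, b) f.
Proof. by move=> f0; apply: Rintegral_ge0 => x /=; rewrite in_itv/=; exact: f0. Qed.

Lemma eq_itv_integral a b f g :
  (forall x, a <= x <= b -> f x = g x) -> \I_(a, b) f = \I_(a, b) g.
Proof.
by move=> fg; apply: eq_Rintegral => x; rewrite inE/= in_itv/=; exact: fg.
Qed.

Lemma itv_integralZl a b f k : mu.-integrable `[a, b] (EFin \o f) ->
  \I_(a, b) (fun x => k * f x) = k * \I_(a, b) f.
Proof. by move=> intf; rewrite RintegralZl. Qed.

Lemma itv_integralD a b f g : mu.-integrable `[a, b] (EFin \o f) ->
  mu.-integrable `[a, b] (EFin \o g) ->
  \I_(a, b) (fun x => f x + g x) = \I_(a, b) f + \I_(a, b) g.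
Proof. by move=> intf intg; rewrite RintegralD. Qed.

Lemma continuous_sum_fun (I : Type) (r : seq I) (P : pred I) (F : I -> R -> R) :
  (forall i, P i -> continuous (F i)) ->
  continuous (fun x => \sum_(i <- r | P i) F i x).
Proof.
move=> cF x; elim: r => [|i r IH].
  by under eq_fun do rewrite big_nil; exact: cvg_cst.
under eq_fun do rewrite big_cons.
case: ifPn => // Pi.
by apply: (@cvgD _ R^o); [exact: cF|exact: IH].
Qed.

Lemma itv_integral_sum (I : Type) (r : seq I) (P : pred I) a b
    (F : I -> R -> R) : a <= b -> (forall i, P i -> continuous (F i)) ->
  \I_(a, b) (fun x => \sum_(i <- r | P i) F i x) =
  \sum_(i <- r | P i) \I_(a, b) (F i).
Proof.
move=> ab cF; elim: r => [|i r IH].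
  under eq_Rintegral do rewrite big_nil.
  by rewrite big_nil itv_integral_cst// mul0r.
under eq_Rintegral do rewrite big_cons.
rewrite big_cons; case: ifPn => // Pi.
rewrite itv_integralD ?IH//; apply: continuous_integrable; first exact: cF.
exact: continuous_sum_fun.
Qed.

Lemma itv_integral_affine a b f k c : 0 < k -> a <= b -> continuous f ->
  \I_(a, b) (fun x => f (k * x + c)) = k^-1 * \I_(k * a + c, k * b + c) f.
Proof.
move=> k0 ab cf; pose F := fun x : R => k * x + c.
have dF x : is_derive x (1 : R) F k.
  rewrite /F; apply: is_derive_eq.
  by rewrite addr0 -[LHS]/(k * 1) mulr1.
have D : derive1 F = cst k.
  by apply/funext => x; rewrite derive1E; exact: derive_val.
have cF : continuous F.
  by move=> x; apply/differentiable_continuous/derivable1_diffP/ex_derive.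
have cfF : continuous (f \o F) by move=> x; apply: continuous_comp; [exact: cF|exact: cf].
have := @integration_by_substitution_increasing R F f a b ab.
rewrite D => H.
rewrite /Rintegral -[k * a + c]/(F a) -[k * b + c]/(F b) H; last 6 first.
- by move=> x y _ _ xy; rewrite /F ltrD2r ltr_pM2l.
- by move=> x _; exact: cvg_cst.
- exact: is_cvg_cst.
- exact: is_cvg_cst.
- split; first by move=> x _; exact: ex_derive.
  + by apply: cvg_at_right_filter; exact: cF.
  + by apply: cvg_at_left_filter; exact: cF.
- exact: continuous_subspaceT.
change (\I_(a, b) (f \o F) = k^-1 * \I_(a, b) (fun x => (f \o F) x * k)).
rewrite RintegralZr//; last exact: continuous_integrable.
by rewrite mulrC mulfK ?gt_eqF.
Qed.

Lemma itv_integral_shift a b f c : a <= b -> continuous f ->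
  \I_(a, b) (fun x => f (x + c)) = \I_(a + c, b + c) f.
Proof.
move=> ab cf; have := itv_integral_affine c ltr01 ab cf.
by rewrite invr1 !mul1r => <-; apply: eq_itv_integral => x _; rewrite mul1r.
Qed.

Lemma itv_integral_opp a b f : a <= b -> continuous f ->
  \I_(- b, - a) f = \I_(a, b) (fun x => f (- x)).
Proof.
move=> ab cf; rewrite /Rintegral integration_by_substitution_oppr//.
exact: continuous_subspaceT.
Qed.

Lemma itv_integral_FTC a b f F : a < b -> continuous f ->
  (forall x, is_derive x (1 : R) F (f x)) -> \I_(a, b) f = F b - F a.
Proof.
move=> ab cf dF.
have cF : continuous F.
  by move=> x; apply/differentiable_continuous/derivable1_diffP/ex_derive.
rewrite /Rintegral (@continuous_FTC2 R f F a b ab)//.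
- exact: continuous_subspaceT.
- split; first by move=> x _; exact: ex_derive.
  + by apply: cvg_at_right_filter; exact: cF.
  + by apply: cvg_at_left_filter; exact: cF.
- by move=> x _; rewrite derive1E; exact: derive_val.
Qed.

End interval_integrals.

(** * Points of the unit circle *)

Section circle_points.
Variable R : realType.
Local Open Scope complex_scope.
Local Notation normc := (@Normc.normc R).
Implicit Types (x y : R) (z : R[i]).

(** The point [exp (2 pi i x)] of the complex plane. *)
Definition ee x : R[i] := cos (2 * pi * x) +i* sin (2 * pi * x).

Lemma eeD x y : ee (x + y) = ee x * ee y.
Proof.
rewrite /ee mulrDr cosD sinD; apply/eqP; rewrite eq_complex /=.
by rewrite eqxx/= addrC [X in _ + X]mulrC [X in X + _]mulrC mulrC eqxx.
Qed.

Lemma ee0 : ee 0 = 1.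
Proof. by rewrite /ee mulr0 cos0 sin0. Qed.

Lemma eeX x k : ee (k%:R * x) = ee x ^+ k.
Proof.
elim: k => [|k IH]; first by rewrite mul0r ee0 expr0.
by rewrite -natr1 mulrDl mul1r eeD IH exprSr.
Qed.

Lemma normc_ge0 z : 0 <= normc z.
Proof. by case: z => a b /=; exact: sqrtr_ge0. Qed.

Lemma sqr_normcE z : normc z ^+ 2 = complex.Re z ^+ 2 + complex.Im z ^+ 2.
Proof. by case: z => a b /=; rewrite sqr_sqrtr// addr_ge0// sqr_ge0. Qed.

Lemma normc_eq z (r : R) : 0 <= r ->
  complex.Re z ^+ 2 + complex.Im z ^+ 2 = r ^+ 2 -> normc z = r.
Proof.
by move=> r0; rewrite -sqr_normcE => /eqP; rewrite eqrXn2// ?normc_ge0// => /eqP.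
Qed.

Lemma normcX z k : normc (z ^+ k) = normc z ^+ k.
Proof.
elim: k => [|k IH]; first by rewrite !expr0 Normc.normc1.
by rewrite !exprS Normc.normcM IH.
Qed.

Lemma normc_real (r : R) : normc (r%:C) = `|r|.
Proof. by rewrite /= expr0n/= addr0 sqrtr_sqr. Qed.

Lemma normc_conj z : normc (conjc z) = normc z.
Proof. by case: z => a b /=; rewrite sqrrN. Qed.

Lemma normc_sum (I : Type) (r : seq I) (P : pred I) (F : I -> R[i]) :
  normc (\sum_(i <- r | P i) F i) <= \sum_(i <- r | P i) normc (F i).
Proof.
elim/big_ind2 : _ => [|a x b y ha hb|i _]; first by rewrite Normc.normc0.
- exact: le_trans (le_normcD _ _) (lerD ha hb).
- exact: lexx.
Qed.

Lemma normc_prod (I : Type) (r : seq I) (P : pred I) (F : I -> R[i]) :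
  normc (\prod_(i <- r | P i) F i) = \prod_(i <- r | P i) normc (F i).
Proof.
elim/big_ind2 : _ => [|a x b y ha hb|//]; first by rewrite Normc.normc1.
by rewrite Normc.normcM ha hb.
Qed.

Lemma normc_ee x : normc (ee x) = 1.
Proof. by apply: normc_eq => //=; rewrite cos2Dsin2 expr1n. Qed.

Lemma ee_conj x : conjc (ee x) = ee (- x).
Proof. by rewrite /ee /= mulrN cosN sinN. Qed.

Lemma ee_neq0 x : ee x != 0.
Proof.
apply/eqP => e0; have := normc_ee x; rewrite e0 Normc.normc0 => /eqP.
by rewrite eq_sym oner_eq0.
Qed.

Lemma eeN x : ee (- x) = (ee x)^-1.
Proof.
by apply: (mulIf (ee_neq0 x)); rewrite mulVf ?ee_neq0// -eeD addNr ee0.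
Qed.

Lemma norm_sin_le_id x : 0 <= x -> `|sin x| <= x.
Proof.
rewrite le_eqVlt => /predU1P[<-|x0]; first by rewrite sin0 normr0.
have [|c _] := @MVT R sin cos 0 x x0 (fun y _ => is_derive_sin y).
  exact/continuous_subspaceT/continuous_sin.
rewrite sin0 !subr0 => ->; rewrite normrM [X in _ * X]gtr0_norm//.
by rewrite ler_piMl ?cos_max// ltW.
Qed.

Lemma cos_ge_parabola x : 0 <= x -> 1 - x ^+ 2 / 2 <= cos x.
Proof.
move=> x0; rewrite [in leRHS](splitr x) -mulr2n cos_mulr2n cos2sin2.
have x20 : 0 <= x / 2 by rewrite divr_ge0.
have : sin (x / 2) ^+ 2 <= (x / 2) ^+ 2.
  by rewrite -real_normK ?num_real// lerXn2r ?nnegrE ?norm_sin_le_id.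
rewrite -mulr_natl; set S := sin _ ^+ 2; lra.
Qed.

Lemma sin_ge_id x : 0 <= x <= 1 -> x * (1 - x ^+ 2 / 2) <= sin x.
Proof.
move=> /andP[]; rewrite le_eqVlt => /predU1P[<-|x0] x1; first by rewrite sin0 mul0r.
have [|c] := @MVT R sin cos 0 x x0 (fun y _ => is_derive_sin y).
  exact/continuous_subspaceT/continuous_sin.
rewrite in_itv/= => /andP[c0 cx].
rewrite sin0 !subr0 => ->; rewrite mulrC ler_wpM2r// ?(ltW x0)//.
apply: le_trans (cos_ge_parabola (ltW c0)).
have : c ^+ 2 <= x ^+ 2 by rewrite lerXn2r ?nnegrE ?ltW.
lra.
Qed.

Lemma sin_ge_quarter x : 0 <= x <= 2 -> x / 4 <= sin x.
Proof.
move=> /andP[x0 x2]; rewrite [in leRHS](splitr x) -mulr2n sin_mulr2n.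
have y01 : 0 <= x / 2 <= 1 by lra.
set y := x / 2 in y01 *; have -> : x / 4 = y / 2 by rewrite /y; lra.
have /andP[y0 y1] := y01.
have h1 := sin_ge_id y01; have h2 := cos_ge_parabola y0.
have y2 : y ^+ 2 <= 1 by rewrite expr_le1.
have h3 : y / 2 <= sin y by apply: le_trans h1; nra.
have h4 : 2^-1 <= cos y by apply: le_trans h2; lra.
rewrite -mulr_natl; nra.
Qed.

Lemma sin_pi_ge x : 0 <= x <= 2^-1 -> x / 2 <= sin (pi * x).
Proof.
move=> /andP[x0 x2].
have p2 := pi_ge2 R; have [_ p4] := andP (pihalf_02 R).
apply: le_trans (_ : pi * x / 4 <= _); first by nra.
by apply: sin_ge_quarter; apply/andP; split; nra.
Qed.

Lemma normc_ee_sub1 x : normc (ee x - 1) = 2 * `|sin (pi * x)|.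
Proof.
apply: normc_eq; first by rewrite mulr_ge0.
rewrite /= oppr0 addr0 exprMn real_normK ?num_real//.
have -> : 2 * pi * x = (pi * x) *+ 2 by rewrite mulr2n; ring.
have : cos (pi * x) ^+ 2 = 1 - sin (pi * x) ^+ 2 by exact: cos2sin2.
rewrite cos_mulr2n sin_mulr2n; move: (cos _) (sin _) => c s cs.
have -> : (c * s *+ 2) ^+ 2 = 4 * c ^+ 2 * s ^+ 2 by ring.
by rewrite cs; ring.
Qed.

Lemma normc_ee_sub1_le x : normc (ee x - 1) <= 8 * `|x|.
Proof.
rewrite normc_ee_sub1.
have [_ p4] := andP (pihalf_02 R); have p2 := pi_ge2 R.
have -> : `|sin (pi * x)| = `|sin (pi * `|x|)|.
  have [x0|x0] := leP 0 x; first by rewrite (ger0_norm x0).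
  by rewrite (ltr0_norm x0) mulrN sinN normrN.
have x0 := normr_ge0 x; move: `|x| x0 => {}x x0.
have px : 0 <= pi * x by nra.
have [s0|s0] := leP 0 (sin (pi * x)).
  rewrite ger0_norm//; have := norm_sin_le_id px; rewrite ger0_norm//; nra.
have [x1|x1] := leP x (2^-1).
  have := @sin_pi_ge x; rewrite x0 x1 => /(_ isT); lra.
have := sin_max (pi * x); lra.
Qed.

Lemma normc_ee_sub1_ge x : `|x| <= 2^-1 -> `|x| <= normc (ee x - 1).
Proof.
move=> x2; rewrite normc_ee_sub1.
have -> : `|sin (pi * x)| = `|sin (pi * `|x|)|.
  have [x0|x0] := leP 0 x; first by rewrite (ger0_norm x0).
  by rewrite (ltr0_norm x0) mulrN sinN normrN.
have := @sin_pi_ge `|x|; rewrite normr_ge0 x2 => /(_ isT) h.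
have := ler_norm (sin (pi * `|x|)); lra.
Qed.

Lemma continuous_Re_ee : continuous (fun x => complex.Re (ee x)).
Proof.
move=> x; apply: continuous_comp; last exact: continuous_cos.
by apply: cvgM => //; exact: cvg_cst.
Qed.

Lemma continuous_Im_ee : continuous (fun x => complex.Im (ee x)).
Proof.
move=> x; apply: continuous_comp; last exact: continuous_sin.
by apply: cvgM => //; exact: cvg_cst.
Qed.

Lemma continuous_horner_ee (p : {poly R[i]}) :
  continuous (fun x => complex.Re p.[ee x]) /\
  continuous (fun x => complex.Im p.[ee x]).
Proof.
elim/poly_ind : p => [|p c [IHr IHi]].
  by split => x; under eq_fun do rewrite horner0; exact: cvg_cst.
have E x : p.[ee x] * ee x + c =
    (complex.Re p.[ee x] * complex.Re (ee x) -
     complex.Im p.[ee x] * complex.Im (ee x) + complex.Re c) +i*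
    (complex.Re p.[ee x] * complex.Im (ee x) +
     complex.Im p.[ee x] * complex.Re (ee x) + complex.Im c).
  by rewrite /ee; case: p.[_] => a b; case: c.
have cr := continuous_Re_ee; have ci := continuous_Im_ee.
split => x; under eq_fun do rewrite hornerMXaddC E /=.
- apply: (@cvgD _ R^o); last exact: cvg_cst.
  by apply: (@cvgB _ R^o); apply: cvgM; [exact: IHr|exact: cr|exact: IHi|exact: ci].
- apply: (@cvgD _ R^o); last exact: cvg_cst.
  by apply: (@cvgD _ R^o); apply: cvgM; [exact: IHr|exact: ci|exact: IHi|exact: cr].
Qed.

Lemma continuous_sqr_normc_horner (p : {poly R[i]}) :
  continuous (fun x => normc p.[ee x] ^+ 2).
Proof.
have [cr ci] := continuous_horner_ee p.
move=> x; under eq_fun do rewrite sqr_normcE !expr2.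
by apply: (@cvgD _ R^o); apply: cvgM; [exact: cr|exact: cr|exact: ci|exact: ci].
Qed.

End circle_points.

(** * Parseval's identity *)

Section parseval.
Variable R : realType.
Local Open Scope complex_scope.
Local Notation normc := (@Normc.normc R).
Local Notation mu := (@lebesgue_measure R).
Local Notation "\I_ ( a , b ) f" := (\int[mu]_(x in `[a, b]) f x)
  (at level 36, a, b at level 10, f at level 36).

Lemma continuous_Re_mul_ee (a : R[i]) (j : R) :
  continuous (fun x => complex.Re (a * ee (j * x))).
Proof.
move=> x; case: a => r s; under eq_fun do rewrite /ee /=.
have c1 : continuous (fun x : R => 2 * pi * (j * x)).
  by move=> y; apply: cvgM; [exact: cvg_cst|apply: cvgM; [exact: cvg_cst|]].
apply: (@cvgB _ R^o); apply: cvgM; try exact: cvg_cst.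
  by apply: continuous_comp; [exact: c1|exact: continuous_cos].
by apply: continuous_comp; [exact: c1|exact: continuous_sin].
Qed.

Lemma sin_nat_pi k : sin (pi * k%:R) = 0 :> R.
Proof.
elim: k => [|k IH]; first by rewrite mulr0 sin0.
by rewrite -natr1 mulrDr mulr1 sinDpi IH oppr0.
Qed.

Lemma itv_integral_Re_mul_ee (a : R[i]) (k l : nat) :
  \I_(- 2^-1, 2^-1) (fun x => complex.Re (a * ee ((k%:R - l%:R) * x))) =
  if k == l then complex.Re a else 0.
Proof.
case: eqP => [->|kl].
  rewrite (@eq_itv_integral _ _ _ _ (fun=> complex.Re a)); last first.
    by move=> x _; rewrite subrr mul0r ee0 mulr1.
  by rewrite itv_integral_cst ?opprK -?splitr ?mulr1//; [lra|lra].
set j : R := k%:R - l%:R.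
have j0 : j != 0 by rewrite subr_eq0 eqr_nat; apply/eqP.
have pi0 : pi != 0 :> R by rewrite gt_eqF// pi_gt0.
have E (x : R) : complex.Re (a * ee (j * x)) =
    complex.Re a * cos (2 * pi * (j * x)) - complex.Im a * sin (2 * pi * (j * x)).
  by case: a.
pose F (x : R) := (2 * pi * j)^-1 *
  (complex.Re a * sin (2 * pi * (j * x)) + complex.Im a * cos (2 * pi * (j * x))).
have dF (x : R) : is_derive x (1 : R) F (complex.Re (a * ee (j * x))).
  rewrite /F.
  have d1 : is_derive x (1 : R) (fun x : R => 2 * pi * (j * x)) (2 * pi * j).
    by apply: is_derive_eq; rewrite -[_ *: _]/(_ * _) -[_%:A]/(_ * 1) mulr1.
  have d2 := @is_derive1_comp R sin _ x _ _ (is_derive_sin _) d1.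
  have d3 := @is_derive1_comp R cos _ x _ _ (is_derive_cos _) d1.
  have d4 := is_deriveD (is_deriveZ (complex.Re a) d2) (is_deriveZ (complex.Im a) d3).
  have d5 := is_deriveZ (2 * pi * j)^-1 d4.
  apply: (is_derive_eq d5).
  rewrite E.
  rewrite /GRing.scale/=; have : 2 * pi * j != 0 by rewrite !mulf_neq0.
  move: (cos _) (sin _) (2 * pi * j) => c s q q0.
  by field; exact: q0.
rewrite (itv_integral_FTC _ _ dF).
- rewrite /F -mulrBr.
  have -> : 2 * pi * (j * 2^-1) = pi * j :> R by field.
  have -> : 2 * pi * (j * - 2^-1) = - (pi * j) :> R by field.
  rewrite sinN cosN; have -> : sin (pi * j) = 0.
    by rewrite /j mulrBr sinB !sin_nat_pi mul0r mulr0 subrr.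
  by rewrite oppr0 subrr mulr0.
- lra.
- exact: continuous_Re_mul_ee.
Qed.

Lemma sqr_normc_sum (n : nat) (z : 'I_n -> R[i]) :
  normc (\sum_i z i) ^+ 2 = \sum_i \sum_j complex.Re (z i * conjc (z j)).
Proof.
have E (w : R[i]) : normc w ^+ 2 = complex.Re (w * conjc w).
  by rewrite sqr_normcE; case: w => a b /=; rewrite mulrN opprK !expr2.
have Re_sum (w : 'I_n -> R[i]) : complex.Re (\sum_i w i) = \sum_i complex.Re (w i).
  exact: (raddf_sum (@complex.Re R : Rcomplex R -> R)).
rewrite E rmorph_sum mulr_suml Re_sum; apply: eq_bigr => i _.
by rewrite mulr_sumr Re_sum.
Qed.

Lemma ee_conjX (x : R) k : conjc (ee x ^+ k) = ee (- x) ^+ k.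
Proof. by rewrite -ee_conj; exact: (rmorphXn (@conjc R)). Qed.

Lemma parseval (n : nat) (c : 'I_n -> R[i]) :
  \I_(- 2^-1, 2^-1) (fun x => normc (\sum_i c i * ee x ^+ i) ^+ 2) =
  \sum_i normc (c i) ^+ 2.
Proof.
have E x : normc (\sum_i c i * ee x ^+ i) ^+ 2 =
    \sum_i \sum_j complex.Re (c i * conjc (c j) * ee ((i%:R - j%:R) * x)).
  rewrite sqr_normc_sum; apply: eq_bigr => i _; apply: eq_bigr => j _.
  have -> : conjc (c j * ee x ^+ j) = conjc (c j) * ee (- x) ^+ j.
    by rewrite -ee_conjX; exact: (rmorphM (@conjc R)).
  rewrite mulrBl eeD -mulrN !eeX.
  by rewrite mulrACA.
rewrite (eq_itv_integral (fun x _ => E x)).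
have h : - 2^-1 <= 2^-1 :> R by lra.
rewrite (itv_integral_sum _ h); last first.
  by move=> i _; apply: continuous_sum_fun => j _; exact: continuous_Re_mul_ee.
apply: eq_bigr => i _; rewrite (itv_integral_sum _ h); last first.
  by move=> j _; exact: continuous_Re_mul_ee.
rewrite (bigD1 i)//= big1 => [|j ji].
  rewrite itv_integral_Re_mul_ee eqxx addr0 sqr_normcE.
  by case: (c i) => a b /=; rewrite mulrN opprK !expr2.
by rewrite itv_integral_Re_mul_ee val_eqE eq_sym (negbTE ji).
Qed.

End parseval.

(** * A Remez inequality across a gap *)

Section remez.
Variable R : realType.
Local Open Scope complex_scope.
Local Notation normc := (@Normc.normc R).
Local Notation mu := (@lebesgue_measure R).
Local Notation "\I_ ( a , b ) f" := (\int[mu]_(x in `[a, b]) f x)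
  (at level 36, a, b at level 10, f at level 36).

Variable n : nat.
Implicit Types (c d : nat -> R[i]) (x s : R).

(** The trigonometric sum with frequencies [0, ..., n].  Its coefficients are
    indexed by all natural numbers, so that multipliers apply to them without
    any reference to [n]. *)
Definition tsum c x : R[i] := \sum_(k < n.+1) c k * ee x ^+ k.

Lemma continuous_sqr_tsum c : continuous (fun x => normc (tsum c x) ^+ 2).
Proof.
have E x : tsum c x = (\poly_(k < n.+1) c k).[ee x] by rewrite horner_poly.
move=> x; under eq_fun do rewrite E.
exact: continuous_sqr_normc_horner.
Qed.

(** A translation by [j * s] acts on coefficients as the multiplier
    [k |-> (ee s ^+ k) ^+ j]. *)
Lemma tsum_shift c x s j :
  tsum c (x + j%:R * s) = tsum (fun k => c k * (ee s ^+ k) ^+ j) x.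
Proof.
apply: eq_bigr => k _; rewrite eeD eeX exprMn -mulrA; congr (_ * _).
by rewrite mulrC exprAC.
Qed.

Lemma tsumD c d x : tsum (fun k => c k + d k) x = tsum c x + tsum d x.
Proof. by rewrite -big_split; apply: eq_bigr => k _; rewrite mulrDl. Qed.

Lemma tsumB c d x : tsum (fun k => c k - d k) x = tsum c x - tsum d x.
Proof. by rewrite -sumrB; apply: eq_bigr => k _; rewrite mulrBl. Qed.

Lemma eq_tsum c d x : c =1 d -> tsum c x = tsum d x.
Proof. by move=> cd; apply: eq_bigr => k _; rewrite cd. Qed.

Lemma tsum_sum (p : nat) (C : 'I_p -> nat -> R[i]) x :
  tsum (fun k => \sum_i C i k) x = \sum_i tsum (C i) x.
Proof.
rewrite exchange_big; apply: eq_bigr => k _.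
by rewrite mulr_suml.
Qed.

Lemma tsum_natr (m : nat) c x :
  tsum (fun k => c k *+ m) x = m%:R * tsum c x.
Proof.
rewrite mulr_sumr; apply: eq_bigr => k _.
by rewrite mulr_natl mulrnAl.
Qed.

Lemma sqr_normcD_le (a b : R[i]) :
  normc (a + b) ^+ 2 <= 2 * normc a ^+ 2 + 2 * normc b ^+ 2.
Proof.
have h := le_normcD a b; have a0 := normc_ge0 a; have b0 := normc_ge0 b.
have : normc (a + b) ^+ 2 <= (normc a + normc b) ^+ 2.
  by rewrite lerXn2r ?nnegrE ?normc_ge0// addr_ge0.
have := sqr_ge0 (normc a - normc b); nra.
Qed.

Lemma sqr_normcB_le (a b : R[i]) :
  normc (a - b) ^+ 2 <= 2 * normc a ^+ 2 + 2 * normc b ^+ 2.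
Proof. by rewrite -(normcN b); exact: sqr_normcD_le. Qed.

Lemma sqr_normc_sum_le p (z : 'I_p -> R[i]) :
  normc (\sum_i z i) ^+ 2 <= 2 ^+ p * \sum_i normc (z i) ^+ 2.
Proof.
elim: p z => [|p IH] z; first by rewrite !big_ord0 Normc.normc0 expr0n mulr0.
rewrite !big_ord_recl (le_trans (sqr_normcD_le _ _))//.
have h1 := IH (fun i => z (lift ord0 i)).
rewrite (exprS 2 p) -mulrA; set S := \sum_(i < p) _ in h1 *.
rewrite -mulrDr ler_wpM2l// mulrDr lerD//.
by rewrite ler_peMl ?sqr_ge0// exprn_ege1// ler1n.
Qed.

(* The square of the L2 norm over [a, b]. *)
Local Notation Q a b c := (\I_(a, b) (fun x => normc (tsum c x) ^+ 2)).

Lemma tsum_integrable a b c :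
  mu.-integrable `[a, b] (EFin \o (fun x => normc (tsum c x) ^+ 2)).
Proof. exact/continuous_integrable/continuous_sqr_tsum. Qed.

Lemma tsum_L2_ge0 a b c : 0 <= Q a b c.
Proof. by apply: itv_integral_ge0 => x _; rewrite sqr_ge0. Qed.

Lemma tsum_L2_comb a b c d e k :
  (forall x, normc (tsum e x) ^+ 2 <=
     k * (normc (tsum c x) ^+ 2 + normc (tsum d x) ^+ 2)) ->
  Q a b e <= k * (Q a b c + Q a b d).
Proof.
move=> h; rewrite -itv_integralD -?itv_integralZl; try exact: tsum_integrable.
  apply: le_itv_integral => //; first exact: tsum_integrable.
  apply: continuous_integrable => x; apply: cvgM; first exact: cvg_cst.
  by apply: (@cvgD _ R^o); exact: continuous_sqr_tsum.
apply: continuous_integrable => x.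
by apply: (@cvgD _ R^o); exact: continuous_sqr_tsum.
Qed.

Lemma tsum_L2D_le a b c d :
  Q a b (fun k => c k + d k) <= 2 * (Q a b c + Q a b d).
Proof. by apply: tsum_L2_comb => x; rewrite tsumD mulrDr sqr_normcD_le. Qed.

Lemma tsum_L2B_le a b c d :
  Q a b (fun k => c k - d k) <= 2 * (Q a b c + Q a b d).
Proof. by apply: tsum_L2_comb => x; rewrite tsumB mulrDr sqr_normcB_le. Qed.

Lemma tsum_L2_natr a b m c : Q a b (fun k => c k *+ m) = m%:R ^+ 2 * Q a b c.
Proof.
rewrite -itv_integralZl; last exact: tsum_integrable.
apply: eq_itv_integral => x _; rewrite tsum_natr Normc.normcM exprMn.
by congr (_ ^+ 2 * _); rewrite -(rmorph_nat (real_complex R)) normc_real ger0_norm.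
Qed.

Lemma tsum_L2_sum_le a b p (C : 'I_p -> nat -> R[i]) : a <= b ->
  Q a b (fun k => \sum_i C i k) <= 2 ^+ p * \sum_i Q a b (C i).
Proof.
move=> ab; rewrite -(itv_integral_sum _ ab); last first.
  by move=> i _; exact: continuous_sqr_tsum.
have cs : continuous (fun x => \sum_i normc (tsum (C i) x) ^+ 2).
  by apply: continuous_sum_fun => i _; exact: continuous_sqr_tsum.
rewrite -itv_integralZl; last exact: continuous_integrable.
apply: le_itv_integral.
- exact: tsum_integrable.
- by apply: continuous_integrable => x; apply: cvgM; [exact: cvg_cst|exact: cs].
by move=> x _; rewrite tsum_sum; exact: sqr_normc_sum_le.
Qed.

Lemma tsum_L2_shift a b c s j : a <= b ->
  Q a b (fun k => c k * (ee s ^+ k) ^+ j) = Q (a + j%:R * s) (b + j%:R * s) c.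
Proof.
move=> ab; rewrite -(itv_integral_shift (j%:R * s) ab (@continuous_sqr_tsum c)).
by apply: eq_itv_integral => x _; rewrite tsum_shift.
Qed.

Lemma tsum_L2_full c : Q (- 2^-1) 2^-1 c = \sum_(k < n.+1) normc (c k) ^+ 2.
Proof. exact: (parseval (fun k : 'I_n.+1 => c k)). Qed.

(** If all the translates of the sum by [j * s, ..., N * s] have square norm at
    most [M], each difference operator costs a factor at most [4]. *)
Lemma tsum_L2_difference a b c s M N m j : (j + m <= N)%N ->
  (forall i, (j <= i <= N)%N -> Q a b (fun k => c k * (ee s ^+ k) ^+ i) <= M) ->
  Q a b (fun k => c k * (ee s ^+ k) ^+ j * (1 - ee s ^+ k) ^+ m) <= 4 ^+ m * M.
Proof.
elim: m j => [|m IH] j jmN h.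
  rewrite expr0 mul1r.
  under eq_Rintegral do under eq_tsum do rewrite expr0 mulr1.
  by apply: h; rewrite leqnn/=; lia.
have E x : tsum (fun k => c k * (ee s ^+ k) ^+ j * (1 - ee s ^+ k) ^+ m.+1) x =
  tsum (fun k => c k * (ee s ^+ k) ^+ j * (1 - ee s ^+ k) ^+ m -
      c k * (ee s ^+ k) ^+ j.+1 * (1 - ee s ^+ k) ^+ m) x.
  apply: eq_tsum => k; rewrite !exprS; ring.
under eq_Rintegral do rewrite E.
apply: (le_trans (tsum_L2B_le _ _ _ _)).
have h1 := IH j; have h2 := IH j.+1.
have {}h1 := h1 _ h; have {}h2 := h2 _ _.
rewrite exprS -mulrA (_ : 4 * _ = 2 * (4 ^+ m * M + 4 ^+ m * M)); last by ring.
rewrite ler_wpM2l// lerD//; first by apply: h1; lia.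
by apply: h2; [lia|move=> i /andP[ji iN]; apply: h; rewrite iN andbT ltnW].
Qed.

Lemma tsum_L2_split a m b c : a <= m <= b -> Q a b c = Q a m c + Q m b c.
Proof. by move=> amb; apply: itv_integral_split => //; exact: tsum_integrable. Qed.

Lemma tsum_L2_subitv a b a' b' c : a' <= a -> a <= b -> b <= b' -> Q a b c <= Q a' b' c.
Proof.
move=> a'a ab bb'; rewrite (@tsum_L2_split a' a b'); last by rewrite a'a (le_trans ab).
rewrite (@tsum_L2_split a b b'); last by rewrite ab.
by rewrite addrCA lerDl addr_ge0// tsum_L2_ge0.
Qed.

Lemma bin_le_exp2 N i : ('C(N, i) <= 2 ^ N)%N.
Proof.
have [iN|Ni] := leqP i N; last by rewrite bin_small.
rewrite -[2%N]/(1 + 1)%N expnDn (bigD1 (Ordinal (iN : i < N.+1)%N)) //=.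
by rewrite !exp1n !muln1 leq_addr.
Qed.

(** The square norm over the gap [|x| <= d] is controlled by the square norm
    over the rest of the circle, with a constant exponential in the number [K]
    of steps [s] needed to jump over the gap. *)
Lemma remez_l2 K c (d s : R) : (0 < K)%N -> 0 < d -> 0 < s ->
  8 * n%:R * s <= 16^-1 -> 2 * d <= K%:R * s -> 2 * K%:R * s + d <= 2^-1 ->
  Q (- d) d c <= 5 * 256 ^+ K * (Q (- 2^-1) (- d) c + Q d 2^-1 c).
Proof.
(* The exponents of [2] met in estimating the part [a] below. *)
have e8 : (K.+1 + (K + ((K + K) + ((K + K) + 2 * K))) <= (8 * K).+1)%N by lia.
move=> K0 d0 s0 ns dK Kd; set M' := Q _ _ _ + _.
(* [u k] is the multiplier of the translation by [s].  Expanding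
   [1 = (u k + (1 - u k)) ^+ N] splits the sum into [b], the terms with more
   than [K] factors [1 - u k], and [a], the terms with at least [K]
   translations. *)
pose u k := ee s ^+ k; pose N := (K + K)%N.
pose a k := \sum_(i < K.+1) (c k * u k ^+ (K + i) * (1 - u k) ^+ (K - i)) *+
  'C(N, K + i).
pose b k := c k * \sum_(i < K) ((1 - u k) ^+ (N - i) * u k ^+ i) *+ 'C(N, i).
have Kr : 1 <= K%:R :> R by rewrite ler1n.
have dd : - d <= d by lra.
have d2 : d <= 2^-1 by nra.
have M'0 : 0 <= M' by rewrite addr_ge0// tsum_L2_ge0.
have cE x : tsum c x = tsum (fun k => b k + a k) x.
  apply: eq_tsum => k; rewrite -[LHS]mulr1 -(expr1n _ N) -[1 in LHS](subrK (u k) 1).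
  rewrite exprDn /b /a -addnS big_split_ord mulrDr /=; congr (_ + _).
  rewrite mulr_sumr; apply: eq_bigr => i _.
  rewrite mulrnAr -mulrA; congr (_ * _ *+ _); rewrite mulrC; congr (_ * _ ^+ _).
  by rewrite /N subnDl.
have uk1 k : (k <= n)%N -> normc (1 - u k) <= 16^-1.
  move=> kn; rewrite -normcN opprB /u -eeX (le_trans (normc_ee_sub1_le _))//.
  rewrite ger0_norm ?mulr_ge0// ?(ltW s0)// (le_trans _ ns)// -mulrA ler_wpM2l//.
  by rewrite ler_wpM2r ?(ltW s0)// ler_nat.
have M0 : 0 <= Q d 2^-1 c by exact: tsum_L2_ge0.
(* A translation by [i * s] with [K <= i <= 2 K] moves the gap into
   [[d, 1/2]]. *)
have hM i : (K <= i <= N)%N -> Q (- d) d (fun k => c k * u k ^+ i) <= M'.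
  move=> /andP[Ki iN]; rewrite tsum_L2_shift//.
  apply: (@le_trans _ _ (Q d 2^-1 c)); last by rewrite /M' lerDr tsum_L2_ge0.
  have h1 : K%:R * s <= i%:R * s by rewrite ler_pM2r// ler_nat.
  have h2 : i%:R * s <= (2 * K%:R) * s.
    by rewrite ler_pM2r// -natrM ler_nat (leq_trans iN)// /N addnn mul2n.
  by apply: tsum_L2_subitv; lra.
have Ka : Q (- d) d a <= 2 * 256 ^+ K * M'.
  rewrite /a; apply: le_trans (tsum_L2_sum_le _ dd) _.
  have h (i : 'I_K.+1) : Q (- d) d (fun k => (c k * u k ^+ (K + i) *
      (1 - u k) ^+ (K - i)) *+ 'C(N, K + i)) <= (2 ^+ N) ^+ 2 * (4 ^+ K * M').
    rewrite tsum_L2_natr; apply: ler_pM; rewrite ?sqr_ge0 ?tsum_L2_ge0//.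
      by rewrite lerXn2r ?nnegrE ?exprn_ge0// -natrX ler_nat bin_le_exp2.
    apply: le_trans (@tsum_L2_difference _ _ _ _ M' N _ _ _ _) _.
    - by rewrite /N -addnA subnKC// -ltnS.
    - by move=> j /andP[ij jN]; apply: hM; rewrite jN andbT (leq_trans _ ij)// leq_addr.
    - by rewrite ler_wpM2r// ler_eXn2l ?leq_subr// ltr1n.
  apply: le_trans (ler_wpM2l _ (ler_sum _ (fun i _ => h i))) _.
    by rewrite exprn_ge0.
  rewrite sumr_const card_ord -[_ *+ K.+1]mulr_natl !mulrA ler_wpM2r//.
  rewrite -!mulrA.
  have -> : 4 = 2 ^+ 2 :> R by rewrite -natrX.
  have -> : 256 = 2 ^+ 8 :> R by rewrite -natrX.
  have hK : K.+1%:R <= 2 ^+ K :> R by rewrite -natrX ler_nat ltn_expl.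
  apply: (@le_trans _ _ (2 ^+ K.+1 * (2 ^+ K * (2 ^+ N * (2 ^+ N * (2 ^+ 2) ^+ K))))).
    by rewrite ler_wpM2l ?exprn_ge0// ler_wpM2r ?mulr_ge0 ?exprn_ge0.
  by rewrite -!exprM -!exprD -exprS ler_eXn2l ?ltr1n.
(* By Parseval's identity the multipliers of [b] may be estimated one
   frequency at a time, over the whole circle. *)
have Kb : Q (- d) d b <= 16^-1 * (Q (- d) d c + M').
  apply: (@le_trans _ _ (Q (- 2^-1) 2^-1 b)); first by apply: tsum_L2_subitv; lra.
  have -> : Q (- d) d c + M' = Q (- 2^-1) 2^-1 c.
    rewrite (@tsum_L2_split (- 2^-1) (- d) 2^-1); last by apply/andP; split; lra.
    rewrite (@tsum_L2_split (- d) d 2^-1); last by apply/andP; split; lra.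
    by rewrite /M'; ring.
  rewrite !tsum_L2_full mulr_sumr; apply: ler_sum => k _.
  rewrite /b Normc.normcM exprMn mulrC ler_wpM2r ?sqr_ge0//.
  have kn : (k <= n)%N by rewrite -ltnS.
  rewrite (_ : 16^-1 = (4^-1) ^+ 2 :> R); last by field.
  rewrite lerXn2r ?nnegrE ?normc_ge0// (le_trans (normc_sum _ _ _))//.
  apply: (@le_trans _ _ (\sum_(i < K) (16^-1) ^+ K *+ 'C(N, i))).
    apply: ler_sum => i _; rewrite normcMn ler_wMn2r// Normc.normcM !normcX.
    rewrite normc_ee !expr1n mulr1.
    apply: (@le_trans _ _ ((16^-1) ^+ (N - i))).
      by rewrite lerXn2r ?nnegrE ?normc_ge0 ?uk1.
    rewrite ler_wiXn2l ?invr_ge0 ?invf_le1 ?ler1n//.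
    by rewrite /N -addnBA ?leq_addr// ltnW.
  rewrite sumrMnr.
  apply: (@le_trans _ _ ((16^-1) ^+ K *+ (2 ^ N))).
    rewrite ler_wpMn2l ?exprn_ge0//.
    rewrite -[2%N]/(1 + 1)%N expnDn -addnS big_split_ord/=.
    under [X in (_ <= X + _)%N]eq_bigr do rewrite !exp1n !muln1.
    exact: leq_addr.
  rewrite -[_ *+ (2 ^ N)]mulr_natr natrX /N addnn -muln2 mulnC exprM -exprMn.
  have -> : 16^-1 * 2 ^+ 2 = 4^-1 :> R by field.
  by apply: ler_iXnr => //; lra.
have : Q (- d) d c <= 2 * (Q (- d) d b + Q (- d) d a).
  under eq_Rintegral do rewrite cE.
  exact: tsum_L2D_le.
have : 1 <= 256 ^+ K :> R by rewrite exprn_ege1// ler1n.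
have := tsum_L2_ge0 (- d) d c.
move: (Q _ _ _) (Q _ _ _) (Q _ _ _) Ka Kb => x y z; nra.
Qed.

End remez.

(** * Szego's inequality *)

Section szego.
Variable R : realType.
Local Open Scope complex_scope.
Local Notation normc := (@Normc.normc R).
Local Notation mu := (@lebesgue_measure R).
Local Notation "\I_ ( a , b ) f" := (\int[mu]_(x in `[a, b]) f x)
  (at level 36, a, b at level 10, f at level 36).
Implicit Types (z : R[i]) (x a r : R).

Lemma sqr_normc_ee_sub z x : normc (ee x - z) ^+ 2 = normc ('X - z%:P).[ee x] ^+ 2.
Proof. by rewrite hornerXsubC. Qed.

Lemma normc_ee_sub_le z x : normc (ee x - z) <= 1 + normc z.
Proof. by rewrite -(normc_ee x) -(normcN z); exact: le_normcD. Qed.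

Lemma normc_ee_sub_ge z x : 1 - normc z <= normc (ee x - z).
Proof.
rewrite lerBlDr -(normc_ee x) -[X in normc X <= _](subrK z).
exact: le_normcD.
Qed.

Lemma continuous_sqr_dist z : continuous (fun x => normc (ee x - z) ^+ 2).
Proof.
move=> x; under eq_fun do rewrite sqr_normc_ee_sub.
exact: continuous_sqr_normc_horner.
Qed.

(** Twice the logarithm of the distance from [ee x] to [z]. *)
Definition logdist z x := ln (normc (ee x - z) ^+ 2).

Lemma continuous_logdist z : normc z < 1 -> continuous (logdist z).
Proof.
move=> z1 x; apply: (@continuous_comp _ _ _ (fun x => normc (ee x - z) ^+ 2) (@ln R)).
  exact: continuous_sqr_dist.
apply: continuous_ln; rewrite exprn_gt0//.
by rewrite (lt_le_trans _ (normc_ee_sub_ge z x))// subr_gt0.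
Qed.

Lemma logdist_bound z r x : normc z <= r -> r < 1 ->
  `|logdist z x| <= ln 4 - ln ((1 - r) ^+ 2).
Proof.
move=> zr r1; have r1' : 0 < 1 - r by rewrite subr_gt0.
have z0 := normc_ge0 z.
have h1 := normc_ee_sub_le z x; have h2 := normc_ee_sub_ge z x.
have l4 : 0 <= ln 4 :> R by rewrite ln_ge0// ler1n.
have lr : ln ((1 - r) ^+ 2) <= 0.
  by rewrite ln_le0// expr_le1//; lra.
have p1 : 0 < (1 - r) ^+ 2 by rewrite exprn_gt0.
have h3 : (1 - r) ^+ 2 <= normc (ee x - z) ^+ 2.
  by rewrite lerXn2r ?nnegrE ?normc_ge0//; lra.
have h4 : normc (ee x - z) ^+ 2 <= 4.
  rewrite (_ : 4 = 2 ^+ 2 :> R); last by ring.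
  by rewrite lerXn2r ?nnegrE ?normc_ge0//; lra.
have p2 := lt_le_trans p1 h3.
have h5 : ln ((1 - r) ^+ 2) <= logdist z x by rewrite ler_ln.
have h6 : logdist z x <= ln 4 by rewrite ler_ln ?posrE.
rewrite ler_norml; apply/andP; split; lra.
Qed.

Lemma ee_half : ee 2^-1 = -1 :> R[i].
Proof.
rewrite /ee (_ : 2 * pi * 2^-1 = pi :> R); last by field.
by rewrite cospi sinpi; apply/eqP; rewrite eq_complex /= oppr0 !eqxx.
Qed.

(** [(ee x - z) * (ee (x + 1/2) - z)] is [z ^+ 2 - ee (2 * x)]. *)
Lemma logdist_double z x : normc z < 1 ->
  logdist z x + logdist z (x + 2^-1) = logdist (z ^+ 2) (2 * x + 0).
Proof.
move=> z1; rewrite /logdist addr0.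
have p y : 0 < normc (ee y - z) ^+ 2.
  rewrite exprn_gt0// (lt_le_trans _ (normc_ee_sub_ge z y))//.
  by rewrite subr_gt0.
rewrite -lnM ?posrE//; congr ln.
rewrite -exprMn -Normc.normcM eeD ee_half eeX mulrN1.
by rewrite -normcN; congr (normc _ ^+ 2); ring.
Qed.

Lemma itv_integral_logdist_double z a : normc z < 1 ->
  \I_(a, a + 1) (logdist z) =
  2^-1 * \I_(2 * a, 2 * a + 1) (logdist (z ^+ 2)).
Proof.
move=> z1; have cz := continuous_logdist z1.
have z21 : normc (z ^+ 2) < 1.
  by rewrite normcX expr_lt1 ?normc_ge0.
have a2 : a <= a + 2^-1 by lra.
have am : a <= a + 2^-1 <= a + 1 by apply/andP; split; lra.
have iz : mu.-integrable `[a, a + 1] (EFin \o logdist z).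
  exact: continuous_integrable.
have -> := itv_integral_split am iz.
have sh := itv_integral_shift 2^-1 a2 cz.
have e1 : (a + 2^-1) + 2^-1 = a + 1 by field.
rewrite e1 in sh; rewrite -sh -itv_integralD; last 2 first.
- exact: continuous_integrable.
- apply: continuous_integrable => x.
  apply: (@continuous_comp _ _ _ (fun x => x + 2^-1)); last exact: cz.
  by apply: (@cvgD _ R^o) => //; exact: cvg_cst.
rewrite (eq_itv_integral (fun x _ => logdist_double x z1)).
have -> := itv_integral_affine 0 (ltr0Sn R 1) a2 (continuous_logdist z21).
have e2 : 2 * (a + 2^-1) = 2 * a + 1 by field.
by rewrite e2 !addr0.
Qed.

(** The mean value property of the logarithm, for [z] in the open disk.  By the
    doubling identity the integral is [2 ^- k] times the one for
    [z ^+ (2 ^ k)], and the latter is bounded in [k]. *)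
Lemma itv_integral_logdist z a : normc z < 1 -> \I_(a, a + 1) (logdist z) = 0.
Proof.
move=> z1; set r := normc z; set B := ln 4 - ln ((1 - r) ^+ 2).
have H k : forall w b, normc w <= r ->
    `|\I_(b, b + 1) (logdist w)| <= 2^-1 ^+ k * B.
  elim: k => [|k IH] w b wr; have w1 := le_lt_trans wr z1.
    rewrite expr0 mul1r.
    have iw : mu.-integrable `[b, b + 1] (EFin \o logdist w).
      exact/continuous_integrable/continuous_logdist.
    rewrite (le_trans (le_normr_Rintegral _ iw))//.
    have -> : B = \I_(b, b + 1) (fun=> B).
      by rewrite itv_integral_cst; [ring|lra].
    apply: le_itv_integral.
    - exact: integrable_norm.
    - by apply: continuous_integrable => x; exact: cvg_cst.
    - by move=> x _; exact: logdist_bound.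
  rewrite itv_integral_logdist_double// normrM ger0_norm// (exprS 2^-1 k) -mulrA.
  rewrite ler_wpM2l// IH// normcX (le_trans _ wr)// expr2 ler_piMl ?normc_ge0//.
  exact: ltW.
set y := \I_(_, _) _.
apply/eqP; rewrite -normr_le0 leNgt; apply/negP => y0.
have B0 : 0 <= B by rewrite (le_trans _ (logdist_bound 0 (lexx r) z1)).
have := H (Num.bound (B / `|y|)) z a (lexx _); rewrite -/y => h.
have hb := archi_boundP (divr_ge0 B0 (normr_ge0 y)).
move: h hb; set k := Num.bound _ => h hb.
have k2 : k%:R < 2 ^+ k :> R by rewrite -natrX ltr_nat ltn_expl.
have := lt_trans hb k2.
rewrite ltr_pdivrMr// => h2.
have p2 : 0 < 2 ^+ k :> R by rewrite exprn_gt0.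
move: h; rewrite exprVn ler_pdivlMl// => h3.
by have := lt_le_trans h2 h3; rewrite ltxx.
Qed.

Implicit Types zs : seq R[i].

Lemma continuous_prod_dist zs :
  continuous (fun x => \prod_(z <- zs) normc (ee x - z) ^+ 2).
Proof.
move=> x; pose p := \prod_(z <- zs) ('X - z%:P).
have E y : \prod_(z <- zs) normc (ee y - z) ^+ 2 = normc p.[ee y] ^+ 2.
  rewrite horner_prod normc_prod -prodrXl.
  by apply: eq_bigr => z _; rewrite hornerXsubC.
under eq_fun do rewrite E.
exact: continuous_sqr_normc_horner.
Qed.

(** Jensen's inequality; the logarithm of the product has mean zero. *)
Lemma jensen_open_disk zs (G : R -> R) : continuous G ->
  (forall z, z \in zs -> normc z < 1) ->
  expR (- \I_(- 2^-1, 2^-1) G) <=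
  \I_(- 2^-1, 2^-1) (fun x => (\prod_(z <- zs) normc (ee x - z) ^+ 2) * expR (- G x)).
Proof.
move=> cG zs1; set c := expR _; set W := fun x => _ * _.
have c0 : 0 < c by exact: expR_gt0.
have cW : continuous W.
  move=> x; apply: cvgM; first exact: continuous_prod_dist.
  by apply: continuous_comp; [apply: cvgN; exact: cG|exact: continuous_expR].
have p z x : z \in zs -> 0 < normc (ee x - z) ^+ 2.
  move=> /zs1 z1; rewrite exprn_gt0// (lt_le_trans _ (normc_ee_sub_ge z x))//.
  by rewrite subr_gt0.
have h2 : - 2^-1 <= 2^-1 :> R by lra.
pose L x := \sum_(z <- zs | z \in zs) logdist z x.
have cL : continuous L.
  by apply: continuous_sum_fun => z /zs1; exact: continuous_logdist.
have WE x : W x = expR (L x - G x).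
  rewrite /W expRD /L expR_sum; congr (_ * _).
  rewrite big_seq; apply: eq_bigr => z zz.
  by rewrite lnK// posrE p.
have IL : \I_(- 2^-1, 2^-1) L = 0.
  rewrite /L (itv_integral_sum _ h2); last first.
    by move=> z /zs1; exact: continuous_logdist.
  rewrite big1// => z /zs1 z1.
  have := itv_integral_logdist (- 2^-1) z1.
  by rewrite (_ : - 2^-1 + 1 = 2^-1 :> R); [|field].
have iG : mu.-integrable `[- 2^-1, 2^-1] (EFin \o G) by exact: continuous_integrable.
have iL : mu.-integrable `[- 2^-1, 2^-1] (EFin \o L) by exact: continuous_integrable.
have cLG : continuous (fun x => L x - G x).
  by move=> x; apply: (@cvgB _ R^o); [exact: cL|exact: cG].
have icst (k : R) : mu.-integrable `[- 2^-1, 2^-1] (EFin \o (fun=> k)).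
  by apply: continuous_integrable => x; exact: cvg_cst.
(* Jensen's inequality for the exponential, as its tangent line inequality
   [1 + (ln (W x) - ln c) <= W x / c]. *)
have H : \I_(- 2^-1, 2^-1) (fun x => (L x - G x) + (1 - ln c)) <=
    \I_(- 2^-1, 2^-1) (fun x => c^-1 * W x).
  apply: le_itv_integral.
  - apply: continuous_integrable => x; apply: (@cvgD _ R^o).
      exact: cLG.
    exact: cvg_cst.
  - by apply: continuous_integrable => x; apply: cvgM; [exact: cvg_cst|exact: cW].
  move=> x _; rewrite WE -{2}(lnK c0) -expRN mulrC -expRD.
  by have := expR_ge1Dx (L x - G x - ln c); rewrite /c expRK; lra.
rewrite itv_integralD// in H; last exact: continuous_integrable.
rewrite itv_integralZl in H; last exact: continuous_integrable.
rewrite RintegralB// IL itv_integral_cst// in H.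
have E1 : ln c = - \I_(- 2^-1, 2^-1) G by rewrite /c expRK.
rewrite E1 in H.
have : 1 <= c^-1 * \I_(- 2^-1, 2^-1) W by lra.
by rewrite ler_pdivlMl// mulr1.
Qed.

(** Points outside the closed unit disk are reflected through the unit circle;
    this does not increase the distance to any point of the circle. *)
Definition disk_reflection z := if normc z <= 1 then z else (conjc z)^-1.

Lemma normc_disk_reflection_le1 z : normc (disk_reflection z) <= 1.
Proof.
rewrite /disk_reflection; case: ifPn => // ; rewrite -ltNge => z1.
by rewrite Normc.normcV normc_conj invf_le1 ?(ltW z1)// (lt_trans _ z1).
Qed.

Lemma normc_ee_sub_disk_reflection z x : normc (ee x - disk_reflection z) <= normc (ee x - z).
Proof.
rewrite /disk_reflection; case: ifPn => // ; rewrite -ltNge => z1.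
have z0 : conjc z != 0.
  apply/eqP => z0; move: z1; rewrite -normc_conj z0 Normc.normc0; lra.
have E : ee x - (conjc z)^-1 = - ee x * (conjc z)^-1 * conjc (ee x - z).
  have -> : conjc (ee x - z) = (ee x)^-1 - conjc z.
    by rewrite -eeN -ee_conj; exact: (rmorphB (@conjc R)).
  by field; rewrite ee_neq0 z0.
rewrite E !Normc.normcM normcN normc_ee normc_conj Normc.normcV normc_conj mul1r.
by rewrite ler_piMl ?normc_ge0// invf_le1 ?(ltW z1)// (lt_trans _ z1).
Qed.

(** Increasing all the distances by [t] changes their product by [O (t)],
    uniformly in [x]. *)
Lemma prod_dist_perturb zs : exists K M : R, [/\ 0 <= K, 0 <= M &
  forall t x, 0 <= t <= 1 ->
   \prod_(z <- zs) normc (ee x - z) ^+ 2 <= M /\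
   \prod_(z <- zs) (normc (ee x - z) + t) ^+ 2 <=
   \prod_(z <- zs) normc (ee x - z) ^+ 2 + K * t].
Proof.
elim: zs => [|z zs [K [M [K0 M0 IH]]]].
  by exists 0, 1; split => // t x _; rewrite !big_nil mul0r addr0.
pose X := 1 + normc z; have X0 : 0 <= X by rewrite addr_ge0// normc_ge0.
exists ((2 * X + 1) * M + (X + 1) ^+ 2 * K); exists (X ^+ 2 * M); split.
- by have := sqr_ge0 (X + 1); nra.
- by rewrite mulr_ge0 ?sqr_ge0.
move=> t x t01; have [h1 h2] := IH t x t01; rewrite !big_cons.
have y0 := normc_ge0 (ee x - z); have yX : normc (ee x - z) <= X := normc_ee_sub_le z x.
have P0 : 0 <= \prod_(z <- zs) normc (ee x - z) ^+ 2.
  by apply: prodr_ge0 => w _; rewrite sqr_ge0.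
move: (normc (ee x - z)) y0 yX => y y0 yX.
move: (\prod_(_ <- _) _) (\prod_(_ <- _) _) P0 h1 h2 => Q P P0 h1 h2.
have /andP[t0 t1] := t01.
have yy : y ^+ 2 <= X ^+ 2 by rewrite lerXn2r.
split; first by rewrite ler_pM ?sqr_ge0.
have q1 : (y + t) ^+ 2 <= y ^+ 2 + (2 * X + 1) * t by nra.
have q2 : (y + t) ^+ 2 <= (X + 1) ^+ 2 by rewrite lerXn2r ?nnegrE//; lra.
apply: le_trans (ler_wpM2l (sqr_ge0 _) h2) _.
rewrite mulrDr [Z in _ <= Z](_ : _ = (y ^+ 2 * P + (2 * X + 1) * t * M) +
  (X + 1) ^+ 2 * (K * t)); last by ring.
apply: lerD; last by rewrite ler_wpM2r// mulr_ge0.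
apply: le_trans (ler_wpM2r P0 q1) _.
by rewrite mulrDl lerD2l ler_wpM2l// mulr_ge0//; lra.
Qed.

(** For arbitrary zeros: reflect them into the closed disk, shrink them by
    [1 - t] into the open disk, and let [t] tend to [0]. *)
Lemma jensen_prod zs (G : R -> R) : continuous G ->
  expR (- \I_(- 2^-1, 2^-1) G) <=
  \I_(- 2^-1, 2^-1) (fun x => (\prod_(z <- zs) normc (ee x - z) ^+ 2) * expR (- G x)).
Proof.
move=> cG; have [K [M [K0 M0 KM]]] := prod_dist_perturb zs.
have ceG : continuous (fun x => expR (- G x)).
  move=> x; apply: continuous_comp; last exact: continuous_expR.
  by apply: cvgN; exact: cG.
set E := \I_(- 2^-1, 2^-1) (fun x => expR (- G x)).
have E0 : 0 <= E by apply: itv_integral_ge0 => x _; exact: expR_ge0.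
have H t : 0 < t < 1 -> expR (- \I_(- 2^-1, 2^-1) G) <=
    \I_(- 2^-1, 2^-1) (fun x => (\prod_(z <- zs) normc (ee x - z) ^+ 2) * expR (- G x))
    + K * t * E.
  move=> /andP[t0 t1].
  apply: le_trans (@jensen_open_disk [seq (1 - t)%:C * disk_reflection z | z <- zs] G cG _) _.
    move=> _ /mapP[z _ ->]; rewrite Normc.normcM normc_real ger0_norm; last by lra.
    by have := normc_disk_reflection_le1 z; have := normc_ge0 (disk_reflection z); nra.
  have cP := @continuous_prod_dist zs.
  have cPG : continuous (fun x =>
      (\prod_(z <- zs) normc (ee x - z) ^+ 2) * expR (- G x)).
    by move=> x; apply: cvgM; [exact: cP|exact: ceG].
  have <- : \I_(- 2^-1, 2^-1) (fun x => K * t * expR (- G x)) = K * t * E.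
    by rewrite itv_integralZl//; exact: continuous_integrable.
  rewrite -itv_integralD; last 2 first.
  - exact: continuous_integrable.
  - apply: continuous_integrable => x; apply: cvgM; [exact: cvg_cst|exact: ceG].
  apply: le_itv_integral.
  - apply: continuous_integrable => x; apply: cvgM; last exact: ceG.
    exact: continuous_prod_dist.
  - apply: continuous_integrable => x; apply: (@cvgD _ R^o); first exact: cPG.
    by apply: cvgM; [exact: cvg_cst|exact: ceG].
  move=> x _; rewrite -mulrDl ler_wpM2r ?expR_ge0// big_map.
  have [|_] := KM t x _; first by rewrite (ltW t0) ltW.
  apply: le_trans; apply: ler_prod => z _; rewrite sqr_ge0/=.
  rewrite lerXn2r ?nnegrE ?normc_ge0 ?addr_ge0 ?normc_ge0 ?(ltW t0)//.
  have -> : ee x - (1 - t)%:C * disk_reflection z =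
      (ee x - disk_reflection z) + t%:C * disk_reflection z.
    by rewrite rmorphB /= rmorph1; ring.
  apply: le_trans (le_normcD _ _) _; apply: lerD; first exact: normc_ee_sub_disk_reflection.
  rewrite Normc.normcM normc_real ger0_norm ?(ltW t0)//.
  by rewrite ler_piMr ?(ltW t0)// normc_disk_reflection_le1.
apply/ler_addgt0Pr => e e0.
pose t := Num.min 2^-1 (e / (K * E + 1)).
have KE : 0 < K * E + 1 by rewrite ltr_pwDr// mulr_ge0.
have t0 : 0 < t by rewrite lt_min divr_gt0// andbT.
have t1 : t < 1 by rewrite gt_min; apply/orP; left; lra.
apply: le_trans (H t _) _; first by rewrite t0 t1.
rewrite lerD2l.
have : t <= e / (K * E + 1) by rewrite ge_min lexx orbT.
rewrite ler_pdivlMr// => h.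
have : 0 <= t by exact: ltW.
have := mulr_ge0 K0 E0; nra.
Qed.

(** Szego's inequality: in the weighted L2 norm, no monic polynomial is smaller
    than the geometric mean of the weight. *)
Lemma szego_lower_bound (p : {poly R[i]}) (G : R -> R) : continuous G ->
  p \is monic ->
  expR (- \I_(- 2^-1, 2^-1) G) <=
  \I_(- 2^-1, 2^-1) (fun x => normc p.[ee x] ^+ 2 * expR (- G x)).
Proof.
move=> cG /monicP pm; have [zs pE] := closed_field_poly_normal p.
rewrite pm scale1r in pE.
have := @jensen_prod zs G cG; congr (_ <= _); apply: eq_itv_integral => x _.
congr (_ * _); rewrite pE horner_prod normc_prod -prodrXl.
by apply: eq_bigr => z _; rewrite hornerXsubC.
Qed.

End szego.

(** * Integration against the measure *)

Section density.
Context d (T : measurableType d) (R : realType).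
Local Open Scope ereal_scope.

(** Integration against a measure with a density; [g] agrees almost everywhere
    with the Radon-Nikodym derivative of [nu]. *)
Lemma ge0_integral_density (nu : {finite_measure set T -> \bar R})
    (la : {sigma_finite_measure set T -> \bar R}) (f g : T -> R) :
  measurable_fun setT f -> measurable_fun setT g ->
  (forall t, 0 <= f t)%R ->
  (forall E, measurable E -> nu E = \int[la]_(t in E) (g t)%:E) ->
  \int[nu]_t (f t)%:E = \int[la]_t (f t * g t)%:E.
Proof.
move=> mf mg f0 nuE.
have mEf : measurable_fun setT (EFin \o f) by exact/measurable_EFinP.
have mEg : measurable_fun setT (EFin \o g) by exact/measurable_EFinP.
have nula : nu `<< la.
  move=> E nE A mA AE; rewrite nuE//; apply: null_set_integral => //.
    exact: measurable_funTS.
  exact: nE.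
rewrite -(Radon_Nikodym_SigmaFinite.change_of_variables nula)//.
have fi := Radon_Nikodym_SigmaFinite.f_integrable nula.
have ae : ae_eq la setT (Radon_Nikodym_SigmaFinite.f nu la) (EFin \o g).
  apply: integral_ae_eq => // E _ mE.
  by rewrite -Radon_Nikodym_SigmaFinite.f_integral// nuE.
under [RHS]eq_integral do rewrite EFinM.
apply: ae_eq_integral => //.
- apply: emeasurable_funM => //; exact: measurable_int fi.
- exact: emeasurable_funM.
- exact: ae_eqe_mul2l.
Qed.

End density.

Section transport.
Variable R : realType.
Local Open Scope complex_scope.
Local Notation normc := (@Normc.normc R).
Local Notation mu := (@lebesgue_measure R).
Local Notation "\I_ ( a , b ) f" := (\int[mu]_(x in `[a, b]) f x)
  (at level 36, a, b at level 10, f at level 36).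

HB.instance Definition _ := Measure_isProbability.Build _ _ _
  (@circle_measure R) (@circle_measureT R).

Lemma measurable_circle_coords : measurable_fun setT (@circle_coords R).
Proof. by move=> _ B mB; rewrite setTI; exists B => //; rewrite setTI. Qed.

Lemma measurable_circle_Re :
  measurable_fun setT (fun t : circle R => complex.Re (circle_val t)).
Proof. exact: (measurableT_comp measurable_fst measurable_circle_coords). Qed.

Lemma measurable_circle_Im :
  measurable_fun setT (fun t : circle R => complex.Im (circle_val t)).
Proof. exact: (measurableT_comp measurable_snd measurable_circle_coords). Qed.

Lemma measurable_horner_circle (p : {poly R[i]}) :
  measurable_fun setT (fun t : circle R => complex.Re p.[circle_val t]) /\
  measurable_fun setT (fun t : circle R => complex.Im p.[circle_val t]).
Proof.
have mr := measurable_circle_Re; have mi := measurable_circle_Im.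
elim/poly_ind : p => [|p c [IHr IHi]].
  by split; under eq_fun do rewrite horner0; exact: measurable_cst.
have E (t : circle R) : p.[circle_val t] * circle_val t + c =
    (complex.Re p.[circle_val t] * complex.Re (circle_val t) -
     complex.Im p.[circle_val t] * complex.Im (circle_val t) + complex.Re c) +i*
    (complex.Re p.[circle_val t] * complex.Im (circle_val t) +
     complex.Im p.[circle_val t] * complex.Re (circle_val t) + complex.Im c).
  by case: p.[_] => a b; case: (circle_val t) => a' b'; case: c.
split; under eq_fun do rewrite hornerMXaddC E /=.
- apply: measurable_funD; last exact: measurable_cst.
  by apply: measurable_funB; exact: measurable_funM.
- apply: measurable_funD; last exact: measurable_cst.
  by apply: measurable_funD; exact: measurable_funM.
Qed.

Lemma measurable_sqr_normc_circle (p : {poly R[i]}) :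
  measurable_fun setT (fun t : circle R => normc p.[circle_val t] ^+ 2).
Proof.
have [mr mi] := measurable_horner_circle p.
under eq_fun do rewrite sqr_normcE.
by apply: measurable_funD; exact: measurable_funX.
Qed.

Lemma circle_pt_surj (t : circle R) : exists x : R,
  [/\ `|x| <= 2^-1, t = circle_pt x &
      `|x| = acos (complex.Re (circle_val t)) / (2 * pi)].
Proof.
case: t => -[a b] ab1.
have ab : a ^+ 2 + b ^+ 2 = 1.
  move: (ab1); rewrite normc_def/= => /eqP[] /(congr1 (fun x => x ^+ 2)).
  by rewrite sqr_sqrtr ?expr1n// addr_ge0// sqr_ge0.
have a1 : -1 <= a <= 1.
  by rewrite -ler_norml -(@expr_le1 _ 2)// real_normK ?num_real// -ab lerDl sqr_ge0.
have p0 := pi_gt0 R.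
pose x0 := acos a / (2 * pi).
have x00 : 0 <= x0 by rewrite divr_ge0 ?acos_ge0// mulr_ge0// ltW.
have x02 : x0 <= 2^-1.
  by rewrite ler_pdivrMr ?mulr_gt0// mulrA mulVf// mul1r acos_lepi.
have e : 2 * pi * x0 = acos a by rewrite /x0 mulrC divfK// gt_eqF// mulr_gt0.
have c0 : cos (2 * pi * x0) = a by rewrite e acosK// in_itv.
have s0 : sin (2 * pi * x0) = `|b|.
  rewrite e sin_acos// -ab addrC addKr sqrtr_sqr.
  by [].
have [b0|b0] := leP 0 b.
  exists x0; rewrite ger0_norm//; split => //.
  apply/val_inj => /=; rewrite /circle_pt /=.
  by rewrite c0 s0 ger0_norm.
exists (- x0); rewrite normrN ger0_norm//; split => //.
apply/val_inj => /=; rewrite /circle_pt /=.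
by rewrite mulrN cosN sinN c0 s0 ltr0_norm ?opprK.
Qed.

Variable h : R -> R.
Hypothesis h_ge0 : forall a, 0 < a <= 2^-1 -> 0 <= h a.
Hypothesis h_cont : {within `]0, 2^-1], continuous h}.
Variable w : circle R -> R.
Hypothesis w_def : forall theta : R, 0 < `|theta| <= 2^-1 ->
  w (circle_pt theta) = expR (- h `|theta|).

(** Off the point [1] the density is a continuous function of the real part. *)
Lemma measurable_weight : measurable_fun setT w.
Proof.
pose f a := if a == 1 then w (circle_pt 0) else expR (- h (acos a / (2 * pi))).
have p0 := pi_gt0 R; have pp0 : 0 < 2 * pi :> R by rewrite mulr_gt0.
have wE t : w t = f (complex.Re (circle_val t)).
  have [x [x2 -> xE]] := circle_pt_surj t; rewrite /f.
  case: eqP => [r1|r1]; last first.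
    have x0 : x != 0 by apply: contra_notN r1 => /eqP ->; rewrite /= mulr0 cos0.
    rewrite w_def ?normr_gt0 ?x0//; congr (expR (- h _)).
    exact: xE.
  suff -> : x = 0 by [].
  by apply/eqP; rewrite -normr_eq0 xE r1 acos1 mul0r.
have hc x : 0 < x < 2^-1 -> {for x, continuous h}.
  move=> x02; have : {within `]0, 2^-1[, continuous h}.
    by apply: continuous_subspaceW h_cont; apply: subset_itv; rewrite bnd_simp.
  rewrite continuous_open_subspace; last exact: interval_open.
  by apply; rewrite inE/= in_itv.
have mf : measurable_fun (`[-1, 1] : set R) f.
  apply/measurable_fun_itv_obnd_cbndP/measurable_fun_itv_bndo_bndcP.
  apply: (@eq_measurable_fun _ _ _ _ _ (fun a => expR (- h (acos a / (2 * pi))))).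
    by move=> a; rewrite inE/= in_itv/= /f => /andP[_ a1]; rewrite lt_eqF.
  apply: open_continuous_measurable_fun; first exact: interval_open.
  move=> a; rewrite inE/= in_itv/= => /andP[a1 a2].
  have c1 : {for a, continuous (fun a => acos a / (2 * pi))}.
    by apply: cvgM; [apply: continuous_acos; rewrite a1 a2|exact: cvg_cst].
  have c2 : {for a, continuous (fun a => h (acos a / (2 * pi)))}.
    apply: (@continuous_comp _ _ _ (fun a => acos a / (2 * pi)) h) => //.
    apply: hc; rewrite divr_gt0 ?acos_gt0 ?(ltW a1) ?a2//=.
    by rewrite ltr_pdivrMr// mulrA mulVf// mul1r acos_ltpi// a1 ltW.
  apply: (@continuous_comp _ _ _ (fun a => - h (acos a / (2 * pi))) (@expR R)).
    exact: cvgN.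
  exact: continuous_expR.
rewrite (_ : w = f \o (fun t => complex.Re (circle_val t))); last exact/funext.
apply: (@measurable_comp _ _ _ _ _ _ (`[-1, 1] : set R)) => //.
  move=> _ [t _ <-] /=; rewrite in_itv/= -ler_norml.
  have [x [_ -> _]] := circle_pt_surj t; exact: cos_max.
exact: measurable_circle_Re.
Qed.

(** The density read on [[-1/2, 1/2]].  At the origin, where [h] is not
    specified, its value is [0]. *)
Definition weight (x : R) : R := if x == 0 then 0 else expR (- h `|x|).

Lemma weight_ge0 x : 0 <= weight x.
Proof. by rewrite /weight; case: ifP => // _; exact: expR_ge0. Qed.

Lemma weight_le1 x : `|x| <= 2^-1 -> weight x <= 1.
Proof.
move=> x2; rewrite /weight; case: eqP => // /eqP x0; rewrite expR_le1 oppr_le0.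
by apply: h_ge0; rewrite normr_gt0 x0.
Qed.

Lemma weightE x : 0 < `|x| <= 2^-1 -> weight x = w (circle_pt x).
Proof.
move=> x02; rewrite w_def// /weight; case: eqP => // x0.
by move: x02; rewrite x0 normr0 ltxx.
Qed.

Lemma measurable_weight_itv : measurable_fun (`[- 2^-1, 2^-1] : set R) weight.
Proof.
have mwc : measurable_fun setT (w \o @circle_pt R).
  exact: measurableT_comp measurable_weight (@measurable_circle_pt R).
apply: (@eq_measurable_fun _ _ _ _ _
    (fun x : R => if x == 0 then (0 : R) else (w \o @circle_pt R) x)).
  move=> x; rewrite inE/= in_itv/= -ler_norml => x2.
  case: ifPn => [/eqP ->|x0]; first by rewrite /weight eqxx.
  by rewrite weightE// normr_gt0 x0.
by apply: measurable_funTS; apply: measurable_fun_ifT => //; exact: measurable_fun_eqr.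
Qed.

Lemma weight_integrable (f : R -> R) : continuous f ->
  mu.-integrable `[- 2^-1, 2^-1] (EFin \o (fun x => f x * weight x)).
Proof.
move=> cf; have h2 : - 2^-1 <= 2^-1 :> R by lra.
have [M fM] : exists M, forall x, - 2^-1 <= x <= 2^-1 -> `|f x| <= M.
  have [|x _ xm] := @EVT_max R (fun x => `|f x|) (- 2^-1) 2^-1 h2.
    by apply: continuous_subspaceT => x; apply: cvg_norm; exact: cf.
  by exists `|f x| => y y2; apply: xm; rewrite in_itv.
apply: (@bounded_integrable _ _ _ _ M).
  apply: measurable_funM; last exact: measurable_weight_itv.
  by apply: measurable_funTS; exact: continuous_measurable_fun.
move=> x x2; rewrite normrM -[M]mulr1 ler_pM// ?fM//.
by rewrite ger0_norm ?weight_ge0// weight_le1// ler_norml.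
Qed.

Variable rho : {finite_measure set (circle R) -> \bar R}.
Hypothesis rho_def : forall E : set (circle R), measurable E ->
  (rho E = \int[@circle_measure R]_(t in E) (w t)%:E)%E.

Lemma rho_integral (p : {poly R[i]}) :
  \int[rho]_t normc p.[circle_val t] ^+ 2 =
  \I_(- 2^-1, 2^-1) (fun x => normc p.[ee x] ^+ 2 * weight x).
Proof.
have mp := measurable_sqr_normc_circle p; have mw := measurable_weight.
have p0 (t : circle R) : 0 <= normc p.[circle_val t] ^+ 2 by rewrite sqr_ge0.
have pp : 0 < pi :> R := pi_gt0 R.
(* [w] is arbitrary at the point [1], which has measure zero; [w1] vanishes
   there, as [weight] does at the origin. *)
pose w1 (t : circle R) := if complex.Re (circle_val t) == 1 then 0 else w t.
have mRe : measurable_fun setT (fun t : circle R => complex.Re (circle_val t) == 1).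
  by apply: measurable_fun_eqr => //; exact: measurable_circle_Re.
have mw1 : measurable_fun setT w1 by apply: measurable_fun_ifT.
have w1E x : `|x| <= 2^-1 -> w1 (circle_pt x) = weight x.
  move=> x2; rewrite /w1; case: ifPn => [/eqP /= c1|].
    suff -> : x = 0 by rewrite /weight eqxx.
    have : cos (2 * pi * `|x|) = cos 0.
      by rewrite cos0 -[RHS]c1 -[RHS]cos_norm normrM [`|2 * pi|]gtr0_norm// mulr_gt0.
    move/cos_inj; rewrite !in_itv/= lexx (ltW pp)/= => /(_ _ isT) h0.
    have {}h0 : 2 * pi * `|x| = 0.
      by apply: h0; rewrite !mulr_ge0 ?(ltW pp)//=; nra.
    move/eqP : h0; rewrite !mulf_eq0 (gt_eqF pp) normr_eq0 pnatr_eq0/=.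
    by move/eqP.
  have [->|x0] := eqVneq x 0; first by rewrite /= mulr0 cos0 eqxx.
  by rewrite weightE// normr_gt0 x0.
have w10 t : 0 <= w1 t.
  have [x [x2 -> _]] := circle_pt_surj t.
  by rewrite w1E// weight_ge0.
have w1rho E : measurable E ->
    (rho E = \int[@circle_measure R]_(t in E) (w1 t)%:E)%E.
  move=> mE; rewrite rho_def//; apply: ae_eq_integral => //.
  - by apply/measurable_EFinP; exact: measurable_funTS.
  - by apply/measurable_EFinP; exact: measurable_funTS.
  exists [set t | complex.Re (circle_val t) = 1]; split.
  - rewrite (_ : [set _ | _] =
        setT `&` (fun t : circle R => complex.Re (circle_val t)) @^-1` [set 1]).
      exact: measurable_circle_Re.
    by rewrite setTI.
  - rewrite /= /circle_measure /pushforward /mrestr.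
    rewrite (_ : _ `&` _ = [set 0]); first by rewrite lebesgue_measure_set1.
    apply/seteqP; split => x /=; last first.
      by move=> ->; rewrite mulr0 cos0 in_itv/=; split => //; apply/andP; split; lra.
    rewrite in_itv/= -ler_norml => -[c1 x2].
    have := w1E x x2; rewrite /w1 /= c1 eqxx /weight.
    by case: eqP => // _ /esym/eqP; rewrite expR_eq0.
  - move=> t /= /not_implyP[_ h1]; apply/eqP.
    by apply: contra_notT h1 => h1; rewrite /w1 (negbTE h1).
(* Pass from [rho] to arc length, then to Lebesgue measure restricted to the
   segment, which is again a measure with a density. *)
rewrite /Rintegral (ge0_integral_density (la := @circle_measure R) mp mw1 p0)//.
pose F (t : circle R) := (normc p.[circle_val t] ^+ 2 * w1 t)%:E.
have mF : measurable_fun setT F.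
  by apply/measurable_EFinP; exact: measurable_funM.
have F0 t : (0 <= F t)%E by rewrite lee_fin mulr_ge0// p0.
pose I : set R := [set` `[- 2^-1 : R, 2^-1]].
have Dfin : (mu I < +oo)%E.
  by rewrite lebesgue_measure_itv/=; case: ifP => _; rewrite ?ltry.
have D : measurable (I : set (measurableTypeR R)) by exact: measurable_itv.
have mFc : measurable_fun setT
    (fun x : R => normc p.[circle_val (circle_pt x)] ^+ 2 * w1 (circle_pt x)).
  apply: measurable_funM.
    exact: measurableT_comp mp (@measurable_circle_pt R).
  exact: measurableT_comp mw1 (@measurable_circle_pt R).
have mI : measurable_fun setT (\1_I : measurableTypeR R -> R) by exact: measurable_indic.
have H2 := @ge0_integral_density _ (measurableTypeR R) R (mfrestr D Dfin) mu
  (fun x : R => normc p.[circle_val (circle_pt x)] ^+ 2 * w1 (circle_pt x))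
  (\1_I) mFc mI.
have H := @ge0_integral_pushforward _ _ (measurableTypeR R) _ R (@circle_pt R)
   (@measurable_circle_pt R) (mfrestr D Dfin) setT F measurableT mF (fun t _ => F0 t).
have {}H2 := H2 (fun x => mulr_ge0 (p0 (circle_pt x)) (w10 (circle_pt x))).
rewrite preimage_setT in H.
have HI (E : set (measurableTypeR R)) : measurable E ->
    (mfrestr D Dfin E = \int[mu]_(t in E) (\1_I t)%:E)%E.
  by move=> mE; rewrite integral_indic// setIC.
congr fine; transitivity (\int[mfrestr D Dfin]_x (F \o @circle_pt R) x)%E.
  exact: H.
rewrite [LHS](H2 HI) [RHS]integral_mkcond; apply: eq_integral => x _.
rewrite patchE; case: ifPn => xI; last first.
  by rewrite indicE (negbTE xI) mulr0.
rewrite indicE xI mulr1; move: xI; rewrite inE/= in_itv/= -ler_norml => x2.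
by rewrite w1E.
Qed.

End transport.

(** * The extremal problem on a segment *)

Section monic_err_interval.
Variable R : realType.
Local Open Scope complex_scope.
Local Notation normc := (@Normc.normc R).
Local Notation mu := (@lebesgue_measure R).
Local Notation "\I_ ( a , b ) f" := (\int[mu]_(x in `[a, b]) f x)
  (at level 36, a, b at level 10, f at level 36).

Variable h : R -> R.
Hypothesis h_ge0 : forall a, 0 < a <= 2^-1 -> 0 <= h a.
Hypothesis h_cont : {within `]0, 2^-1], continuous h}.
Variable w : circle R -> R.
Hypothesis w_def : forall theta : R, 0 < `|theta| <= 2^-1 ->
  w (circle_pt theta) = expR (- h `|theta|).
Variable rho : {finite_measure set (circle R) -> \bar R}.
Hypothesis rho_def : forall E : set (circle R), measurable E ->
  (rho E = \int[@circle_measure R]_(t in E) (w t)%:E)%E.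
Variable n : nat.

Local Notation N p := (\I_(- 2^-1, 2^-1) (fun x => normc p.[ee x] ^+ 2 * weight h x)).

Lemma monic_err_ge (M : R) :
  (forall p : {poly R[i]}, p \is monic -> size p = n.+1 -> M <= N p) ->
  Num.sqrt M <= monic_err n rho.
Proof.
move=> HM; rewrite /monic_err; apply: lb_le_inf.
  by exists (Num.sqrt (\int[rho]_t
    normc ((\sum_(i < n) 0 * circle_val t ^+ i) + circle_val t ^+ n) ^+ 2)), (fun=> 0).
move=> _ [q _ <-]; apply: ler_wsqrtr.
pose p : {poly R[i]} := \sum_(i < n) q i *: 'X^i + 'X^n.
pose p0 : {poly R[i]} := \sum_(i < n) q i *: 'X^i.
have sp : (size p0 < size ('X^n : {poly R[i]}))%N.
  rewrite size_polyXn ltnS; apply: (leq_trans (size_sum _ _ _)).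
  apply/bigmax_leqP => i _; rewrite (leq_trans (size_scale_leq _ _))//.
  by rewrite size_polyXn.
have spn : size p = n.+1 by rewrite /p -/p0 addrC size_polyDl// size_polyXn.
have pm : p \is monic.
  by rewrite monicE /p -/p0 addrC lead_coefDl// lead_coefXn.
have := HM p pm spn; rewrite -(rho_integral h_cont w_def rho_def).
congr (_ <= _); apply: eq_Rintegral => t _; congr (normc _ ^+ 2).
rewrite /p hornerD horner_sum hornerXn; congr (_ + _).
by apply: eq_bigr => i _; rewrite hornerZ hornerXn.
Qed.

Lemma monic_err_le (M : R) (p : {poly R[i]}) : p \is monic -> size p = n.+1 ->
  N p <= M -> monic_err n rho <= Num.sqrt M.
Proof.
move=> pm pn NM; apply: (@le_trans _ _ (Num.sqrt (N p))); last exact: ler_wsqrtr.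
rewrite /monic_err; apply: ge_inf.
  by exists 0 => _ [q _ <-]; exact: sqrtr_ge0.
exists (fun i : 'I_n => p`_i) => //.
congr Num.sqrt; rewrite -(rho_integral h_cont w_def rho_def).
apply: eq_Rintegral => t _; congr (normc _ ^+ 2).
rewrite horner_coef pn big_ord_recr /=; congr (_ + _).
by move/monicP: pm; rewrite lead_coefE pn /= => ->; rewrite mul1r.
Qed.

Lemma monic_err_le1 : monic_err n rho <= 1.
Proof.
rewrite -(sqrtr1 R); apply: (@monic_err_le _ ('X^n)).
- exact: monicXn.
- by rewrite size_polyXn.
have h2 : - 2^-1 <= 2^-1 :> R by lra.
rewrite [leRHS](_ : 1 = \I_(- 2^-1, 2^-1) (fun=> 1 : R)); last first.
  by rewrite itv_integral_cst//; field.
apply: le_itv_integral.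
- exact: (weight_integrable h_ge0 h_cont w_def (@continuous_sqr_normc_horner R 'X^n)).
- by apply: continuous_integrable => x; exact: cvg_cst.
move=> x x2; rewrite hornerXn normcX normc_ee !expr1n mul1r.
by apply: weight_le1; rewrite // ler_norml.
Qed.

End monic_err_interval.

(** * The lower bound for the minimal error *)

Section truncated_profile.
Variable R : realType.
Local Notation normc := (@Normc.normc R).
Local Notation mu := (@lebesgue_measure R).
Local Notation "\I_ ( a , b ) f" := (\int[mu]_(x in `[a, b]) f x)
  (at level 36, a, b at level 10, f at level 36).

Variable h : R -> R.
Hypothesis h_ge0 : forall a, 0 < a <= 2^-1 -> 0 <= h a.
Hypothesis h_cont : {within `]0, 2^-1], continuous h}.
Hypothesis h_decr : forall a b, 0 < a -> a < b -> b <= 2^-1 -> h b < h a.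

Lemma h_noninc a b : 0 < a -> a <= b -> b <= 2^-1 -> h b <= h a.
Proof.
move=> a0; rewrite le_eqVlt => /predU1P[-> //|ab] b2.
exact/ltW/h_decr.
Qed.

(** The profile [min (h |x|, h d)], defined by clamping [|x|] to [[d, 1/2]]: it
    is continuous on the whole line when [d > 0]. *)
Definition hcut (d x : R) : R := h (Num.min (Num.max `|x| d) 2^-1).

Lemma continuous_hcut d : 0 < d -> continuous (hcut d).
Proof.
move=> d0 x; pose g (y : R) := Num.min (Num.max `|y| d) 2^-1.
have gA y : [set` `]0 : R, 2^-1]] (g y).
  by rewrite /= in_itv/= /g lt_min lt_max d0 orbT/= ge_min lexx orbT andbT; lra.
have cg : continuous g.
  move=> y; rewrite /g; apply: (@continuous_min _ _ (fun y => Num.max `|y| d) (fun=> 2^-1)).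
    apply: (@continuous_max _ _ (fun y => `|y|) (fun=> d)).
      exact: norm_continuous.
    exact: cvg_cst.
  exact: cvg_cst.
have /subspace_continuousP/(_ (g x) (gA x)) hg := h_cont.
move=> P /hg hP.
have /= hP' : nbhs (g x) (fun y => [set` `]0 : R, 2^-1]] y -> P (h y)) := hP.
have H : \forall y \near x, [set` `]0 : R, 2^-1]] (g y) -> P (h (g y)).
  exact: (cg x _ hP').
suff : \forall y \near x, P (hcut d y) by [].
by apply: filterS H => y; apply; exact: gA.
Qed.

Lemma hcut_out d x : 0 < d -> d <= `|x| -> `|x| <= 2^-1 -> hcut d x = h `|x|.
Proof. by move=> d0 dx x2; rewrite /hcut max_l// min_l. Qed.

Lemma hcut_in d x : d <= 2^-1 -> `|x| <= d -> hcut d x = h d.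
Proof. by move=> d0 dx; rewrite /hcut max_r// min_l. Qed.

Lemma hcutE d x : 0 < d <= 2^-1 -> 0 < x <= 2^-1 -> hcut d x = Num.min (h x) (h d).
Proof.
move=> /andP[d0 d2] /andP[x0 x2].
have [xd|dx] := leP x d.
  by rewrite hcut_in ?gtr0_norm// min_r// h_noninc.
rewrite hcut_out ?gtr0_norm ?(ltW dx)// min_l//.
by rewrite h_noninc// ltW.
Qed.

Lemma hcut_ge0 d x : 0 < d -> 0 <= hcut d x.
Proof.
move=> d0; apply: h_ge0; rewrite lt_min lt_max d0 orbT/= ge_min lexx orbT andbT; lra.
Qed.

Lemma Rintegral_min_hcut d : 0 < d <= 2^-1 ->
  \int[mu]_(a in `]0, 2^-1]) Num.min (h a) (h d) = \I_(0, 2^-1) (hcut d).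
Proof.
move=> d02; have /andP[d0 _] := d02; rewrite -Rintegral_itv_obnd_cbnd; last first.
  apply: (@integrableS _ _ _ mu `[0, 2^-1]) => //.
    by apply: subset_itv; rewrite bnd_simp.
  exact/continuous_integrable/continuous_hcut.
apply: eq_Rintegral => x; rewrite inE/= in_itv/= => x02.
by rewrite hcutE.
Qed.

Lemma itv_integral_hcut_sym d : 0 < d ->
  \I_(- 2^-1, 2^-1) (hcut d) = 2 * \I_(0, 2^-1) (hcut d).
Proof.
move=> d0; have ch := continuous_hcut d0.
have h2 : 0 <= 2^-1 :> R by lra.
rewrite (@itv_integral_split _ (- 2^-1) 0 2^-1); last exact: continuous_integrable.
  rewrite -[X in \I_(- 2^-1, X) _]oppr0 itv_integral_opp// mulr_natl mulr2n.
  by congr (_ + _); apply: eq_itv_integral => x _; rewrite /hcut normrN.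
by apply/andP; split; lra.
Qed.

Variable w : circle R -> R.
Hypothesis w_def : forall theta : R, 0 < `|theta| <= 2^-1 ->
  w (circle_pt theta) = expR (- h `|theta|).
Variable rho : {finite_measure set (circle R) -> \bar R}.
Hypothesis rho_def : forall E : set (circle R), measurable E ->
  (rho E = \int[@circle_measure R]_(t in E) (w t)%:E)%E.

Lemma expR1_ge2 : 2 <= expR 1 :> R.
Proof. by have := expR_ge1Dx (1 : R); lra. Qed.

Lemma exp2_le_expR k : 2 ^+ k <= expR k%:R :> R.
Proof.
rewrite -[k%:R]mulr1 expRM_natl lerXn2r ?nnegrE ?expR_ge0 ?ler0n ?expR1_ge2//.
Qed.

(** The Remez inequality with a constant exponential in [n * d]. *)
Lemma remez_exp (n : nat) (p : {poly R[i]}) (d : R) : (0 < n)%N ->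
  (size p <= n.+1)%N -> 0 < d -> d <= 20^-1 -> 1 <= n%:R * d ->
  \I_(- d, d) (fun x => normc p.[ee x] ^+ 2) <=
  expR (2059 * (n%:R * d)) *
    (\I_(- 2^-1, - d) (fun x => normc p.[ee x] ^+ 2) +
     \I_(d, 2^-1) (fun x => normc p.[ee x] ^+ 2)).
Proof.
move=> n0 pn d0 d20 A1; set A := n%:R * d in A1 *.
(* With the step [s = 1 / (128 n)] the hypothesis [8 * n * s <= 1/16] of
   [remez_l2] is an equality, and [256 * A] steps make up the length [2 * d] of
   the gap. *)
pose K := (Num.truncn (256 * A)).+1.
have A0 : 0 <= 256 * A by lra.
have /andP[K1 K2] := truncn_itv A0.
have KE : K%:R = (Num.truncn (256 * A))%:R + 1 :> R by rewrite natr1.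
have n1 : 1 <= n%:R :> R by rewrite ler1n.
have nn0 : 0 < n%:R :> R by lra.
pose s : R := (128 * n%:R)^-1.
have ns : 128 * n%:R * s = 1 by rewrite divff // mulf_neq0 // gt_eqF.
have s0 : 0 < s by rewrite invr_gt0 mulr_gt0.
have s128 : s <= 128^-1 by nra.
have Ks : 256 * A <= K%:R <= 256 * A + 1 by rewrite (ltW K2)/= KE lerD2r.
have /andP[Ks1 Ks2] := Ks.
have As : 256 * A * s = 2 * d.
  have -> : 256 * A * s = 2 * d * (128 * n%:R * s) by rewrite /A; ring.
  by rewrite ns mulr1.
have c1 : 8 * n%:R * s <= 16^-1 by lra.
have c2 : 2 * d <= K%:R * s by rewrite -As ler_pM2r.
have c3 : 2 * K%:R * s + d <= 2^-1.
  have : K%:R * s <= (256 * A + 1) * s by rewrite ler_pM2r.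
  lra.
have E c a b : \I_(a, b) (fun x => normc (tsum n c x) ^+ 2) =
    \I_(a, b) (fun x => normc (\poly_(k < n.+1) c k).[ee x] ^+ 2).
  by apply: eq_itv_integral => x _; rewrite horner_poly.
have pE : p = \poly_(k < n.+1) p`_k.
  apply/polyP => k; rewrite coef_poly ltnS; case: ltnP => // nk.
  by rewrite nth_default// (leq_trans pn).
have := @remez_l2 R n K (fun k => p`_k) d s isT d0 s0.
rewrite !E -pE => /(_ c1 c2 c3) H; apply: (le_trans H).
apply: ler_wpM2r; first by apply: addr_ge0; apply: itv_integral_ge0 => x _; rewrite sqr_ge0.
(* [3 + 8 * K <= 3 + 8 * (256 * A + 1) <= 2059 * A] since [A >= 1]. *)
apply: (@le_trans _ _ (2 ^+ 3 * (2 ^+ 8) ^+ K)).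
  rewrite (_ : 256 = 2 ^+ 8 :> R); last by rewrite -natrX.
  by rewrite ler_wpM2r ?exprn_ge0// -natrX ler_nat.
rewrite -exprM -exprD (le_trans (exp2_le_expR _))// ler_expR natrD natrM.
by lra.
Qed.

(** Szego's inequality for the profile [2060 * hcut h d], whose part over the
    gap is absorbed by the Remez inequality: of the factor
    [expR (- 2060 * h d)], the constant [expR (2059 * h d)] leaves
    [expR (- h d)], a lower bound of the weight off the gap. *)
Lemma monic_err_ge_hcut (n : nat) (d : R) : (0 < n)%N ->
  0 < d -> d <= 20^-1 -> n%:R * d = h d -> 1 <= h d ->
  expR (- (2^-1 + 2060 * \I_(0, 2^-1) (hcut d))) <= monic_err n rho.
Proof.
move=> n0 d0 d20 nd A1; set S := \I_(_, _) _.
have -> : - (2^-1 + 2060 * S) = (- 1 - 2060 * (2 * S)) / 2 by field.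
have sq (y : R) : expR (y / 2) = Num.sqrt (expR y).
  by rewrite {2}(splitr y) expRD -expr2 sqrtr_sqr ger0_norm ?expR_ge0.
rewrite sq; apply: (monic_err_ge h_cont w_def rho_def) => p pm pn.
have d2 : d <= 2^-1 by lra.
have dm : - d <= d by lra.
have dN2 : - 2^-1 <= - d by rewrite lerN2.
have Nd2 : - d <= 2^-1 by lra.
set f := fun x => normc p.[ee x] ^+ 2.
have cf : continuous f by exact: continuous_sqr_normc_horner.
have f0 x : 0 <= f x by rewrite sqr_ge0.
have ch := continuous_hcut d0.
have ce k : continuous (fun x => f x * expR (- (k * hcut d x))).
  move=> x; apply: cvgM; first exact: cf.
  apply: continuous_comp; last exact: continuous_expR.
  by apply: cvgN; apply: cvgM; [exact: cvg_cst|exact: ch].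
have iw := weight_integrable h_ge0 h_cont w_def cf.
have B1 : - 2^-1 <= - d <= 2^-1 by rewrite dN2 Nd2.
have B2 : - d <= d <= 2^-1 by rewrite dm d2.
pose k : R := 2060.
have sz : \I_(- 2^-1, 2^-1) (fun x => f x * expR (- (k * hcut d x))) >=
    expR (- (k * (2 * S))).
  have ckh : continuous (fun x => k * hcut d x).
    by move=> x; apply: cvgM; [exact: cvg_cst|exact: ch].
  rewrite -itv_integral_hcut_sym// -itv_integralZl; last exact: continuous_integrable.
  exact: szego_lower_bound.
have gap : \I_(- d, d) (fun x => f x * expR (- (k * hcut d x))) <=
    expR (- h d) * (\I_(- 2^-1, - d) f + \I_(d, 2^-1) f).
  have -> : \I_(- d, d) (fun x => f x * expR (- (k * hcut d x))) =
      \I_(- d, d) (fun x => expR (- (k * h d)) * f x).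
    apply: eq_itv_integral => x xd; rewrite mulrC hcut_in//.
    by rewrite ler_norml.
  rewrite itv_integralZl; last exact: continuous_integrable.
  have -> : - h d = - (k * h d) + 2059 * h d by rewrite /k; ring.
  rewrite expRD -mulrA ler_wpM2l ?expR_ge0// -nd.
  by apply: remez_exp; rewrite ?pn// nd.
have side a b : - 2^-1 <= a -> a <= b -> b <= 2^-1 ->
    (forall x, a <= x <= b -> d <= `|x| <= 2^-1) ->
    \I_(a, b) (fun x => f x * expR (- (k * hcut d x))) + expR (- h d) * \I_(a, b) f
    <= 2 * \I_(a, b) (fun x => f x * weight h x).
  move=> a2 ab b2 abd.
  have iwab : mu.-integrable `[a, b] (EFin \o (fun x => f x * weight h x)).
    exact: integrable_subitv iw.
  rewrite -!itv_integralZl//; last exact: continuous_integrable.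
  rewrite -itv_integralD; last 2 first.
  - exact: continuous_integrable.
  - apply: continuous_integrable => x; apply: cvgM; [exact: cvg_cst|exact: cf].
  apply: le_itv_integral.
  - apply: continuous_integrable => x; apply: (@cvgD _ R^o); first exact: ce.
    by apply: cvgM; [exact: cvg_cst|exact: cf].
  - exact: (integrableZl _ 2 iwab).
  move=> x /abd /andP[dx x2].
  have x0 : x != 0 by rewrite -normr_gt0 (lt_le_trans d0).
  rewrite /weight (negbTE x0) hcut_out//.
  have hx0 : 0 <= h `|x| by apply: h_ge0; rewrite (lt_le_trans d0).
  have hxd : h `|x| <= h d by rewrite h_noninc.
  have e1 : expR (- (k * h `|x|)) <= expR (- h `|x|).
    by rewrite ler_expR lerN2 ler_peMl// /k ler1n.
  have e2 : expR (- h d) <= expR (- h `|x|) by rewrite ler_expR lerN2.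
  by have := ler_wpM2l (f0 x) e1; have := ler_wpM2l (f0 x) e2; lra.
have sl : \I_(- 2^-1, - d) (fun x => f x * expR (- (k * hcut d x))) +
   expR (- h d) * \I_(- 2^-1, - d) f <= 2 * \I_(- 2^-1, - d) (fun x => f x * weight h x).
  apply: side; [exact: lexx|exact: dN2|exact: Nd2|].
  move=> x /andP[x1 x2]; rewrite ltr0_norm.
    by rewrite lerNr x2 lerNl x1.
  by rewrite (le_lt_trans x2)// oppr_lt0.
have sr : \I_(d, 2^-1) (fun x => f x * expR (- (k * hcut d x))) +
   expR (- h d) * \I_(d, 2^-1) f <= 2 * \I_(d, 2^-1) (fun x => f x * weight h x).
  apply: side; [exact: le_trans dN2 dm|exact: d2|exact: lexx|].
  move=> x /andP[x1 x2]; rewrite gtr0_norm; first by rewrite x1 x2.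
  exact: lt_le_trans d0 x1.
have wgap : 0 <= \I_(- d, d) (fun x => f x * weight h x).
  by apply: itv_integral_ge0 => x _; rewrite mulr_ge0 ?weight_ge0.
rewrite (itv_integral_split B1 iw).
rewrite (itv_integral_split B2); last first.
  exact: integrable_subitv dN2 (lexx _) iw.
move: sz; rewrite (itv_integral_split B1); last exact: continuous_integrable.
rewrite (itv_integral_split B2); last exact: continuous_integrable.
move=> sz.
have e12 : expR (-1 - 2060 * (2 * S)) <= 2^-1 * expR (- (k * (2 * S))).
  rewrite expRD ler_wpM2r ?expR_ge0// expRN lef_pV2 ?posrE ?expR_gt0//.
  exact: expR1_ge2.
apply: (le_trans e12).
move: (\I_(- 2^-1, - d) f) (\I_(d, 2^-1) f) (expR (- h d)) gap sl sr => u v e gap sl sr.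
by clear -gap sl sr sz wgap; lra.
Qed.

End truncated_profile.

(** * Chebyshev polynomials of an arc *)

Section chebyshev.
Variable R : realType.
Local Open Scope complex_scope.
Local Notation normc := (@Normc.normc R).
Implicit Types (a x y r : R) (m : nat).

(** The polynomial with [(cheb a m).[ee x] = ee x ^+ m * tcheb a y m] for
    [y = 4 * cos (pi * x) ^+ 2 - 2 * a]; it is monic of degree [2 * m] when
    [m > 0].  For [a = cos (pi * e) ^+ 2] it is the Chebyshev polynomial of the
    arc [|x| >= e], since there [y] runs over [[- 2 * a, 2 * a]]. *)
Fixpoint cheb a m : {poly R[i]} :=
  match m with
  | 0 => 2%:P
  | 1 => 'X^2 + ((2 - 2 * a)%:C)%:P * 'X + 1
  | (m''.+1 as m').+1 =>
      ('X^2 + ((2 - 2 * a)%:C)%:P * 'X + 1) * cheb a m' -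
      ((a ^+ 2)%:C)%:P * 'X^2 * cheb a m''
  end.

(** The Chebyshev polynomials of the segment [[- 2 * a, 2 * a]], by their
    three-term recurrence; the normalization is
    [tcheb a (2 * a * cos f) m = 2 * a ^+ m * cos (m * f)]. *)
Fixpoint tcheb a y m : R :=
  match m with
  | 0 => 2
  | 1 => y
  | (m''.+1 as m').+1 => y * tcheb a y m' - a ^+ 2 * tcheb a y m''
  end.

Lemma two_step_ind (P : nat -> Prop) : P 0%N -> P 1%N ->
  (forall m, P m -> P m.+1 -> P m.+2) -> forall m, P m.
Proof.
move=> P0 P1 PS m; suff : P m /\ P m.+1 by case.
by elim: m => [|m [Pm Pm1]]; split => //; exact: PS.
Qed.

Lemma cheb_ee a x m :
  (cheb a m).[ee x] = ee x ^+ m * (tcheb a (2 * cos (2 * pi * x) + 2 - 2 * a) m)%:C.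
Proof.
set y := 2 * _ + 2 - _.
have e1 : ee x ^+ 2 + (2 - 2 * a)%:C * ee x + 1 = ee x * y%:C.
  have -> : y%:C = ee x + (ee x)^-1 + (2 - 2 * a)%:C.
    rewrite -eeN /ee mulrN cosN sinN /y; apply/eqP.
    by rewrite eq_complex /= subrr addr0 eqxx andbT; apply/eqP; ring.
  by field; exact: ee_neq0.
elim/two_step_ind : m => [||m IH1 IH2].
- by rewrite /= hornerC expr0 mul1r rmorph_nat.
- by rewrite /= !hornerE /= expr1.
rewrite [cheb a m.+2]/= -/(cheb a m.+1) [tcheb a y m.+2]/= -/(tcheb a y m.+1).
rewrite !(hornerD, hornerN, hornerM, hornerC, hornerX, hornerXn) IH1 IH2 e1.
have -> (u v c d : R) : (u * v - c * d)%:C = u%:C * v%:C - c%:C * d%:C.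
  by rewrite rmorphB !rmorphM.
move: (y%:C) ((a ^+ 2)%:C) (_%:C) (_%:C) => u v c d.
by rewrite (exprS _ m.+1) (exprS _ m); ring.
Qed.

Lemma size_cheb1 a : size (cheb a 1) = 3 /\ cheb a 1 \is monic.
Proof.
pose q : {poly R[i]} := ((2 - 2 * a)%:C)%:P * 'X + 1.
have s1 : (size q < 3)%N.
  rewrite ltnS (leq_trans (size_polyD _ _))// geq_max size_poly1 andbT.
  rewrite mul_polyC (leq_trans (size_scale_leq _ _))// size_polyX//.
rewrite /= -addrA -/q; split.
  by rewrite size_polyDl size_polyXn.
by rewrite monicE lead_coefDl ?size_polyXn// lead_coefXn.
Qed.

Lemma size_cheb a m : (size (cheb a m) <= m.*2.+1)%N /\
  ((0 < m)%N -> size (cheb a m) = m.*2.+1 /\ cheb a m \is monic).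
Proof.
have [s1 m1] := size_cheb1 a.
elim/two_step_ind : m => [||m [IH1 _] [_ /(_ isT) [IH2 IH2m]]].
- by split => //; rewrite /= size_polyC; case: eqP.
- by split => [|_]; rewrite ?s1.
rewrite [cheb a m.+2]/= -/(cheb a m.+1) -[_ + _ + 1]/(cheb a 1).
have sA : size (cheb a 1 * cheb a m.+1) = m.+2.*2.+1.
  by rewrite size_proper_mul ?(monicP m1) ?(monicP IH2m) ?mulr1 ?oner_neq0// s1 IH2.
pose q := cheb a 1 * cheb a m.+1; pose q' := ((a ^+ 2)%:C)%:P * 'X^2 * cheb a m.
have sB : (size (- q') < size q)%N.
  rewrite sA size_polyN /q' -mulrA mul_polyC.
  apply: leq_ltn_trans (size_scale_leq _ _) _.
  apply: leq_ltn_trans (size_polyMleq _ _) _; rewrite size_polyXn.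
  by move: IH1; rewrite !doubleS; move: (size _) (m.*2) => k l; lia.
rewrite -/q -/q'; have -> : size (q - q') = m.+2.*2.+1.
  by rewrite size_polyDl.
split => // _; split => //.
by rewrite monicE lead_coefDl// lead_coefM (monicP m1) (monicP IH2m) mulr1.
Qed.

Lemma tcheb_cos a f m : tcheb a (2 * a * cos f) m = 2 * a ^+ m * cos (m%:R * f).
Proof.
elim/two_step_ind : m => [||m IH1 IH2].
- by rewrite /= mul0r cos0 expr0 !mulr1.
- by rewrite /= mul1r expr1.
rewrite [LHS]/= -/(tcheb a (2 * a * cos f) m.+1) IH1 IH2.
have e1 : m.+1%:R * f = m%:R * f + f by rewrite -natr1; ring.
have e2 : m.+2%:R * f = m%:R * f + f + f by rewrite -natr1 -natr1; ring.
rewrite e1 e2 !cosD !sinD !exprS.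
have s2 : sin f * sin f = 1 - cos f * cos f by rewrite -!expr2 sin2cos2.
move: (cos (_ * f)) (sin (_ * f)) => c s; ring: s2.
Qed.

Lemma tcheb_hyp a r m : r != 0 ->
  tcheb a (a * (r + r^-1)) m = a ^+ m * (r ^+ m + r^-1 ^+ m).
Proof.
move=> r0; elim/two_step_ind : m => [||m IH1 IH2].
- by rewrite /= !expr0 mul1r.
- by rewrite /= !expr1.
rewrite [LHS]/= -/(tcheb a (a * (r + r^-1)) m.+1) IH1 IH2 !exprS.
by field.
Qed.

Lemma tcheb_small a y m : 0 < a -> `|y| <= 2 * a -> `|tcheb a y m| <= 2 * a ^+ m.
Proof.
move=> a0 ya.
have y1 : -1 <= y / (2 * a) <= 1.
  rewrite -ler_norml normrM normfV [`|2 * a|]gtr0_norm ?mulr_gt0//.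
  by rewrite ler_pdivrMr ?mulr_gt0// mul1r.
have -> : y = 2 * a * cos (acos (y / (2 * a))).
  by rewrite acosK ?in_itv//= mulrC divfK// mulf_neq0// gt_eqF.
rewrite tcheb_cos normrM ger0_norm ?mulr_ge0 ?exprn_ge0 ?(ltW a0)//.
by rewrite ler_piMr ?cos_max// mulr_ge0 ?exprn_ge0 ?(ltW a0).
Qed.

(** Growth off the segment, at a point [y] written as [a * (r + r^-1)] with
    [1 <= r <= expR (4 * t)]. *)
Lemma tcheb_large a y t m : 0 < a -> 0 <= t -> 2 * a <= y ->
  y <= 2 * a * (1 + 2 * t ^+ 2) ->
  0 <= tcheb a y m <= 2 * a ^+ m * expR (4 * t * m%:R).
Proof.
move=> a0 t0 ya yt.
(* The number [r] is [(s + q) ^+ 2] with [q ^+ 2 = 1 + s ^+ 2], that is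
   [r = exp (2 * arsinh s)]. *)
pose s := Num.sqrt ((y / (2 * a) - 1) / 2).
have a20 : 0 < 2 * a by rewrite mulr_gt0.
have s2 : s ^+ 2 = (y / (2 * a) - 1) / 2.
  by rewrite sqr_sqrtr// divr_ge0// subr_ge0 ler_pdivlMr// mul1r.
have s0 : 0 <= s by exact: sqrtr_ge0.
have st : s <= t.
  rewrite -(@ler_pXn2r _ 2) ?nnegrE// s2 ler_pdivrMr// lerBlDr ler_pdivrMr//; nra.
pose q := Num.sqrt (1 + s ^+ 2).
have q2 : q ^+ 2 = 1 + s ^+ 2 by rewrite sqr_sqrtr// addr_ge0// sqr_ge0.
have q0 : 0 <= q by exact: sqrtr_ge0.
have qs : q <= 1 + s.
  by rewrite -(@ler_pXn2r _ 2) ?nnegrE ?addr_ge0// q2; nra.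
have q1 : 1 <= q.
  by rewrite -(@ler_pXn2r _ 2) ?nnegrE// q2 expr1n lerDl sqr_ge0.
pose r := (s + q) ^+ 2.
have r1 : 1 <= r by rewrite /r expr_ge1//; lra.
have r0 : r != 0 by rewrite gt_eqF//; lra.
have rV : r^-1 = (q - s) ^+ 2.
  apply: (mulfI r0); rewrite divff// /r -exprMn (_ : (s + q) * (q - s) = q ^+ 2 - s ^+ 2).
    by rewrite q2 addrK expr1n.
  by ring.
have yE : y = a * (r + r^-1).
  have -> : r + r^-1 = 2 * s ^+ 2 + 2 * q ^+ 2 by rewrite rV /r; ring.
  by rewrite q2 s2; field; rewrite gt_eqF.
rewrite yE tcheb_hyp//.
have rm0 : 0 <= r ^+ m by rewrite exprn_ge0//; lra.
have rV0 : 0 <= r^-1 ^+ m by rewrite exprn_ge0// invr_ge0; lra.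
have rVm : r^-1 ^+ m <= r ^+ m.
  rewrite lerXn2r ?nnegrE ?invr_ge0; try lra.
  by rewrite (le_trans _ r1)// invf_le1//; lra.
have am0 : 0 <= a ^+ m by rewrite exprn_ge0// ltW.
apply/andP; split; first by rewrite mulr_ge0// addr_ge0.
have rexp : r ^+ m <= expR (4 * t * m%:R).
  rewrite expRM_natr lerXn2r ?nnegrE ?expR_ge0//; first by lra.
  have -> : 4 * t = 2%:R * (2 * t) by ring.
  rewrite expRM_natl /r lerXn2r ?nnegrE ?expR_ge0 ?addr_ge0//.
  by apply: le_trans (expR_ge1Dx _); lra.
nra.
Qed.

End chebyshev.

Section chebyshev_upper.
Variable R : realType.
Local Open Scope complex_scope.
Local Notation normc := (@Normc.normc R).
Local Notation mu := (@lebesgue_measure R).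
Local Notation "\I_ ( a , b ) f" := (\int[mu]_(x in `[a, b]) f x)
  (at level 36, a, b at level 10, f at level 36).

Variable h : R -> R.
Hypothesis h_ge0 : forall a, 0 < a <= 2^-1 -> 0 <= h a.
Hypothesis h_cont : {within `]0, 2^-1], continuous h}.
Hypothesis h_decr : forall a b, 0 < a -> a < b -> b <= 2^-1 -> h b < h a.
Variable w : circle R -> R.
Hypothesis w_def : forall theta : R, 0 < `|theta| <= 2^-1 ->
  w (circle_pt theta) = expR (- h `|theta|).
Variable rho : {finite_measure set (circle R) -> \bar R}.
Hypothesis rho_def : forall E : set (circle R), measurable E ->
  (rho E = \int[@circle_measure R]_(t in E) (w t)%:E)%E.

Lemma monic_err_le_pointwise n (p : {poly R[i]}) (M : R) :
  p \is monic -> size p = n.+1 -> 0 <= M ->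
  (forall x, 0 < `|x| <= 2^-1 -> normc p.[ee x] ^+ 2 * expR (- h `|x|) <= M) ->
  monic_err n rho <= Num.sqrt M.
Proof.
move=> pm pn M0 pM; apply: (monic_err_le h_cont w_def rho_def pm pn).
have h2 : - 2^-1 <= 2^-1 :> R by lra.
rewrite [leRHS](_ : M = \I_(- 2^-1, 2^-1) (fun=> M)); last first.
  by rewrite itv_integral_cst//; field.
apply: le_itv_integral.
- exact: (weight_integrable h_ge0 h_cont w_def (@continuous_sqr_normc_horner R p)).
- by apply: continuous_integrable => x; exact: cvg_cst.
move=> x; rewrite -ler_norml => x2; rewrite /weight; case: eqP => [_|/eqP x0].
  by rewrite mulr0.
by apply: pM; rewrite normr_gt0 x0.
Qed.

Lemma sqr_cos_pi_le (s t : R) : 0 <= s <= t -> t <= 2^-1 ->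
  cos (pi * t) ^+ 2 <= cos (pi * s) ^+ 2.
Proof.
move=> /andP[s0 st] t2; have p2 := pi_ge2 R.
have pst : pi * s <= pi * t by rewrite ler_wpM2l// pi_ge0.
have pt2 : pi * t <= pi / 2 by rewrite ler_wpM2l// pi_ge0.
have ps0 : 0 <= pi * s by rewrite mulr_ge0// pi_ge0.
have ct : 0 <= cos (pi * t) by apply: cos_ge0_pihalf; apply/andP; split; lra.
have cs : 0 <= cos (pi * s) by apply: cos_ge0_pihalf; apply/andP; split; lra.
rewrite lerXn2r ?nnegrE// leNgt ltr_cos -?leNgt// in_itv/=; apply/andP; split; lra.
Qed.

Lemma half_bounds n : (1 < n)%N -> (n./2 * 2 <= n)%N /\ (n <= n./2 * 3)%N.
Proof.
move=> n1; have nE := odd_double_half n.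
have := leq_b1 (odd n); move: nE n1.
by move: (n./2) (odd n : nat) => k b; rewrite -muln2; lia.
Qed.

(** The test polynomial is the Chebyshev polynomial of the arc [|x| >= d / 64],
    times ['X] when [n] is odd. *)
Lemma monic_err_upper_cheb n d : (1 < n)%N -> 0 < d -> d <= 20^-1 ->
  n%:R * d = h d ->
  monic_err n rho <= 2 * expR (- (h d * d / 2 ^+ 16)).
Proof.
move=> n1 d0 d20 nd; set m := n./2.
have m0 : (0 < m)%N by rewrite half_gt0.
pose u : R := pi * (d / 64).
pose a : R := cos u ^+ 2.
have p2 := pi_ge2 R; have /andP[p0 p4] := pihalf_02 R.
have u0 : 0 <= u by rewrite /u; nra.
have u16 : u <= d / 16 by rewrite /u; nra.
have su : d / 128 <= sin u.
  rewrite (le_trans _ (@sin_pi_ge _ (d / 64) _))//; lra.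
have su' : `|sin u| <= u by exact: norm_sin_le_id.
have aE : a = 1 - sin u ^+ 2 by rewrite /a cos2sin2.
have su2 : sin u ^+ 2 <= u ^+ 2 by rewrite -real_normK ?num_real// lerXn2r ?nnegrE.
have su2' : (d / 128) ^+ 2 <= sin u ^+ 2.
  by rewrite lerXn2r ?nnegrE ?divr_ge0//; lra.
have u2 : u ^+ 2 <= 2^-1 by nra.
have a2 : 2^-1 <= a by lra.
have a0 : 0 < a by lra.
have a1 : a <= 1 by rewrite aE gerBl sqr_ge0.
have [mn0 nm0] := half_bounds n1.
have nE : n = (odd n + m.*2)%N by rewrite odd_double_half.
have mn : m%:R <= n%:R / 2 :> R.
  have : (m * 2)%:R <= n%:R :> R by rewrite ler_nat.
  rewrite natrM; lra.
have nm : n%:R <= 3 * m%:R :> R.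
  have : n%:R <= (m * 3)%:R :> R by rewrite ler_nat.
  rewrite natrM; lra.
pose M : R := 4 * expR (- (h d * d / 2 ^+ 15)).
have -> : 2 * expR (- (h d * d / 2 ^+ 16)) = Num.sqrt M.
  rewrite /M (_ : h d * d / 2 ^+ 15 = h d * d / 2 ^+ 16 + h d * d / 2 ^+ 16); last by field.
  rewrite opprD expRD -expr2 (_ : 4 = 2 ^+ 2 :> R); last by ring.
  by rewrite -exprMn sqrtr_sqr ger0_norm// mulr_ge0 ?expR_ge0.
have hd0 : 0 <= h d by apply: h_ge0; rewrite d0/=; lra.
have [_ /(_ m0) [sc mc]] := size_cheb a m.
pose p := 'X^(odd n) * cheb a m.
have pm : p \is monic by rewrite monicMl ?monicXn.
have sp : size p = n.+1.
  by rewrite /p mulrC size_mulXn ?monic_neq0// sc [in RHS]nE addnS.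
apply: (@monic_err_le_pointwise n p) => //.
  by rewrite mulr_ge0 ?expR_ge0.
move=> x /andP[x0 x2].
rewrite /p hornerM hornerXn cheb_ee !Normc.normcM !normcX normc_ee !expr1n !mul1r.
rewrite normc_real real_normK ?num_real//.
have -> : 2 * cos (2 * pi * x) + 2 - 2 * a = 4 * cos (pi * `|x|) ^+ 2 - 2 * a.
  rewrite -[cos (2 * _ * _)]cos_norm normrM gtr0_norm; last by rewrite mulr_gt0//; lra.
  have -> : 2 * pi * `|x| = (pi * `|x|) *+ 2 by rewrite -mulr_natl; ring.
  by rewrite cos_mulr2n -[_ *+ 2]mulr_natl; ring.
have hx0 : 0 <= h `|x| by apply: h_ge0; rewrite x0.
(* On the arc, the gain comes from [a <= 1 - (d / 128) ^+ 2]. *)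
have [xd|dx] := leP (d / 64) `|x|.
  have cle : cos (pi * `|x|) ^+ 2 <= a.
    by rewrite /a /u sqr_cos_pi_le// xd divr_ge0// ltW.
  have cge : 0 <= cos (pi * `|x|) ^+ 2 by rewrite sqr_ge0.
  set y := _ - 2 * a.
  have ya : `|y| <= 2 * a.
    rewrite ler_norml /y; move: cge cle; move: (cos _ ^+ 2) a0 => c a0' cge cle.
    by clear -a0' cge cle; apply/andP; split; lra.
  have t1 := tcheb_small m a0 ya.
  have t2 : tcheb a y m ^+ 2 <= (2 * a ^+ m) ^+ 2.
    rewrite -real_normK ?num_real// lerXn2r ?nnegrE ?normr_ge0//.
    by rewrite (le_trans _ t1).
  apply: (@le_trans _ _ (tcheb a y m ^+ 2)).
    by rewrite ler_piMr ?sqr_ge0// expR_le1 oppr_le0.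
  apply: (le_trans t2); rewrite exprMn /M (_ : 2 ^+ 2 = 4 :> R); last by ring.
  rewrite ler_wpM2l// -exprM.
  apply: (@le_trans _ _ (expR (- (d / 128) ^+ 2) ^+ (m * 2))).
    rewrite lerXn2r ?nnegrE ?expR_ge0 ?(ltW a0)//.
    by apply: (le_trans _ (expR_ge1Dx _)); lra.
  rewrite -expRM_natl ler_expR -nd natrM.
  have d20' : 0 <= d ^+ 2 by rewrite sqr_ge0.
  nra.
(* Off the arc, the square of the polynomial is at most
   [4 * expR (8 * t * m)] with [8 * t * m = d * m <= h d / 2], while the weight
   is at most [expR (- h d)]. *)
have hxd : h d <= h `|x| by apply: h_noninc => //; lra.
pose t : R := d / 8.
have cge : a <= cos (pi * `|x|) ^+ 2.
  by rewrite /a /u sqr_cos_pi_le ?(ltW x0) ?(ltW dx)//; lra.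
have cle : cos (pi * `|x|) ^+ 2 <= 1 by rewrite -[leRHS](cos2Dsin2 (pi * `|x|)) lerDl sqr_ge0.
set y := _ - 2 * a.
have t0 : 0 <= t by rewrite /t; lra.
have y1 : 2 * a <= y by rewrite /y; lra.
have y2 : y <= 2 * a * (1 + 2 * t ^+ 2).
  have ut : u ^+ 2 <= t ^+ 2 / 4 by rewrite /t; nra.
  have : t ^+ 2 / 2 <= a * t ^+ 2 by have := sqr_ge0 t; nra.
  rewrite /y; nra.
have /andP[t1 t2] := tcheb_large m a0 t0 y1 y2.
have t3 : tcheb a y m <= 2 * expR (4 * t * m%:R).
  apply: (le_trans t2); rewrite ler_wpM2r ?expR_ge0//.
  by rewrite ler_piMr// exprn_ile1// ltW.
have t4 : tcheb a y m ^+ 2 <= (2 * expR (4 * t * m%:R)) ^+ 2.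
  by rewrite lerXn2r ?nnegrE// mulr_ge0 ?expR_ge0.
apply: (@le_trans _ _ ((2 * expR (4 * t * m%:R)) ^+ 2 * expR (- h d))).
  by rewrite ler_pM ?sqr_ge0 ?expR_ge0// ler_expR lerN2.
rewrite exprMn /M -expRM_natl -(mulrA (2 ^+ 2)) -expRD (_ : 2 ^+ 2 = 4 :> R); last by ring.
rewrite ler_wpM2l// ler_expR -nd /t.
have : d * m%:R <= d * (n%:R / 2) by rewrite ler_wpM2l// ltW.
have : 0 <= n%:R * d by rewrite mulr_ge0// ltW.
nra.
Qed.

End chebyshev_upper.

(** * Polynomial factors of Jackson type *)

Section jackson_factors.
Variable R : realType.
Local Open Scope complex_scope.
Local Notation normc := (@Normc.normc R).

Lemma expR_ge_cubic (t : R) : 1 + t + t ^+ 2 / 2 + t ^+ 3 / 6 <= expR t.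
Proof.
pose F (s : R) := expR (- s) * (1 + s + s ^+ 2 / 2 + s ^+ 3 / 6).
pose dF (s : R) := - (expR (- s) * (s ^+ 3 / 6)).
have dFE (s : R) : is_derive s (1 : R) F (dF s).
  rewrite /F; apply: is_derive_eq; rewrite /dF /GRing.scale /=; by field.
have cF : continuous F.
  by move=> s; apply/differentiable_continuous/derivable1_diffP/ex_derive.
have F0 : F 0 = 1 by rewrite /F oppr0 expR0 !expr0n /= !mul0r !addr0 mulr1.
suff : F t <= 1.
  by rewrite /F expRN ler_pdivrMl ?expR_gt0// mulr1.
rewrite -F0; case: (ltgtP t 0) => [t0|t0|->]; last by [].
- have [|c /[!in_itv]/= /andP[tc c0] E] := @MVT R F dF t 0 t0 (fun x _ => dFE x).
    exact: continuous_subspaceT.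
  have c3 : c ^+ 3 <= 0 by rewrite (exprS c 2); have := sqr_ge0 c; nra.
  rewrite -subr_ge0 E /dF sub0r mulrNN -mulrA mulr_ge0 ?expR_ge0//.
  by rewrite mulr_le0 ?(ltW t0)// pmulr_lle0 ?invr_gt0.
- have [|c /[!in_itv]/= /andP[c0 ct] E] := @MVT R F dF 0 t t0 (fun x _ => dFE x).
    exact: continuous_subspaceT.
  have c3 : 0 <= c ^+ 3 by rewrite exprn_ge0// ltW.
  rewrite -subr_le0 E /dF subr0 mulNr oppr_le0.
  by rewrite !mulr_ge0 ?expR_ge0// ltW.
Qed.

(** Up to a cubic error in the exponent, the Taylor polynomial of degree [2] of
    the exponential has the modulus of the exponential. *)
Lemma sqr_normc_taylor2 (z : R[i]) : normc z <= 1 ->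
  normc (1 + z + 2^-1%:C * z ^+ 2) ^+ 2 <= expR (2 * complex.Re z + 32 * normc z ^+ 3).
Proof.
have -> : normc (1 + z + 2^-1%:C * z ^+ 2) ^+ 2 =
    1 + 2 * complex.Re z + 2 * complex.Re z ^+ 2 + complex.Re z ^+ 3 +
    complex.Re z * complex.Im z ^+ 2 +
    (complex.Re z ^+ 2 + complex.Im z ^+ 2) ^+ 2 / 4.
  by rewrite sqr_normcE expr2; case: z => a b /=; field.
have r0 := normc_ge0 z; have := sqr_normcE z.
move: (normc z) (complex.Re z) (complex.Im z) r0 => r a b r0 r2 r1.
have ab : `|a| <= r.
  rewrite -(@ler_pXn2r _ 2) ?nnegrE// real_normK ?num_real// r2 lerDl sqr_ge0.
  by [].
have b2 : b ^+ 2 <= r ^+ 2 by rewrite r2 lerDr sqr_ge0.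
have r3 : 0 <= r ^+ 3 by rewrite exprn_ge0.
have ab3 : `|a| * b ^+ 2 <= r ^+ 3.
  by rewrite (exprS r 2) ler_pM// sqr_ge0.
have a3 : `|a| ^+ 3 <= r ^+ 3 by rewrite lerXn2r ?nnegrE.
have r4 : (a ^+ 2 + b ^+ 2) ^+ 2 <= r ^+ 3.
  by rewrite -r2 -exprM ler_wiXn2l.
have aa : - `|a| <= a <= `|a| by rewrite -ler_norml.
have a3' : - (a ^+ 3) <= `|a| ^+ 3 by rewrite -normrX -normrN ler_norm.
have ab' : a * b ^+ 2 <= `|a| * b ^+ 2.
  by rewrite ler_wpM2r ?sqr_ge0//; lra.
have e1 := expR_ge_cubic (2 * a).
have e2 : 1 - 2 * r <= expR (2 * a).
  by apply: le_trans (expR_ge1Dx _); lra.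
have e3 : 16^-1 <= expR (2 * a).
  have -> : 2 * a = 4%:R * (a / 2) by field.
  rewrite expRM_natl (_ : 16^-1 = 2^-1 ^+ 4 :> R); last by field.
  rewrite lerXn2r ?nnegrE ?expR_ge0 ?invr_ge0//.
  by apply: le_trans (expR_ge1Dx _); lra.
have e4 := expR_ge1Dx (32 * r ^+ 3).
rewrite expRD.
have : expR (2 * a) * (1 + 32 * r ^+ 3) <= expR (2 * a) * expR (32 * r ^+ 3).
  by rewrite ler_wpM2l ?expR_ge0.
have X1 : 16^-1 * (32 * r ^+ 3) <= expR (2 * a) * (32 * r ^+ 3).
  by rewrite ler_wpM2r// mulr_ge0.
have X2 : (2 * a) ^+ 3 = 8 * a ^+ 3 by ring.
have X3 : (2 * a) ^+ 2 = 4 * a ^+ 2 by ring.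
rewrite X2 X3 in e1.
lra.
Qed.

Variable d : nat.
Hypothesis d_gt0 : (0 < d)%N.

(** The Dirichlet sum [1 + 'X + ... + 'X^(d - 1)] and the coefficients of its
    square, the triangular Fejer weights. *)
Definition geom_poly : {poly R} := \poly_(k < d) 1.
Definition fejer (i : nat) : R := (geom_poly ^+ 2)`_i.
Local Notation G := fejer.
Local Notation N := (d.*2).

Lemma coef_geom_poly i : geom_poly`_i = (i < d)%:R.
Proof. by rewrite coef_poly; case: ifP. Qed.

Lemma size_geom_poly : (size geom_poly <= d)%N.
Proof. exact: size_poly. Qed.

Lemma size_sqr_geom_poly : (size (geom_poly ^+ 2) <= N.-1)%N.
Proof.
apply: (leq_trans (size_polyMleq _ _)).
by have := size_geom_poly; move: (size geom_poly) => k kd; rewrite -addnn; lia.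
Qed.

Lemma fejer_ge0 i : 0 <= G i.
Proof.
rewrite /fejer expr2 coefM; apply: sumr_ge0 => j _.
by rewrite !coef_geom_poly mulr_ge0.
Qed.

Lemma fejer_out i : (N.-1 <= i)%N -> G i = 0.
Proof. by move=> Ni; rewrite /fejer nth_default// (leq_trans size_sqr_geom_poly). Qed.

Lemma geom_poly_mul : ('X - 1) * geom_poly = 'X^d - 1.
Proof.
rewrite subrX1; congr (_ * _); rewrite /geom_poly poly_def.
by apply: eq_bigr => i _; rewrite scale1r.
Qed.

Lemma fejer_step i : `|G i.+1 - G i| <= 1.
Proof.
have E : G i - G i.+1 = ('X^d * geom_poly)`_i.+1 - geom_poly`_i.+1.
  have : (('X - 1) * geom_poly ^+ 2)`_i.+1 = (('X^d - 1) * geom_poly)`_i.+1.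
    by rewrite expr2 mulrA geom_poly_mul.
  by rewrite !mulrBl !mul1r !coefB coefXM /=.
rewrite -normrN opprB E coefXnM !coef_geom_poly; case: ifP => _.
  by rewrite sub0r normrN normr_nat; case: (_ < _)%N; rewrite ?lexx ?ler01.
by do 2 case: (_ < _)%N;
  rewrite /= ?mulr1n ?mulr0n ?subrr ?subr0 ?sub0r ?normrN ?normr1 ?normr0 ?lexx ?ler01.
Qed.

Lemma fejer_le i : G i <= i.+1%:R.
Proof.
elim: i => [|i IH].
  rewrite /fejer expr2 coefM big_ord1 !coef_geom_poly -natrM ler_nat.
  by case: (_ < _)%N.
have := fejer_step i; rewrite ler_norml => /andP[_ h1].
by rewrite -[i.+2%:R]natr1; lra.
Qed.

Lemma fejer_sum : \sum_(i < N) G i = d%:R ^+ 2.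
Proof.
have <- : (geom_poly ^+ 2).[1] = d%:R ^+ 2.
  rewrite horner_exp /geom_poly horner_poly; congr (_ ^+ 2).
  by under eq_bigr do rewrite mul1r expr1n; rewrite sumr_const card_ord.
rewrite (@horner_coef_wide _ N); last by rewrite (leq_trans size_sqr_geom_poly)// leq_pred.
by apply: eq_bigr => i _; rewrite expr1n mulr1.
Qed.

(** The constant Fourier coefficient of [|geom_poly|^4]. *)
Definition fejer_energy : R := \sum_(i < N) G i ^+ 2.
Local Notation a0 := fejer_energy.

Lemma fejer_energy_ge : d%:R ^+ 3 / 2 <= a0.
Proof.
have : 0 <= \sum_(i < N) (G i - d%:R / 2) ^+ 2.
  by apply: sumr_ge0 => i _; rewrite sqr_ge0.
have -> : \sum_(i < N) (G i - d%:R / 2) ^+ 2 =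
    \sum_(i < N) (G i ^+ 2 - d%:R * G i + d%:R ^+ 2 / 4).
  by apply: eq_bigr => i _; field.
rewrite big_split sumrB /= -mulr_sumr fejer_sum sumr_const card_ord -/a0.
rewrite -[_ *+ N]mulr_natr -addnn natrD; move: (d%:R) => r; lra.
Qed.

Lemma fejer_energy_gt0 : 0 < a0.
Proof.
apply: lt_le_trans fejer_energy_ge; rewrite divr_gt0// exprn_gt0// ltr0n.
by [].
Qed.

Lemma normc_geom_poly_le x : normc (map_poly (real_complex R) geom_poly).[ee x] <= d%:R.
Proof.
have -> : (map_poly (real_complex R) geom_poly).[ee x] = \sum_(k < d) ee x ^+ k.
  rewrite (@horner_coef_wide _ d); last by rewrite size_map_poly size_geom_poly.
  by apply: eq_bigr => k _; rewrite coef_map /= coef_geom_poly ltn_ord rmorph1 mul1r.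
apply: (le_trans (normc_sum _ _ _)).
under eq_bigr do rewrite normcX normc_ee expr1n.
by rewrite sumr_const card_ord.
Qed.

Lemma normc_geom_poly_mul x :
  normc (ee x - 1) * normc (map_poly (real_complex R) geom_poly).[ee x] <= 2.
Proof.
rewrite -Normc.normcM.
have -> : (ee x - 1) * (map_poly (real_complex R) geom_poly).[ee x] = ee x ^+ d - 1.
  have := congr1 (fun p => (map_poly (real_complex R) p).[ee x]) geom_poly_mul.
  rewrite /= rmorphM !rmorphB /= map_polyXn map_polyX rmorph1.
  by rewrite hornerM !hornerD !hornerN hornerXn hornerX !hornerC.
apply: (le_trans (le_normcD _ _)); rewrite normcN Normc.normc1 normcX normc_ee expr1n; lra.
Qed.

(** The part with positive frequencies of the Jackson kernel [|geom_poly|^4],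
    see [jackson_poly_Re]. *)
Definition jackson_poly : {poly R[i]} :=
  \sum_(i < N) \sum_(j < N | (i < j)%N) (G i * G j)%:C *: 'X^(j - i).

Lemma jackson_poly_ee x : jackson_poly.[ee x] =
  \sum_(i < N) \sum_(j < N | (i < j)%N) (G i * G j)%:C * ee x ^+ (j - i).
Proof.
rewrite horner_sum; apply: eq_bigr => i _; rewrite horner_sum.
by apply: eq_bigr => j _; rewrite hornerZ hornerXn.
Qed.

Lemma size_jackson_poly : (size jackson_poly <= N)%N.
Proof.
apply: (leq_trans (size_sum _ _ _)); apply/bigmax_leqP => i _.
apply: (leq_trans (size_sum _ _ _)); apply/bigmax_leqP => j ij.
rewrite (leq_trans (size_scale_leq _ _))// size_polyXn.
by rewrite (leq_ltn_trans (leq_subr _ _)).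
Qed.

Lemma jackson_poly_coef0 : jackson_poly`_0 = 0.
Proof.
rewrite coef_sum big1// => i _; rewrite coef_sum big1// => j ij.
by rewrite coefZ coefXn eq_sym subn_eq0 leqNgt ij /= mulr0.
Qed.

Lemma jackson_poly_Re x :
  normc (map_poly (real_complex R) geom_poly).[ee x] ^+ 4 =
  a0 + 2 * complex.Re jackson_poly.[ee x].
Proof.
pose c (i j : nat) : R := cos (2 * pi * ((i%:R - j%:R) * x)).
have cC i j : c i j = c j i.
  by rewrite /c -cosN; congr cos; ring.
have ReC (r : R) (z : R[i]) : complex.Re (r%:C * z) = r * complex.Re z.
  by case: z => a b /=; rewrite mul0r subr0.
have Re_sum (I : Type) (r : seq I) (P : pred I) (F : I -> R[i]) :
    complex.Re (\sum_(i <- r | P i) F i) = \sum_(i <- r | P i) complex.Re (F i).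
  exact: (raddf_sum (@complex.Re R : Rcomplex R -> R)).
have KE : complex.Re jackson_poly.[ee x] =
    \sum_(i < N) \sum_(j < N | (i < j)%N) G i * G j * c j i.
  rewrite jackson_poly_ee Re_sum; apply: eq_bigr => i _; rewrite Re_sum.
  apply: eq_bigr => j ij; rewrite ReC -eeX; congr (_ * _).
  by rewrite /c natrB ?(ltnW ij).
have -> : normc (map_poly (real_complex R) geom_poly).[ee x] ^+ 4 =
    \sum_(i < N) \sum_(j < N) G i * G j * c i j.
  rewrite (_ : 4 = (2 * 2)%N)%N// exprM -normcX -horner_exp -rmorphXn /=.
  rewrite (@horner_coef_wide _ N); last first.
    by rewrite size_map_poly (leq_trans size_sqr_geom_poly)// leq_pred.
  rewrite sqr_normc_sum; apply: eq_bigr => i _; apply: eq_bigr => j _.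
  cbv beta; rewrite !coef_map /= -/(G i) -/(G j).
  have -> : conjc ((G j)%:C * ee x ^+ j) = (G j)%:C * ee (- x) ^+ j.
    by rewrite -ee_conjX (rmorphM (@conjc R)) /= oppr0.
  rewrite mulrACA -rmorphM ReC; congr (_ * _).
  by rewrite -!eeX -eeD /c /ee /=; congr (cos (2 * pi * _)); ring.
rewrite KE.
have split (i : 'I_N) : \sum_(j < N) G i * G j * c i j =
    G i ^+ 2 + \sum_(j < N | (i < j)%N) G i * G j * c i j
    + \sum_(j < N | (j < i)%N) G i * G j * c i j.
  have E : \sum_(j < N | ~~ (i < j)%N) G i * G j * c i j =
      G i ^+ 2 + \sum_(j < N | (j < i)%N) G i * G j * c i j.
    rewrite (bigD1 i)/=; last by rewrite ltnn.
    congr (_ + _); first by rewrite /c subrr mul0r mulr0 cos0 mulr1 expr2.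
    apply: eq_bigl => j; rewrite -leqNgt.
    by rewrite -val_eqE /= ltn_neqAle andbC.
  by rewrite (bigID (fun j : 'I_N => (i < j)%N)) /= E addrA [_ + G i ^+ 2]addrC.
under eq_bigr do rewrite split.
rewrite !big_split /= -/a0 mulr2n mulrDl !mul1r addrA.
congr (_ + _ + _).
  by apply: eq_bigr => i _; apply: eq_bigr => j _; rewrite cC.
rewrite (exchange_big_dep xpredT) //=; apply: eq_bigr => i _; apply: eq_bigr => j _.
by rewrite (mulrC (G j)).
Qed.

(** Summation by parts. *)
Lemma abel_sum (u : nat -> R) (z : R[i]) n :
  (z - 1) * \sum_(k < n) (u k)%:C * z ^+ k =
  (u n)%:C * z ^+ n - (u 0%N)%:C - \sum_(k < n) (u k.+1 - u k)%:C * z ^+ k.+1.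
Proof.
elim: n => [|n IH]; first by rewrite !big_ord0 mulr0 expr0 mulr1 !subrr.
rewrite !big_ord_recr /= mulrDr IH rmorphB /= !exprS; ring.
Qed.

Lemma normc_abel_sum (u : nat -> R) x n : u n = 0 ->
  normc (ee x - 1) * normc (\sum_(k < n) (u k)%:C * ee x ^+ k) <=
  `|u 0%N| + \sum_(k < n) `|u k.+1 - u k|.
Proof.
move=> un; rewrite -Normc.normcM abel_sum un mul0r sub0r.
apply: (le_trans (le_normcD _ _)); rewrite !normcN normc_real lerD2l.
apply: (le_trans (normc_sum _ _ _)); apply: ler_sum => k _.
by rewrite Normc.normcM normc_real normcX normc_ee expr1n mulr1.
Qed.

Lemma fejer_out_N i : (N <= i)%N -> G i = 0.
Proof. by move=> Ni; rewrite fejer_out// (leq_trans (leq_pred _)). Qed.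

(** Summation by parts in each row, using that consecutive Fejer weights differ
    by at most [1]. *)
Lemma normc_jackson_poly_mul x :
  normc (ee x - 1) * normc jackson_poly.[ee x] <= 4 * d%:R ^+ 3.
Proof.
have row (i : 'I_N) : \sum_(j < N | (i < j)%N) (G i * G j)%:C * ee x ^+ (j - i) =
    (G i)%:C * (ee x * \sum_(k < N) (G (i.+1 + k)%N)%:C * ee x ^+ k).
  rewrite mulrA mulr_sumr.
  transitivity (\sum_(i.+1 <= j < N) (G i * G j)%:C * ee x ^+ (j - i)).
    by rewrite big_geq_mkord.
  rewrite -{1}[i.+1]add0n big_addn -(big_mkord xpredT
    (fun k => (G i)%:C * ee x * ((G (i.+1 + k)%N)%:C * ee x ^+ k))).
  rewrite (@big_cat_nat _ _ _ (N - i.+1)%N 0 N)//=; last exact: leq_subr.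
  rewrite [X in _ = _ + X]big_nat_cond [X in _ = _ + X]big1 ?addr0; last first.
    move=> k /andP[/andP[Nk _] _].
    have -> : G (i.+1 + k)%N = 0 by apply: fejer_out_N; rewrite -leq_subLR.
    by rewrite mul0r mulr0.
  apply: eq_big_nat => k _; rewrite addnC rmorphM /=.
  by rewrite addSn subSn ?leq_addr// addKn exprS; ring.
have rowle (i : 'I_N) : normc (ee x - 1) *
    normc (\sum_(j < N | (i < j)%N) (G i * G j)%:C * ee x ^+ (j - i)) <=
    G i * (4 * d%:R).
  rewrite row !Normc.normcM normc_real ger0_norm ?fejer_ge0// normc_ee mul1r mulrCA.
  rewrite ler_wpM2l ?fejer_ge0//.
  apply: (le_trans (@normc_abel_sum (fun k => G (i.+1 + k)%N) x N _)).
    by rewrite fejer_out_N// leq_addl.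
  have h1 : `|G (i.+1 + 0)%N| <= 2 * d%:R.
    rewrite addn0 ger0_norm ?fejer_ge0//.
    have [iN|iN] := leqP N i.+1; first by rewrite fejer_out_N// mulr_ge0.
    by rewrite (le_trans (fejer_le _))// -natrM ler_nat mul2n.
  have h2 : \sum_(k < N) `|G (i.+1 + k.+1)%N - G (i.+1 + k)%N| <= 2 * d%:R.
    apply: (@le_trans _ _ (\sum_(k < N) 1)).
      by apply: ler_sum => k _; rewrite addnS fejer_step.
    by rewrite sumr_const card_ord -natrM mul2n.
  lra.
rewrite jackson_poly_ee.
have step : normc (ee x - 1) * normc (\sum_(i < N) \sum_(j < N | (i < j)%N)
     (G i * G j)%:C * ee x ^+ (j - i)) <= \sum_(i < N) G i * (4 * d%:R).
  apply: (le_trans (ler_wpM2l (normc_ge0 _) (normc_sum _ _ _))).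
  rewrite mulr_sumr; apply: ler_sum => i _; exact: rowle.
apply: (le_trans step); rewrite -mulr_suml fejer_sum.
by rewrite le_eqVlt; apply/orP; left; apply/eqP; ring.
Qed.

Lemma normc_jackson_poly_le x : normc jackson_poly.[ee x] <= d%:R ^+ 4.
Proof.
rewrite jackson_poly_ee; apply: (le_trans (normc_sum _ _ _)).
have -> : d%:R ^+ 4 = \sum_(i < N) \sum_(j < N) G i * G j.
  under eq_bigr do rewrite -mulr_sumr fejer_sum.
  by rewrite -mulr_suml fejer_sum -exprD.
apply: ler_sum => i _; apply: (le_trans (normc_sum _ _ _)).
rewrite [leRHS](bigID (fun j : 'I_N => (i < j)%N))/=.
rewrite -[leLHS]addr0; apply: lerD.
  apply: ler_sum => j _; rewrite Normc.normcM normc_real normcX normc_ee expr1n mulr1.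
  by rewrite ger0_norm ?mulr_ge0 ?fejer_ge0.
by apply: sumr_ge0 => j _; rewrite mulr_ge0 ?fejer_ge0.
Qed.

(** The factor is the Taylor polynomial of degree [2] of the exponential at a
    small multiple [z] of [jackson_poly]: [2 * Re z] is the Jackson kernel,
    normalized, minus its mean [1 / (2 d)]. *)
Lemma jackson_factor : exists q : {poly R[i]},
  [/\ (size q <= (4 * d).+1)%N, q`_0 = 1 &
    forall x, 0 < `|x| <= 2^-1 -> normc q.[ee x] ^+ 2 <=
      expR (2056 * Num.min 1 (d%:R * `|x|)^-1 ^+ 3 - (2 * d%:R)^-1)].
Proof.
have dr : 0 < d%:R :> R by rewrite ltr0n.
have a0p := fejer_energy_gt0; have a0d := fejer_energy_ge.
(* [2 * Re z = c * |geom_poly|^4 - c * a0]; this [c] makes the mean [c * a0] of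
   the normalized kernel equal to [1 / (2 d)] and keeps [|z| <= 1]. *)
pose c : R := (2 * d%:R * a0)^-1.
have c0 : 0 < c by rewrite invr_gt0 !mulr_gt0.
have cd : c * d%:R ^+ 4 <= 1.
  rewrite /c mulrC ler_pdivrMr ?mulr_gt0// mul1r (exprS _ 3); nra.
pose wp : {poly R[i]} := c%:C *: jackson_poly.
pose q : {poly R[i]} := 1 + wp + 2^-1%:C *: wp ^+ 2.
have swp : (size wp <= N)%N by rewrite (leq_trans (size_scale_leq _ _))// size_jackson_poly.
exists q; split.
- rewrite (leq_trans (size_polyD _ _))// geq_max; apply/andP; split.
    rewrite (leq_trans (size_polyD _ _))// geq_max size_poly1 /= (leq_trans swp)//.
    by rewrite -muln2; lia.
  rewrite (leq_trans (size_scale_leq _ _))// (leq_trans (size_polyMleq _ _))//.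
  by move: swp; rewrite -muln2; move: (size _) => k; lia.
- by rewrite /q /wp !coefD !coefZ coef1 expr2 coef0M !coefZ jackson_poly_coef0 /= !mulr0 !addr0.
move=> x /andP[x0 x2].
have -> : q.[ee x] = 1 + wp.[ee x] + 2^-1%:C * wp.[ee x] ^+ 2.
  by rewrite /q !hornerE.
set z := wp.[ee x].
have zE : z = c%:C * jackson_poly.[ee x] by rewrite /z /wp hornerZ.
have zn : normc z = c * normc jackson_poly.[ee x].
  by rewrite zE Normc.normcM normc_real ger0_norm// ltW.
have z1 : normc z <= 1.
  by rewrite zn (le_trans _ cd)// ler_wpM2l ?normc_jackson_poly_le// ltW.
have e1 := normc_ee_sub1_ge x2.
have dx : 0 < d%:R * `|x| by rewrite mulr_gt0.
set mm := Num.min 1 _.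
have mm0 : 0 <= mm by rewrite le_min ler01 invr_ge0 ltW.
have mm1 : mm <= 1 by rewrite ge_min lexx.
have zm : normc z <= 4 * mm.
  rewrite /mm minr_pMr// le_min mulr1; apply/andP; split; first by lra.
  rewrite ler_pdivlMr// zn.
  have h1 : `|x| * normc jackson_poly.[ee x] <= 4 * d%:R ^+ 3.
    by apply: le_trans (normc_jackson_poly_mul x); rewrite ler_wpM2r ?normc_ge0.
  have h2 : c * d%:R * (`|x| * normc jackson_poly.[ee x]) <= c * d%:R * (4 * d%:R ^+ 3).
    by rewrite ler_wpM2l// mulr_ge0// ltW.
  apply: (@le_trans _ _ (c * d%:R * (`|x| * normc jackson_poly.[ee x]))).
    by rewrite le_eqVlt; apply/orP; left; apply/eqP; ring.
  apply: (le_trans h2).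
  have -> : c * d%:R * (4 * d%:R ^+ 3) = 4 * (c * d%:R ^+ 4) by ring.
  by lra.
set gz := normc (map_poly (real_complex R) geom_poly).[ee x].
have gz0 : 0 <= gz by exact: normc_ge0.
have gd : gz / d%:R <= 1 by rewrite ler_pdivrMr// mul1r normc_geom_poly_le.
have gm : gz / d%:R <= 2 * mm.
  rewrite /mm minr_pMr// le_min mulr1; apply/andP; split; first by lra.
  rewrite ler_pdivlMr// mulrCA mulrC mulrAC mulfVK ?gt_eqF//.
  apply: le_trans (normc_geom_poly_mul x); rewrite mulrC.
  by rewrite ler_wpM2r.
have gd0 : 0 <= gz / d%:R by rewrite divr_ge0// ltW.
have g4 : (gz / d%:R) ^+ 4 <= 8 * mm ^+ 3.
  apply: (@le_trans _ _ ((gz / d%:R) ^+ 3)).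
    by rewrite exprS ler_piMl// exprn_ge0.
  rewrite (_ : 8 * mm ^+ 3 = (2 * mm) ^+ 3); last by ring.
  by rewrite lerXn2r ?nnegrE// mulr_ge0.
have z3 : normc z ^+ 3 <= 64 * mm ^+ 3.
  rewrite (_ : 64 * mm ^+ 3 = (4 * mm) ^+ 3); last by ring.
  by rewrite lerXn2r ?nnegrE ?normc_ge0// mulr_ge0.
have rez : 2 * complex.Re z <= (gz / d%:R) ^+ 4 - (2 * d%:R)^-1.
  have -> : 2 * complex.Re z = c * (gz ^+ 4 - a0).
    rewrite /gz jackson_poly_Re zE; case: jackson_poly.[_] => a b /=.
    by rewrite mul0r subr0; ring.
  rewrite mulrBr; apply: lerB.
    rewrite expr_div_n mulrC ler_wpM2l ?exprn_ge0//.
    by rewrite -[leRHS]mul1r ler_pdivlMr ?exprn_gt0//; lra.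
  by rewrite /c le_eqVlt; apply/orP; left; apply/eqP; field; rewrite !gt_eqF.
(* [2056 = 8 + 32 * 64], from [g4] and [z3]. *)
apply: (le_trans (sqr_normc_taylor2 z1)); rewrite ler_expR.
lra.
Qed.

End jackson_factors.

(** * Products over dyadic scales *)

Section multiscale.
Variable R : realType.
Local Open Scope complex_scope.
Local Notation normc := (@Normc.normc R).
Local Notation mu := (@lebesgue_measure R).
Local Notation "\I_ ( a , b ) f" := (\int[mu]_(x in `[a, b]) f x)
  (at level 36, a, b at level 10, f at level 36).

Variable h : R -> R.
Hypothesis h_ge0 : forall a, 0 < a <= 2^-1 -> 0 <= h a.
Hypothesis h_cont : {within `]0, 2^-1], continuous h}.
Hypothesis h_decr : forall a b, 0 < a -> a < b -> b <= 2^-1 -> h b < h a.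
Hypothesis h_reg : forall a b, 0 < a -> a <= b -> b <= 2^-1 ->
  a ^+ 2 * h a <= b ^+ 2 * h b.

(** The scale [2 ^- (k + 2)], and the value of [h] at twice this scale; thus
    [h_dyadic k.+1] is the value of [h] at [dyadic_scale k]. *)
Definition dyadic_scale (k : nat) : R := 2^-1 ^+ k.+2.
Definition h_dyadic (k : nat) : R := h (2^-1 ^+ k.+1).
Local Notation s := dyadic_scale.
Local Notation H := h_dyadic.

Lemma dyadic_scale_gt0 k : 0 < s k.
Proof. by rewrite exprn_gt0. Qed.

Lemma dyadic_scaleS k : s k.+1 = s k / 2.
Proof. by rewrite /dyadic_scale exprSr. Qed.

Lemma dyadic_scale_le k : s k <= 4^-1.
Proof.
rewrite /dyadic_scale (_ : 4^-1 = 2^-1 ^+ 2 :> R); last by field.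
by apply: ler_wiXn2l => //; lra.
Qed.

Lemma h_dyadicS k : H k.+1 = h (s k). Proof. by []. Qed.

Lemma h_dyadic_le k : H k <= H k.+1.
Proof.
rewrite /h_dyadic (exprS _ k.+1); have p0 : 0 < 2^-1 ^+ k.+1 :> R by rewrite exprn_gt0.
have p1 : 2^-1 ^+ k.+1 <= 2^-1 :> R by rewrite exprS ler_piMr// exprn_ile1//; lra.
apply: (h_noninc h_decr); move: (2^-1 ^+ k.+1) p0 p1 => u p0 p1; lra.
Qed.

Lemma h_dyadic_ge0 k : 0 <= H k.
Proof.
apply: h_ge0; rewrite exprn_gt0//=.
by rewrite exprS ler_piMr// exprn_ile1//; lra.
Qed.

(** The scales above [t] telescope to [min (H K, h t)].  For a scale [s] below
    [t] the growth condition gives [h s * (s / t) ^+ 3 <= h t * (s / t)], a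
    geometric series; the last term bounds the sum of this series down to scale
    [K]. *)
Lemma growth_sum t K : 0 < t <= 2^-1 ->
  \sum_(k < K) (H k.+1 - H k) * Num.min 1 (s k / t) ^+ 3 <=
  Num.min (H K) (h t) + h t * Num.max 0 (2 - 2 * (s K / t)).
Proof.
move=> t02; have /andP[t0 t2] := t02; have ht0 := h_ge0 t02.
elim: K => [|K IH].
  rewrite big_ord0 addr_ge0 ?mulr_ge0 ?le_max ?lexx//.
  by rewrite le_min ht0 h_dyadic_ge0.
rewrite big_ord_recr /=.
have sK := dyadic_scale_gt0 K; have HK := h_dyadic_le K.
have r0 : 0 < s K / t by rewrite divr_gt0.
have [ts|st] := leP t (s K).
  have r1 : 1 <= s K / t by rewrite ler_pdivlMr// mul1r.
  rewrite (min_l r1) expr1n mulr1.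
  have Hh : H K.+1 <= h t by rewrite h_dyadicS (h_noninc h_decr)//; have := dyadic_scale_le K; lra.
  rewrite (min_l Hh).
  move: IH; rewrite (min_l (le_trans HK Hh)) max_l; last by lra.
  have : 0 <= h t * Num.max 0 (2 - 2 * (s K.+1 / t)) by rewrite mulr_ge0// le_max lexx.
  lra.
have r1 : s K / t < 1 by rewrite ltr_pdivrMr// mul1r.
rewrite (min_r (ltW r1)).
have term : (H K.+1 - H K) * (s K / t) ^+ 3 <= h t * (s K / t).
  apply: (@le_trans _ _ (H K.+1 * (s K / t) ^+ 3)).
    by rewrite ler_wpM2r ?exprn_ge0 ?(ltW r0)// gerBl h_dyadic_ge0.
  rewrite exprSr mulrA ler_wpM2r ?(ltW r0)//.
  rewrite expr_div_n mulrA ler_pdivrMr ?exprn_gt0// h_dyadicS mulrC [leRHS]mulrC.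
  by apply: h_reg => //; exact: ltW.
have m1 : Num.min (H K) (h t) <= Num.min (H K.+1) (h t).
  by rewrite le_min ge_min HK ge_min lexx orbT.
move: IH; rewrite dyadic_scaleS (max_r (y := 2 - 2 * (s K / t))); last by lra.
rewrite (max_r (y := 2 - 2 * (s K / 2 / t))); last first.
  by rewrite (mulrAC (s K)); lra.
rewrite (mulrAC (s K) 2^-1); nra.
Qed.

Lemma growth_sum_le t K : 0 < t <= 2^-1 ->
  \sum_(k < K) (H k.+1 - H k) * Num.min 1 (s k / t) ^+ 3 <= 3 * h t.
Proof.
move=> t02; apply: (le_trans (growth_sum K t02)).
have ht0 := h_ge0 t02; have /andP[t0 t2] := t02.
have : Num.min (H K) (h t) <= h t by rewrite ge_min lexx orbT.
have : Num.max 0 (2 - 2 * (s K / t)) <= 2.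
  rewrite ge_max; apply/andP; split; first by lra.
  by rewrite gerBl mulr_ge0// divr_ge0 ?(ltW t0)// ltW// dyadic_scale_gt0.
nra.
Qed.

Lemma abel_h_dyadic K : \sum_(k < K) (H k.+1 - H k) * s k =
  2^-1 * \sum_(k < K) H k.+1 * s k + H K * s K - H 0 / 4.
Proof.
elim: K => [|K IH].
  by rewrite !big_ord0 /dyadic_scale; field.
by rewrite !big_ord_recr /= IH dyadic_scaleS; field.
Qed.

Lemma dyadic_scale_sum K : \sum_(k < K) s k <= 2^-1.
Proof.
have -> : \sum_(k < K) s k = 2^-1 - 2 * s K.
  elim: K => [|K IH]; first by rewrite big_ord0 /dyadic_scale; field.
  by rewrite big_ord_recr /= IH dyadic_scaleS; field.
have := dyadic_scale_gt0 K; lra.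
Qed.

Lemma hcut_le d x : 0 < d <= 2^-1 -> 0 < x <= 2^-1 -> hcut h d x <= h x.
Proof. by move=> d02 x02; rewrite (hcutE h_decr d02 x02) ge_min lexx. Qed.

Lemma itv_integral_hcut_dyadic d K : 0 < d <= 2^-1 ->
  \I_(2^-1 ^+ K.+1, 2^-1) (hcut h d) <= \sum_(k < K) H k.+1 * s k.
Proof.
move=> d02; have /andP[d0 d2] := d02; have ch := continuous_hcut h_cont d0.
elim: K => [|K IH].
  by rewrite big_ord0 expr1 set_itv1 Rintegral_set1.
have p0 : 0 < 2^-1 ^+ K.+1 :> R by rewrite exprn_gt0.
have p1 : 2^-1 ^+ K.+1 <= 2^-1 :> R by rewrite exprS ler_piMr// exprn_ile1//; lra.
have sE : s K = 2^-1 * 2^-1 ^+ K.+1 by rewrite /dyadic_scale exprS.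
have b1 : s K <= 2^-1 ^+ K.+1 by rewrite sE; lra.
have bet : (s K <= 2^-1 ^+ K.+1 :> R) && (2^-1 ^+ K.+1 <= 2^-1 :> R) by rewrite b1 p1.
rewrite -/(s K) (itv_integral_split bet); last exact: continuous_integrable.
rewrite big_ord_recr /= addrC lerD//.
have -> : H K.+1 * s K = \I_(s K, 2^-1 ^+ K.+1) (fun=> H K.+1).
  by rewrite itv_integral_cst; [rewrite sE; field|rewrite sE; lra].
apply: le_itv_integral.
- exact: continuous_integrable.
- by apply: continuous_integrable => x; exact: cvg_cst.
move=> x /andP[x1 x2]; have sK := dyadic_scale_gt0 K.
have x02 : 0 < x <= 2^-1 by apply/andP; split; lra.
apply: (le_trans (hcut_le d02 x02)).
by rewrite h_dyadicS (h_noninc h_decr)//; lra.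
Qed.

(** When [d] lies between the scales [K.+1] and [K], the integral over
    [[0, dyadic_scale K]] is at most [4] times the last term of the sum, because
    the growth condition gives [h d <= 4 * h (dyadic_scale K)]. *)
Lemma itv_integral_hcut_le5 d K : 0 < d -> d <= s K -> s K.+1 <= d ->
  \I_(0, 2^-1) (hcut h d) <= 5 * \sum_(k < K.+1) H k.+1 * s k.
Proof.
move=> d0 ds sd; have sK := dyadic_scale_gt0 K; have sK4 := dyadic_scale_le K.
have d02 : 0 < d <= 2^-1 by apply/andP; split; lra.
have ch := continuous_hcut h_cont d0.
have bet : 0 <= s K <= 2^-1 by apply/andP; split; lra.
rewrite (itv_integral_split bet); last exact: continuous_integrable.
have h1 := itv_integral_hcut_dyadic K.+1 d02.
have h2 : \I_(0, s K) (hcut h d) <= h d * s K.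
  have -> : h d * s K = \I_(0, s K) (fun=> h d).
    by rewrite itv_integral_cst ?subr0// ltW.
  apply: le_itv_integral.
  - exact: continuous_integrable.
  - by apply: continuous_integrable => x; exact: cvg_cst.
  move=> x /andP[x0 x1]; rewrite /hcut (h_noninc h_decr)//.
    by rewrite le_min le_max lexx orbT; lra.
  by rewrite ge_min lexx orbT.
have hd : h d <= 4 * H K.+1.
  have := @h_reg d (s K) d0 ds _; rewrite -h_dyadicS.
  have : (s K) ^+ 2 <= 4 * d ^+ 2.
    rewrite (_ : 4 * d ^+ 2 = (2 * d) ^+ 2); last by ring.
    by rewrite lerXn2r ?nnegrE//; move: sd; rewrite dyadic_scaleS; lra.
  have d2 : 0 < d ^+ 2 by rewrite exprn_gt0.
  have HK0 := h_dyadic_ge0 K.+1.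
  move=> q1 q2; have {}q2 := q2 (le_trans sK4 _).
  have {}q2 : d ^+ 2 * h d <= s K ^+ 2 * H K.+1 by apply: q2; lra.
  rewrite -(ler_pM2l d2); nra.
have h3 : H K.+1 * s K <= \sum_(k < K.+1) H k.+1 * s k.
  rewrite big_ord_recr /= lerDr; apply: sumr_ge0 => k _.
  by rewrite mulr_ge0 ?h_dyadic_ge0// ltW// dyadic_scale_gt0.
rewrite -/(s K) in h1.
have : h d * s K <= 4 * H K.+1 * s K by rewrite ler_wpM2r// ltW.
lra.
Qed.

Lemma exists_dyadic_scale d : 0 < d -> d <= 4^-1 ->
  exists K, d <= s K /\ s K.+1 <= d.
Proof.
move=> d0 d4.
have ex : exists k, s k.+1 <= d.
  have := archi_boundP (ltW (divr_gt0 ltr01 d0)); set k := Num.bound _ => hk.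
  exists k; have k2 : k%:R < 2 ^+ k :> R by rewrite -natrX ltr_nat ltn_expl.
  have p2 : 0 < 2 ^+ k :> R by rewrite exprn_gt0.
  have h1 : 2^-1 ^+ k <= d.
    rewrite exprVn -[leLHS]mul1r ler_pdivrMr// mulrC -ler_pdivrMr//.
    exact/ltW/(lt_trans hk).
  apply: le_trans h1; rewrite /dyadic_scale ler_wiXn2l//; first by lra.
  by rewrite -addn3 leq_addr.
case: (ex_minnP ex) => -[|K] sd minK; first by exists 0%N; rewrite /dyadic_scale; split => //; lra.
exists K.+1; split => //; rewrite leNgt; apply/negP => /ltW /minK.
by rewrite ltnn.
Qed.

Lemma size_mul_le (p q : {poly R[i]}) a b : (size p <= a.+1)%N ->
  (size q <= b.+1)%N -> (size (p * q)%R <= (a + b).+1)%N.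
Proof.
move=> pa qb; apply: (leq_trans (size_polyMleq _ _)).
by move: pa qb; move: (size p) (size q) => k l; lia.
Qed.

Lemma size_exp_le (p : {poly R[i]}) a m : (size p <= a.+1)%N ->
  (size (p ^+ m)%R <= (a * m).+1)%N.
Proof.
move=> pa; elim: m => [|m IH]; first by rewrite expr0 size_poly1.
by rewrite exprS mulnS; exact: size_mul_le.
Qed.

Lemma size_prod_le (I : Type) (r : seq I) (F : I -> {poly R[i]}) (a : I -> nat) :
  (forall i, (size (F i) <= (a i).+1)%N) ->
  (size (\prod_(i <- r) F i)%R <= (\sum_(i <- r) a i).+1)%N.
Proof.
move=> Fa; elim: r => [|i r IH]; first by rewrite !big_nil size_poly1.
by rewrite !big_cons; exact: size_mul_le.
Qed.

(** The polynomial ['X^n * q (1 / 'X)], for [q] of degree at most [n]. *)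
Definition rev_poly n (q : {poly R[i]}) : {poly R[i]} := \poly_(i < n.+1) q`_(n - i).

Lemma size_rev_poly n (q : {poly R[i]}) : q`_0 = 1 -> size (rev_poly n q) = n.+1.
Proof. by move=> q0; rewrite size_poly_eq// subnn q0 oner_neq0. Qed.

Lemma monic_rev_poly n (q : {poly R[i]}) : q`_0 = 1 -> rev_poly n q \is monic.
Proof.
by move=> q0; rewrite monicE lead_coefE size_rev_poly//= coef_poly ltnS leqnn subnn q0.
Qed.

Lemma normc_rev_poly n (q : {poly R[i]}) x : (size q <= n.+1)%N ->
  normc (rev_poly n q).[ee x] = normc q.[ee (- x)].
Proof.
move=> qn; suff -> : (rev_poly n q).[ee x] = ee x ^+ n * q.[ee (- x)].
  by rewrite Normc.normcM normcX normc_ee expr1n mul1r.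
rewrite horner_poly (horner_coef_wide _ qn) mulr_sumr.
rewrite (reindex_inj rev_ord_inj) /=; apply: eq_bigr => i _.
have iN : (i <= n)%N by rewrite -ltnS.
rewrite subSS subKn// mulrCA; congr (_ * _).
have -> : ee x ^+ n = ee x ^+ (n - i) * ee x ^+ i by rewrite -exprD subnK.
by rewrite eeN exprVn mulfK// expf_neq0// ee_neq0.
Qed.

Variable w : circle R -> R.
Hypothesis w_def : forall theta : R, 0 < `|theta| <= 2^-1 ->
  w (circle_pt theta) = expR (- h `|theta|).
Variable rho : {finite_measure set (circle R) -> \bar R}.
Hypothesis rho_def : forall E : set (circle R), measurable E ->
  (rho E = \int[@circle_measure R]_(t in E) (w t)%:E)%E.

(** The test polynomial is the reversed product of the Jackson-type factors of
    the scales [dyadic_scale k >= d], with exponents [m k] proportional to the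
    increments of [h] between consecutive scales. *)
Lemma monic_err_upper_multiscale n d : 0 < d -> d <= 20^-1 ->
  n%:R * d = h d ->
  monic_err n rho <=
  expR (- (\I_(0, 2^-1) (hcut h d) / (5 * 2 ^+ 16)) + h 2^-1 / 2 ^+ 17 + 8^-1).
Proof.
move=> d0 d20 nd; have d4 : d <= 4^-1 by lra.
have [K [ds sd]] := exists_dyadic_scale d0 d4.
have [qf qfP] : exists qf : nat -> {poly R[i]}, forall k,
    [/\ (size (qf k) <= (4 * 2 ^ k.+2).+1)%N, (qf k)`_0 = 1 &
    forall x, 0 < `|x| <= 2^-1 -> normc (qf k).[ee x] ^+ 2 <=
      expR (2056 * Num.min 1 (s k / `|x|) ^+ 3 - s k / 2)].
  have H2 k : exists q : {poly R[i]}, [/\ (size q <= (4 * 2 ^ k.+2).+1)%N, q`_0 = 1 &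
    forall x, 0 < `|x| <= 2^-1 -> normc q.[ee x] ^+ 2 <=
      expR (2056 * Num.min 1 (s k / `|x|) ^+ 3 - s k / 2)].
    have [|q [q1 q2 q3]] := @jackson_factor R (2 ^ k.+2)%N; first by rewrite expn_gt0.
    have sE : s k = ((2 ^ k.+2)%N%:R)^-1 by rewrite natrX /dyadic_scale exprVn.
    exists q; split => // x /q3; rewrite sE -invfM.
    by rewrite [X in _ - X]invfM [2^-1 * _]mulrC.
  exists (fun k => sval (cid (H2 k))) => k; exact: (svalP (cid (H2 k))).
(* The constant of proportionality must satisfy [3 * 2056 * ka <= 1], for the
   weight to compensate the cubic terms, and [8 * ka <= 1], for the degree of
   the product not to exceed [n]. *)
pose ka : R := (2 ^+ 13)^-1.
pose m k := Num.truncn (ka * (H k.+1 - H k)).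
have dH k : 0 <= H k.+1 - H k by rewrite subr_ge0 h_dyadic_le.
have ka0 : 0 <= ka by rewrite invr_ge0.
have m_le k : (m k)%:R <= ka * (H k.+1 - H k).
  by have /andP[] := truncn_itv (mulr_ge0 ka0 (dH k)).
have m_ge k : ka * (H k.+1 - H k) - 1 <= (m k)%:R.
  have /andP[_] := truncn_itv (mulr_ge0 ka0 (dH k)).
  by rewrite -natr1 => /ltW; rewrite -/(m k); lra.
pose Q := \prod_(k < K.+1) qf k ^+ m k.
have HK1 : H K.+1 <= h d by rewrite h_dyadicS (h_noninc h_decr)//; have := dyadic_scale_le K; lra.
have Hmono k : (k <= K)%N -> H k.+1 <= H K.+1.
  move=> kK; rewrite -(subnKC kK); elim: (K - k)%N => [|j IH]; first by rewrite addn0.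
  by rewrite addnS (le_trans IH)// h_dyadic_le.
have sQ : (size Q <= n.+1)%N.
  apply: (@leq_trans (\sum_(k < K.+1) 4 * 2 ^ k.+2 * m k).+1).
    by apply: size_prod_le => k; apply: size_exp_le; have [] := qfP k.
  rewrite ltnS -(ler_nat R) natr_sum.
  apply: (@le_trans _ _ (\sum_(k < K.+1) 16 * ka * h d * 2 ^+ k)).
    apply: ler_sum => k _; rewrite natrM natrM natrX.
    have -> : 2 ^+ k.+2 = 4 * 2 ^+ k :> R by rewrite !exprS; ring.
    have p2 : 0 <= 2 ^+ k :> R by rewrite exprn_ge0.
    have h1 : (m k)%:R <= ka * h d.
      apply: (le_trans (m_le k)); rewrite ler_wpM2l//.
      have := Hmono k (ltn_ord k); have := h_dyadic_ge0 k; lra.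
    have := ler_wpM2l p2 h1; lra.
  rewrite -mulr_sumr.
  have g2 : \sum_(k < K.+1) 2 ^+ k = 2 ^+ K.+1 - 1 :> R.
    by rewrite subrX1; rewrite (_ : 2 - 1 = 1 :> R) ?mul1r//; ring.
  rewrite g2.
  have sK : 2 ^+ K.+1 * d <= 2^-1.
    apply: (@le_trans _ _ (2 ^+ K.+1 * s K)); first by rewrite ler_wpM2l// exprn_ge0.
    rewrite /dyadic_scale exprVn ler_pdivrMr ?exprn_gt0// [2 ^+ K.+2]exprS; lra.
  have n0 : 0 <= n%:R :> R by [].
  rewrite -nd.
  have -> : 16 * ka * (n%:R * d) * (2 ^+ K.+1 - 1) =
    n%:R * (16 * ka * (2 ^+ K.+1 * d - d)) by ring.
  by rewrite ler_piMr// /ka; lra.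
have Q0 : Q`_0 = 1.
  rewrite -horner_coef0 horner_prod big1// => k _.
  by rewrite horner_exp horner_coef0; have [_ -> _] := qfP k; rewrite expr1n.
pose S := \sum_(k < K.+1) (m k)%:R * s k.
have -> : expR (- (\I_(0, 2^-1) (hcut h d) / (5 * 2 ^+ 16)) + h 2^-1 / 2 ^+ 17 + 8^-1) =
    Num.sqrt (expR (- (\I_(0, 2^-1) (hcut h d) / (5 * 2 ^+ 15)) + h 2^-1 / 2 ^+ 16 + 4^-1)).
  rewrite [in RHS](_ : _ + 4^-1 = 2%:R *
    (- (\I_(0, 2^-1) (hcut h d) / (5 * 2 ^+ 16)) + h 2^-1 / 2 ^+ 17 + 8^-1)); last by field.
  by rewrite expRM_natl sqrtr_sqr ger0_norm// expR_ge0.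
apply: (monic_err_le_pointwise h_ge0 h_cont w_def rho_def (p := rev_poly n Q)).
- exact: monic_rev_poly.
- exact: size_rev_poly.
- exact: expR_ge0.
move=> x /[dup] x02 /andP[x0 x2].
rewrite normc_rev_poly//.
have x02' : 0 < `|- x| <= 2^-1 by rewrite normrN.
have QE : normc Q.[ee (- x)] ^+ 2 <= expR (\sum_(k < K.+1)
    (m k)%:R * (2056 * Num.min 1 (s k / `|x|) ^+ 3 - s k / 2)).
  rewrite expR_sum horner_prod normc_prod -prodrXl; apply: ler_prod => k _.
  rewrite sqr_ge0/= horner_exp normcX exprAC expRM_natl.
  rewrite lerXn2r ?nnegrE ?sqr_ge0 ?expR_ge0//.
  by have [_ _ /(_ _ x02')] := qfP k; rewrite normrN.
apply: (le_trans (ler_wpM2r (expR_ge0 _) QE)); rewrite -expRD ler_expR.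
have -> : \sum_(k < K.+1) (m k)%:R * (2056 * Num.min 1 (s k / `|x|) ^+ 3 - s k / 2)
    = 2056 * (\sum_(k < K.+1) (m k)%:R * Num.min 1 (s k / `|x|) ^+ 3) - S / 2.
  rewrite /S mulr_sumr mulr_suml -sumrB; apply: eq_bigr => k _; ring.
have g1 : \sum_(k < K.+1) (m k)%:R * Num.min 1 (s k / `|x|) ^+ 3 <= ka * (3 * h `|x|).
  apply: (@le_trans _ _ (ka * \sum_(k < K.+1) (H k.+1 - H k) * Num.min 1 (s k / `|x|) ^+ 3)).
    rewrite mulr_sumr; apply: ler_sum => k _; rewrite mulrA ler_wpM2r//.
    by rewrite exprn_ge0// le_min ler01 divr_ge0// ltW// dyadic_scale_gt0.
  by rewrite ler_wpM2l// growth_sum_le.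
(* Rounding the exponents down costs at most the sum of the scales. *)
have g2 : ka * (\sum_(k < K.+1) (H k.+1 - H k) * s k) - \sum_(k < K.+1) s k <= S.
  rewrite mulr_sumr -sumrB; apply: ler_sum => k _.
  by have := ler_wpM2r (ltW (dyadic_scale_gt0 k)) (m_ge k); lra.
have g3 := dyadic_scale_sum K.+1.
have g4 := abel_h_dyadic K.+1.
have g5 := itv_integral_hcut_le5 d0 ds sd.
have g6 : 0 <= H K.+1 * s K.+1 by rewrite mulr_ge0 ?h_dyadic_ge0// ltW// dyadic_scale_gt0.
have H0E : H 0 = h 2^-1 by rewrite /h_dyadic expr1.
have hx0 := h_ge0 x02.
rewrite H0E in g4; rewrite /ka in g1 g2.
clear -g1 g2 g3 g4 g5 g6 hx0.
move: (\sum_(k < K.+1) _ * Num.min _ _ ^+ 3) (\sum_(k < K.+1) (H k.+1 - H k) * s k)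
  (\sum_(k < K.+1) s k) (\sum_(k < K.+1) H k.+1 * s k) (\I_(_, _) _) g1 g2 g3 g4 g5
  => a b c e I g1 g2 g3 g4 g5.
lra.
Qed.

End multiscale.

(** * Levels and the integral of the truncated profile *)

Section truncated_integral.
Variable R : realType.
Local Notation mu := (@lebesgue_measure R).
Local Notation "\I_ ( a , b ) f" := (\int[mu]_(x in `[a, b]) f x)
  (at level 36, a, b at level 10, f at level 36).

Variable h : R -> R.
Hypothesis h_ge0 : forall a, 0 < a <= 2^-1 -> 0 <= h a.
Hypothesis h_cont : {within `]0, 2^-1], continuous h}.
Hypothesis h_decr : forall a b, 0 < a -> a < b -> b <= 2^-1 -> h b < h a.
Hypothesis h_int :
  (\int[mu]_(a in `]0%R, (2^-1)%R]) (h a)%:E = +oo)%E.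

Local Notation S d := (\I_(0, 2^-1) (hcut h d)).

Lemma h_inj a b : 0 < a <= 2^-1 -> 0 < b <= 2^-1 -> h a = h b -> a = b.
Proof.
move=> /andP[a0 a2] /andP[b0 b2] hab.
case: (ltgtP a b) => // [ab|ba].
- by have := h_decr a0 ab b2; rewrite hab ltxx.
- by have := h_decr b0 ba a2; rewrite hab ltxx.
Qed.

Lemma h_lt_cancel a b : 0 < a <= 2^-1 -> 0 < b <= 2^-1 -> h a <= h b -> b <= a.
Proof.
move=> /andP[a0 a2] /andP[b0 b2] hab; rewrite leNgt; apply/negP => ab.
by have := h_decr a0 ab b2; rewrite ltNge hab.
Qed.

Lemma hcut_mono d d' x : 0 < d' -> d' <= d -> d <= 2^-1 -> hcut h d x <= hcut h d' x.
Proof.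
move=> d0 dd d2; rewrite /hcut (h_noninc h_decr)//.
- by rewrite lt_min lt_max d0 orbT/=; lra.
- have m1 : Num.max `|x| d' <= Num.max `|x| d by rewrite ge_max !le_max lexx/= dd orbT.
  by rewrite le_min !ge_min m1 lexx orbT.
- by rewrite ge_min lexx orbT.
Qed.

Lemma hcut_integral_mono d d' : 0 < d' -> d' <= d -> d <= 2^-1 -> S d <= S d'.
Proof.
move=> d0 dd d2; apply: le_itv_integral.
- exact/continuous_integrable/continuous_hcut/(lt_le_trans d0).
- exact/continuous_integrable/continuous_hcut.
- by move=> x _; exact: hcut_mono.
Qed.

Lemma hcut_integral_le d : 0 < d <= 2^-1 -> S d <= h d / 2.
Proof.
move=> /andP[d0 d2]; have -> : h d / 2 = \I_(0, 2^-1) (fun=> h d).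
  by rewrite itv_integral_cst ?subr0//; lra.
apply: le_itv_integral.
- exact/continuous_integrable/continuous_hcut.
- by apply: continuous_integrable => x; exact: cvg_cst.
move=> x _; rewrite /hcut (h_noninc h_decr)//.
  by rewrite le_min le_max lexx orbT.
by rewrite ge_min lexx orbT.
Qed.

(** Monotone convergence, as [h] is not integrable. *)
Lemma hcut_integral_unbounded M : exists2 d, 0 < d <= 2^-1 & M <= S d.
Proof.
pose dk (k : nat) : R := 2^-1 ^+ k.+1.
have dk0 k : 0 < dk k by rewrite exprn_gt0.
have dk2 k : dk k <= 2^-1 by rewrite /dk exprS ler_piMr// exprn_ile1//; lra.
pose f (k : nat) (x : R) := (hcut h (dk k) x)%:E.
have fi k : (\int[mu]_(x in `]0%R, (2^-1)%R]) f k x = (S (dk k))%:E)%E.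
  have ik : mu.-integrable `[0, 2^-1] (EFin \o hcut h (dk k)).
    exact/continuous_integrable/continuous_hcut.
  rewrite integral_itv_obnd_cbnd; last first.
    apply/measurable_EFinP/measurable_funTS.
    by apply: continuous_measurable_fun; exact: continuous_hcut.
  by rewrite /Rintegral fineK//; exact: integrable_fin_num.
have cv : (\int[mu]_(x in `]0%R, (2^-1)%R]) f k x @[k --> \oo] -->
    \int[mu]_(x in `]0%R, (2^-1)%R]) (limn (f ^~ x)))%E.
  apply: cvg_monotone_convergence => //.
  - move=> k; apply/measurable_EFinP/measurable_funTS.
    by apply: continuous_measurable_fun; exact: continuous_hcut.
  - by move=> k x _; rewrite lee_fin hcut_ge0.
  - move=> x _ i j ij; rewrite lee_fin; apply: hcut_mono => //.
    by rewrite /dk; apply: ler_wiXn2l; [lra|lra|].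
have lim x : 0 < x <= 2^-1 -> limn (f ^~ x) = (h x)%:E.
  move=> /andP[x0 x2]; apply: cvg_lim => //.
  have [k hk] : exists k, dk k <= x.
    have [k hk] : exists k : nat, x^-1 < k%:R.
      exists (Num.bound x^-1); apply: archi_boundP; rewrite invr_ge0; exact: ltW.
    exists k; rewrite /dk (le_trans (_ : _ <= 2^-1 ^+ k))//.
      by rewrite ler_wiXn2l//; lra.
    rewrite exprVn -[leRHS]invrK lef_pV2 ?posrE ?exprn_gt0 ?invr_gt0//.
    by rewrite (le_trans (ltW hk))// -natrX ler_nat ltnW// ltn_expl.
  apply: (@cvg_trans _ (cst (h x)%:E @ \oo)); last exact: cvg_cst.
  apply: near_eq_cvg; exists k => // j /= kj.
  rewrite /f hcut_out ?gtr0_norm//.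
  apply: le_trans hk; rewrite /dk; apply: ler_wiXn2l; [lra|lra|].
  by rewrite ltnS.
have E : (\int[mu]_(x in `]0%R, (2^-1)%R]) (limn (f ^~ x)) = +oo)%E.
  by rewrite -h_int; apply: eq_integral => x; rewrite inE/= in_itv/= => xI; rewrite lim.
rewrite E in cv; move/cvgeyPge : cv => /(_ M) [k _ /(_ k (leqnn k))] /=.
rewrite fi lee_fin => Mk; exists (dk k) => //.
by rewrite dk0 dk2.
Qed.

Lemma h_unbounded M : exists2 a, 0 < a <= 2^-1 & M < h a.
Proof.
have [d d02 Md] := hcut_integral_unbounded (`|M| + 1).
exists d => //; have := hcut_integral_le d02; have := ler_norm M; have := normr_ge0 M.
lra.
Qed.

Lemma within_sub a : 0 < a -> {within `[a, 2^-1], continuous h}.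
Proof.
move=> a0; apply: continuous_subspaceW h_cont.
by apply: subset_itv; rewrite bnd_simp.
Qed.

Lemma h_surj A : h 2^-1 <= A -> exists2 d, 0 < d <= 2^-1 & h d = A.
Proof.
move=> hA; have [a /andP[a0 a2] Aa] := h_unbounded A.
have [|d] := @IVT R h a 2^-1 A a2 (within_sub a0).
  by rewrite ge_min hA orbT le_max (ltW Aa).
rewrite in_itv/= => /andP[ad d2] hd; exists d => //.
by rewrite (lt_le_trans a0).
Qed.

Lemma hinvK d : 0 < d <= 2^-1 -> hinv h (h d) = d.
Proof.
move=> d02; rewrite /hinv pinvKV// ?inE/= ?in_itv//.
by move=> x y; rewrite !inE/= !in_itv/=; exact: h_inj.
Qed.

(** The equation [n * d = h d] is solvable for large [n], and the only level is
    [h d]. *)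
Lemma level_exists n : 2 * h 2^-1 <= n%:R ->
  exists d, [/\ 0 < d <= 2^-1, n%:R * d = h d & unique (is_level h n) (h d)].
Proof.
move=> hn; have n0 : 0 <= n%:R :> R by [].
have [a /andP[a0 a2] na] := h_unbounded (n%:R / 2).
pose g x := h x - n%:R * x.
have cg : {within `[a, 2^-1], continuous g}.
  move=> x; apply: (@cvgB _ R^o); first exact: within_sub.
  apply: cvgM; first exact: cvg_cst.
  exact: (continuous_subspaceT (fun y => @cvg_id _ (nbhs y))).
have [|d] := @IVT R g a 2^-1 0 a2 cg.
  have g1 : g 2^-1 <= 0 by rewrite /g; lra.
  have g2 : 0 <= g a by rewrite /g; nra.
  by rewrite ge_min g1 orbT le_max g2.
rewrite in_itv/= => /andP[ad d2] gd.
have d02 : 0 < d <= 2^-1 by rewrite (lt_le_trans a0).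
have nd : n%:R * d = h d by move: gd; rewrite /g; lra.
have /andP[d0 _] := d02.
exists d; split => //; split.
  by split; [exact: (h_noninc h_decr)|rewrite hinvK].
move=> A' [hA' nA']; have [d' d02' hd'] := h_surj hA'.
move: nA'; rewrite -hd' hinvK// => nd'.
congr h; have /andP[d0' _] := d02'.
case: (ltgtP d d') => // dd.
- have := h_decr d0 dd (andP d02').2; rewrite -nd -nd'; have := ler_wpM2l n0 (ltW dd); lra.
- have := h_decr d0' dd d2; rewrite -nd -nd'; have := ler_wpM2l n0 (ltW dd); lra.
Qed.

(** A criterion for the solution of [n * d = h d] to be at most [e]. *)
Lemma level_small n d e : 0 < d <= 2^-1 -> 0 < e <= 2^-1 ->
  n%:R * d = h d -> h e < n%:R * e -> d <= e.
Proof.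
move=> /andP[d0 d2] /andP[e0 e2] nd he; rewrite leNgt; apply/negP => ed.
have := h_decr e0 ed d2; rewrite -nd.
have n0 : 0 <= n%:R :> R by [].
have := ler_wpM2l n0 (ltW ed); lra.
Qed.

(** The condition on the upper limit, as a bound [l < 2] valid from some level
    [a0] on. *)
Lemma limsup_ratio :
  (limf_esup (fun a : R => (hinv h a / hinv h (2 * a))%:E) (pinfty_nbhs R) < 2%:E)%E ->
  exists l a0 : R, [/\ 1 <= l, l < 2, 0 < a0, h 2^-1 <= a0 &
    forall a, a0 <= a -> hinv h a / hinv h (2 * a) <= l].
Proof.
rewrite limf_esupE => /ereal_inf_lt[_ [V [M [_ MV]] <-] sup2].
set f := (X in ereal_sup (X @` V)) in sup2.
have fle a : M < a -> (f a <= ereal_sup (f @` V))%E.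
  by move=> Ma; apply: ereal_sup_ubound; exists a => //; exact: MV.
have sfin : ereal_sup (f @` V) \is a fin_num.
  have := fle (M + 1) _; rewrite ltrDl ltr01 => /(_ isT) h1.
  rewrite fin_numE; apply/andP; split.
    by rewrite gt_eqF// (lt_le_trans _ h1)// ltNyr.
  by rewrite lt_eqF// (lt_trans sup2)// ltry.
pose l := fine (ereal_sup (f @` V)).
have lE : ereal_sup (f @` V) = l%:E by rewrite fineK.
have l2 : l < 2 by rewrite -lte_fin -lE.
exists (Num.max 1 l), (Num.max (Num.max (M + 1) 1) (h 2^-1)); split.
- by rewrite le_max lexx.
- by rewrite gt_max l2 andbT; lra.
- by rewrite !lt_max ltr01 orbT.
- by rewrite le_max lexx orbT.
move=> a; rewrite !ge_max => /andP[/andP[Ma _] _].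
rewrite le_max; apply/orP; right; rewrite -lee_fin -lE; apply: fle; lra.
Qed.

Section doubling.
Variables l a0 : R.
Hypotheses (l1 : 1 <= l) (l2 : l < 2) (a0_gt0 : 0 < a0) (ha0 : h 2^-1 <= a0).
Hypothesis ratio : forall a, a0 <= a -> hinv h a / hinv h (2 * a) <= l.

(** Halving the level loses at most the area [h e * e] of the upper half. *)
Lemma hcut_integral_double d e : 0 < d -> d <= e -> e <= 2^-1 -> h d = 2 * h e ->
  S d <= S e + h e * e.
Proof.
move=> d0 de e2 hde; have e0 := lt_le_trans d0 de.
have cd := continuous_hcut h_cont d0; have ce := continuous_hcut h_cont e0.
have bet : 0 <= e <= 2^-1 by rewrite (ltW e0).
rewrite (itv_integral_split bet); last exact: continuous_integrable.
rewrite [X in _ <= X + _](itv_integral_split bet); last exact: continuous_integrable.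
have tail : \I_(e, 2^-1) (hcut h d) = \I_(e, 2^-1) (hcut h e).
  apply: eq_itv_integral => x /andP[ex x2]; have x0 := lt_le_trans e0 ex.
  by rewrite !hcut_out ?gtr0_norm// (le_trans de).
have -> : \I_(0, e) (hcut h e) = h e * e.
  rewrite (@eq_itv_integral _ _ _ _ (fun=> h e)).
    by rewrite itv_integral_cst ?subr0// ltW.
  by move=> x /andP[x0 xe]; rewrite hcut_in// ger0_norm.
have : \I_(0, e) (hcut h d) <= h d * e.
  have -> : h d * e = \I_(0, e) (fun=> h d).
    by rewrite itv_integral_cst ?subr0// ltW.
  apply: le_itv_integral.
  - exact: continuous_integrable.
  - by apply: continuous_integrable => x; exact: cvg_cst.
  move=> x _; rewrite /hcut (h_noninc h_decr)//.
    by rewrite le_min le_max lexx orbT (le_trans de).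
  by rewrite ge_min lexx orbT.
rewrite tail hde; lra.
Qed.

(** Under the doubling condition the integral is dominated by the area
    [h d * d] of the tip.  Passing from the level [h d] to its half
    multiplies the tip area by at most [l / 2 < 1]; the constant
    [C = l / (2 - l)] solves [(C + 1) * l = 2 * C], which makes the estimate
    reproduce itself when the level is doubled. *)
Lemma hcut_integral_le_tip d : 0 < d <= 2^-1 -> a0 <= h d ->
  S d <= l / (2 - l) * (h d * d) + a0.
Proof.
move=> d02 ad.
have [l1' l2' a00 ha0'] := And4 l1 l2 a0_gt0 ha0.
have l0 : 0 <= l by exact: le_trans ler01 l1.
have C0 : 0 <= l / (2 - l) by rewrite divr_ge0// subr_ge0 ltW.
have base e : 0 < e <= 2^-1 -> h e <= 2 * a0 -> S e <= l / (2 - l) * (h e * e) + a0.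
  move=> e02 he; have /andP[e0 _] := e02.
  have := hcut_integral_le e02; have : 0 <= l / (2 - l) * (h e * e).
    exact: mulr_ge0 C0 (mulr_ge0 (h_ge0 e02) (ltW e0)).
  lra.
have [k hk] : exists k : nat, h d <= 2 ^+ k * a0.
  exists (Num.bound (h d / a0)).
  have := archi_boundP (divr_ge0 (h_ge0 d02) (ltW a0_gt0)).
  set k := Num.bound _; rewrite ltr_pdivrMr// => hk.
  apply: (le_trans (ltW hk)); rewrite ler_pM2r//.
  by rewrite -natrX ler_nat ltnW// ltn_expl.
elim: k d d02 ad hk => [|k IH] d d02 ad hk.
  by apply: base => //; move: hk; rewrite expr0; lra.
have half : h d / 2 <= 2 ^+ k * a0.
  by rewrite ler_pdivrMr// mulrC mulrA -exprS.
have {}IH e : 0 < e <= 2^-1 -> a0 <= h e -> h e = h d / 2 ->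
    S e <= l / (2 - l) * (h e * e) + a0.
  by move=> e02 ae he; apply: IH => //; rewrite he.
clear k hk half.
have [hd|hd] := leP (h d) (2 * a0); first exact: base.
have /andP[d0 d2] := d02.
have [e e02 he] : exists2 e, 0 < e <= 2^-1 & h e = h d / 2.
  by apply: h_surj; lra.
have hde : h d = 2 * h e by lra.
have de : d <= e by apply: h_lt_cancel => //; lra.
have /andP[e0 e2] := e02.
have ae : a0 <= h e by lra.
have {}IH := IH e e02 ae he.
have r := ratio ae; rewrite -hde !hinvK// ler_pdivrMr// in r.
have he0 : 0 <= h e by exact: h_ge0.
have := hcut_integral_double d0 de e2 hde.
have hee : h e * e <= h e * (l * d) by rewrite ler_wpM2l.
have Cl : (l / (2 - l) + 1) * l = 2 * (l / (2 - l)).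
  by field; rewrite gt_eqF//; lra.
have : (l / (2 - l) + 1) * (h e * e) <= (l / (2 - l) + 1) * (h e * (l * d)).
  by rewrite ler_wpM2l//; lra.
rewrite [X in _ <= X](_ : _ = (l / (2 - l) + 1) * l * (h e * d)); last by ring.
rewrite Cl hde; lra.
Qed.

End doubling.

End truncated_integral.

(** * Decay of the minimal error *)

Section decay.
Variable R : realType.
Local Notation mu := (@lebesgue_measure R).
Variable h : R -> R.
Hypothesis h_ge0 : forall a, 0 < a <= 2^-1 -> 0 <= h a.
Hypothesis h_cont : {within `]0, 2^-1], continuous h}.
Hypothesis h_decr : forall a b, 0 < a -> a < b -> b <= 2^-1 -> h b < h a.
Hypothesis h_int :
  (\int[mu]_(a in `]0%R, (2^-1)%R]) (h a)%:E = +oo)%E.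
Variable w : circle R -> R.
Hypothesis w_def : forall theta : R, 0 < `|theta| <= 2^-1 ->
  w (circle_pt theta) = expR (- h `|theta|).
Variable rho : {finite_measure set (circle R) -> \bar R}.
Hypothesis rho_def : forall E : set (circle R), measurable E ->
  (rho E = \int[@circle_measure R]_(t in E) (w t)%:E)%E.

Local Notation S d := (\int[mu]_(x in `[0, 2^-1]) (hcut h d) x).

(** The decay of the minimal error at rate [S d], once [d] is small and [S d] is
    large. *)
Definition decay_rate := exists c s0 e0 : R, [/\ 0 < c, 0 < e0 &
  forall n d, (1 < n)%N -> 0 < d -> d <= 20^-1 -> d <= e0 ->
    n%:R * d = h d -> s0 <= S d -> monic_err n rho <= expR (- (c * S d))].

Lemma decay_rate_multiscale :
  (forall a b, 0 < a -> a <= b -> b <= 2^-1 -> a ^+ 2 * h a <= b ^+ 2 * h b) ->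
  decay_rate.
Proof.
move=> h_reg; exists (5 * 2 ^+ 17)^-1, (5 * (h 2^-1 + 2 ^+ 14)), 1; split.
- by rewrite invr_gt0 mulr_gt0// exprn_gt0.
- by [].
move=> n d _ d0 d20 _ nd; set T := S d => ST.
apply: (le_trans (monic_err_upper_multiscale h_ge0 h_cont h_decr h_reg w_def rho_def d0 d20 nd)).
rewrite ler_expR -/T; lra.
Qed.

Lemma decay_rate_doubling :
  (limf_esup (fun a : R => (hinv h a / hinv h (2 * a))%:E) (pinfty_nbhs R) < 2%:E)%E ->
  decay_rate.
Proof.
move=> /limsup_ratio[l [a0 [l1 l2 a00 ha0 ratio]]].
have [e0 /andP[e00 e02] he0] := h_surj h_ge0 h_cont h_decr h_int ha0.
pose C := l / (2 - l).
have C0 : 0 < C by rewrite divr_gt0//; lra.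
exists (2 ^+ 17 * C)^-1, (2 ^+ 17 * C + 2 * a0), e0; split => //.
  by rewrite invr_gt0 mulr_gt0// exprn_gt0.
move=> n d n1 d0 d20 de nd; set T := S d => ST.
have d02 : 0 < d <= 2^-1 by rewrite d0/=; lra.
have ad : a0 <= h d by rewrite -he0 (h_noninc h_decr).
have tip := hcut_integral_le_tip h_ge0 h_cont h_decr h_int l1 l2 a00 ha0 ratio d02 ad.
rewrite -/T -/C in tip.
apply: (le_trans (monic_err_upper_cheb h_ge0 h_cont h_decr w_def rho_def n1 d0 d20 nd)).
apply: (@le_trans _ _ (expR (1 - h d * d / 2 ^+ 16))).
  by rewrite expRD ler_wpM2r ?expR_ge0// expR1_ge2.
rewrite ler_expR.
move: (h d * d) tip => x tip.
have p16 : 0 < 2 ^+ 16 :> R by rewrite exprn_gt0.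
have E : (2 ^+ 17 * C)^-1 * T = T / C / 2 ^+ 17.
  by field; rewrite gt_eqF.
rewrite E.
have q1 : 2 ^+ 17 + 2 * a0 / C <= T / C.
  by rewrite ler_pdivlMr// mulrDl divfK ?gt_eqF.
have q2 : T / C <= x + a0 / C.
  by rewrite ler_pdivrMr// mulrDl divfK ?gt_eqF// mulrC.
rewrite -mulrA in q1.
move: (T / C) (a0 / C) q1 q2 => u v q1 q2; lra.
Qed.

End decay.

Theorem theorem14 (R : realType) (h : R -> R)
  (h_ge0 : forall a, 0 < a <= 2^-1 -> 0 <= h a)
  (h_cont : {within `]0, 2^-1], continuous h})
  (h_decr : forall a b, 0 < a -> a < b -> b <= 2^-1 -> h b < h a)
  (h_int : (\int[lebesgue_measure]_(a in `]0%R, (2^-1)%R]) (h a)%:E = +oo)%E)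
  (h_reg :
    ((forall a b, 0 < a -> a <= b -> b <= 2^-1 ->
        a ^+ 2 * h a <= b ^+ 2 * h b) /\
     (fun theta : R => `|ln theta| : R^o) =O_ (0^'+) (h : R -> R^o))
    \/
    (limf_esup (fun a : R => (hinv h a / hinv h (2 * a))%:E) (pinfty_nbhs R)
       < 2%:E)%E)
  (rho : {finite_measure set (circle R) -> \bar R})
  (w : circle R -> R)
  (w_def : forall theta : R, 0 < `|theta| <= 2^-1 ->
     w (circle_pt theta) = expR (- h `|theta|))
  (rho_def : forall E : set (circle R), measurable E ->
     (rho E = \int[@circle_measure R]_(t in E) (w t)%:E)%E) :
  exists c C : R, [/\ 0 < c, 0 < C & exists n0 : nat, forall n : nat,
    (n0 <= n)%N -> exists2 A : R, unique (is_level h n) A &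
      c * (\int[lebesgue_measure]_(a in `]0, 2^-1]) Num.min (h a) A)
        <= `|ln (monic_err n rho)|
        <= C * (\int[lebesgue_measure]_(a in `]0, 2^-1]) Num.min (h a) A)].
Proof.
have [c [s0 [e0 [c0 e00 upper]]]] : decay_rate h rho.
  case: h_reg => [[reg _]|reg].
  - exact: (decay_rate_multiscale h_ge0 h_cont h_decr w_def rho_def reg).
  - exact: (decay_rate_doubling h_ge0 h_cont h_decr h_int w_def rho_def reg).
have [e1 /andP[e10 e12] Se1] := hcut_integral_unbounded h_ge0 h_cont h_decr h_int (Num.max s0 1).
have [e2 /andP[e20 e22] he2] := h_unbounded h_ge0 h_cont h_decr h_int 1.
(* For [d <= e] both the integral and the level are at least [1], and the decay
   estimate applies. *)
pose e := Num.min (Num.min e0 20^-1) (Num.min e1 e2).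
have e_gt0 : 0 < e by rewrite !lt_min e00 e10 e20 invr_gt0 ltr0n.
have ee0 : e <= e0 by rewrite /e !ge_min lexx.
have ee20 : e <= 20^-1 by rewrite /e !ge_min lexx !orbT.
have ee1 : e <= e1 by rewrite /e !ge_min lexx !orbT.
have ee2 : e <= e2 by rewrite /e !ge_min lexx !orbT.
have e02 : 0 < e <= 2^-1 by rewrite e_gt0 (le_trans ee1).
(* [2^-1 + 2060 * S <= 2061 * S] as soon as [S >= 1]. *)
exists c; exists 2061; split; [exact: c0|by rewrite ltr0n|].
pose B := Num.max (h e / e) (Num.max (2 * h 2^-1) 2).
exists (Num.bound B).+1 => n nB.
have nBr : B < n%:R.
  have B0 : 0 <= B by rewrite !le_max ler0n !orbT.
  rewrite (lt_le_trans (archi_boundP B0))// ler_nat.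
  exact: leq_trans (leqnSn _) nB.
move: nBr; rewrite /B !gt_max => /andP[ne /andP[nh n2]].
have n1 : (1 < n)%N by rewrite ltnW// -(ltr_nat R).
have [d [d02 nd uniq_d]] := level_exists h_ge0 h_cont h_decr h_int (ltW nh).
exists (h d); first exact: uniq_d.
have de : d <= e.
  by apply: (level_small h_decr d02 e02 nd); rewrite -ltr_pdivrMr.
have /andP[d0 d2] := d02.
have d20 : d <= 20^-1 by exact: le_trans ee20.
have hd1 : 1 <= h d.
  rewrite (le_trans (ltW he2))// (h_noninc h_decr)// (le_trans de)//.
rewrite (Rintegral_min_hcut h_cont h_decr d02).
have Sd : Num.max s0 1 <= \int[lebesgue_measure]_(x in `[0, 2^-1]) hcut h d x.
  apply: (le_trans Se1); apply: hcut_integral_mono => //.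
  exact: le_trans ee1.
move: Sd; rewrite ge_max => /andP[Ss0 S1].
have lower := monic_err_ge_hcut h_ge0 h_cont h_decr w_def rho_def (ltnW n1) d0 d20 nd hd1.
have {}upper := upper n d n1 d0 d20 (le_trans de ee0) nd Ss0.
have err0 : 0 < monic_err n rho by exact: lt_le_trans (expR_gt0 _) lower.
have err1 := monic_err_le1 h_ge0 h_cont w_def rho_def n.
rewrite ler0_norm ?ln_le0//.
have := lower; rewrite -ler_ln ?posrE ?expR_gt0// expRK => lo.
have := upper; rewrite -ler_ln ?posrE ?expR_gt0// expRK => up.
apply/andP; split; first by rewrite lerNr.
by clear -lo S1; lra.
Qed.
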